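(* Let $N\ge2$, $p>1$, $q=\frac{2p}{p+1}$, and let $$M\ge M_0:=2^{-\frac{p-1}{p+1}}(6N)^{\frac{p}{p+1}}(N+2)^{\frac{p-1}{p+1}}(p-1)^{\frac{p-1}{p+1}}p^{-\frac{p}{p+1}}(p+1).$$ (i) There exists a constant $C=C(N,M,p)>0$ such that, for every domain $\Omega\subset\mathbb R^N$ and every positive solution $u$ of $-\Delta u=u^p+M|\nabla u|^q$ in $\Omega$, $$u(x)+|\nabla u(x)|^{\frac{2}{p+1}}\le C\,\mathrm{dist}^{-\frac{2}{p-1}}(x,\partial\Omega),\qquad x\in\Omega.$$ Consequently, the equation $-\Delta u=u^p+M|\nabla u|^q$ possesses no positive solution in $\mathbb R^N$. (ii) There exists a constant $C=C(N,M,p)>0$ such that, for every domain $\Omega\subset\mathbb R^N$, every $m>0$ and every positive solution $u$ of $-\Delta u=u^p+M|\nabla u|^q$ in $\Omega$ with $u\le m$ in $\Omega$, $$|\nabla u(x)|\le C\,m\,\mathrm{dist}^{-1}(x,\partial\Omega),\qquad x\in\Omega.$$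
   Context: A solution of $-\Delta u=u^p+M|\nabla u|^q$ in $\Omega$ means a weak solution: a function $u\in C^1(\Omega)$ with $|\nabla u|^q\in L^1_{\rm loc}(\Omega)$ and $\int_\Omega\langle\nabla u,\nabla\psi\rangle=\int_\Omega u^p\psi+M\int_\Omega|\nabla u|^q\psi$ for all $\psi\in C_0^\infty(\Omega)$. Positive means $u>0$ in $\Omega$. $\mathrm{dist}^{-s}(x,\partial\Omega)$ denotes $(\mathrm{dist}(x,\partial\Omega))^{-s}$; if $\Omega=\mathbb R^N$ the distance is $+\infty$ and its negative powers are $0$. *)

(* Defs.v *)
From HB Require Import structures.
From mathcomp Require Import all_boot all_order all_algebra.
From mathcomp Require Import all_classical all_reals all_analysis.

Set Implicit Arguments.
Unset Strict Implicit.
Unset Printing Implicit Defensive.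

Import Order.TTheory GRing.Theory Num.Theory.
Import numFieldNormedType.Exports.

Local Open Scope classical_set_scope.
Local Open Scope ring_scope.

Fact rV_display : measure_display. Proof. exact: measure_tuple_display. Qed.

Section rV_measurable.
Context {R : realType} {n : nat}.

(* Row vectors carry the sigma-algebra generated by the coordinates, like
   the tuples of the library. *)
Definition rV_coord (i : 'I_n) (v : 'rV[R]_n) : measurableTypeR R := v ord0 i.

Let rV_set0 : g_sigma_preimage rV_coord set0.
Proof. exact: sigma_algebra0. Qed.

Let rV_setC A : g_sigma_preimage rV_coord A -> g_sigma_preimage rV_coord (~` A).
Proof. exact: sigma_algebraC. Qed.

Let rV_bigcup (F : (set 'rV[R]_n)^nat) :
  (forall i, g_sigma_preimage rV_coord (F i)) ->
  g_sigma_preimage rV_coord (\bigcup_i (F i)).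
Proof. exact: sigma_algebra_bigcup. Qed.

HB.instance Definition _ := @isMeasurable.Build rV_display
  'rV[R]_n (g_sigma_preimage rV_coord) rV_set0 rV_setC rV_bigcup.

End rV_measurable.

Section rV_measurable_fun.
Context {R : realType}.

Lemma measurable_rV_coord n (i : 'I_n) :
  measurable_fun [set: 'rV[R]_n] (@rV_coord R n i).
Proof.
move=> _ Y mY; rewrite setTI; apply: sub_sigma_algebra => /=.
rewrite -bigcup_seq/=; exists i => /=; first by rewrite mem_index_enum.
by exists Y => //; rewrite setTI.
Qed.

Lemma measurable_fun_rVP d (T : measurableType d) n (f : T -> 'rV[R]_n) :
  (forall i, measurable_fun [set: T] (@rV_coord R n i \o f)) ->
  measurable_fun [set: T] f.
Proof.
move=> mf _ A mA; rewrite setTI.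
have : g_sigma_preimage (@rV_coord R n) A by exact: mA.
move: A {mA}; apply: smallest_sub.
  split=> [|A /= mA|F /= mF].
  - by rewrite /= preimage_set0.
  - by rewrite setTD -preimage_setC; exact: measurableC.
  - by rewrite /= preimage_bigcup; exact: bigcupT_measurable.
move=> A; rewrite -bigcup_seq/= => -[i _ [B mB <-]] /=; rewrite setTI.
by have := mf i measurableT B mB; rewrite setTI.
Qed.

Definition rV_cons n (z : measurableTypeR R * 'rV[R]_n) : 'rV[R]_n.+1 :=
  \row_i if unlift ord0 i is Some j then z.2 ord0 j else z.1.

Definition rV_uncons n (v : 'rV[R]_n.+1) : measurableTypeR R * 'rV[R]_n :=
  (v ord0 ord0, \row_i v ord0 (lift ord0 i)).

Lemma rV_consK n : cancel (@rV_cons n) (@rV_uncons n).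
Proof.
move=> [x v]; apply: injective_projections => /=; first by rewrite mxE unlift_none.
by apply/rowP => i; rewrite !mxE liftK.
Qed.

Lemma measurable_rV_cons n : measurable_fun setT (@rV_cons n).
Proof.
apply: measurable_fun_rVP => i.
rewrite (_ : _ \o _ = fun z : measurableTypeR R * 'rV[R]_n =>
    if unlift ord0 i is Some j then rV_coord j z.2 else z.1); last first.
  by apply/funext => z; rewrite /= /rV_coord mxE.
case: (unlift ord0 i) => [j|]; last exact: measurable_fst.
exact: (measurableT_comp (measurable_rV_coord j)).
Qed.

Lemma measurable_rV_uncons n : measurable_fun setT (@rV_uncons n).
Proof.
apply/measurable_fun_pairP; split; first exact: measurable_rV_coord.
apply: measurable_fun_rVP => i.
rewrite (_ : _ \o _ = @rV_coord R n.+1 (lift ord0 i)).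
  exact: measurable_rV_coord.
by apply/funext => v; rewrite /= /rV_coord mxE.
Qed.

End rV_measurable_fun.

Section lebesgue_rV_step.
Context {R : realType} (n : nat).
Variable mu : {sigma_finite_measure set 'rV[R]_n -> \bar R}.
Local Open Scope ereal_scope.

Definition lebesgue_rV_step : set 'rV[R]_n.+1 -> \bar R :=
  pushforward (lebesgue_measure \x mu) (@rV_cons R n).

Let measurable_preimage A : measurable A -> measurable (@rV_cons R n @^-1` A).
Proof. by move=> mA; rewrite -[X in measurable X]setTI; exact: measurable_rV_cons. Qed.

Let step0 : lebesgue_rV_step set0 = 0.
Proof. by rewrite /lebesgue_rV_step /pushforward preimage_set0 measure0. Qed.

Let step_ge0 A : 0 <= lebesgue_rV_step A.
Proof. by rewrite /lebesgue_rV_step /pushforward measure_ge0. Qed.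

Let step_sigma_additive : semi_sigma_additive lebesgue_rV_step.
Proof.
move=> F mF tF mUF; rewrite /lebesgue_rV_step /pushforward preimage_bigcup.
apply: measure_semi_sigma_additive.
- by move=> k; exact: measurable_preimage.
- apply/trivIsetP => /= i j _ _ ij; rewrite -preimage_setI.
  by move/trivIsetP : tF => /(_ _ _ _ _ ij) ->//; rewrite preimage_set0.
- by rewrite -preimage_bigcup; exact: measurable_preimage.
Qed.

HB.instance Definition _ := isMeasure.Build _ _ _ lebesgue_rV_step
  step0 step_ge0 step_sigma_additive.

(* The library's instance is hidden by the one for subprobabilities. *)
Let product_sigma_finite :
  sigma_finite setT (@lebesgue_measure R \x mu).
Proof.
have /sigma_finiteP[F [TF ndF Foo]] := sigma_finiteT (@lebesgue_measure R).
have /sigma_finiteP[G [TG ndG Goo]] := sigma_finiteT mu.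
exists (fun k => F k `*` G k).
  rewrite -setXTT TF TG; apply/seteqP; split=> [[x y]|[x y] [k _ []/= ? ?]].
    move=> [/= [j _ Fx] [k _ Gy]]; exists (maxn j k) => //; split.
    - by move: x Fx; exact/subsetPset/ndF/leq_maxl.
    - by move: y Gy; exact/subsetPset/ndG/leq_maxr.
  by split; exists k.
move=> k; have [mF Fk] := Foo k; have [mG Gk] := Goo k.
split; first exact: measurableX.
by rewrite product_measure1E// lte_mul_pinfty// ge0_fin_numE.
Qed.

Let step_sigma_finite : sigma_finite setT lebesgue_rV_step.
Proof.
have [F TF Foo] := product_sigma_finite.
exists (fun k => @rV_uncons R n @^-1` F k).
  by rewrite -preimage_bigcup -TF preimage_setT.
move=> k; have [mF Fk] := Foo k; split.
  by rewrite -[X in measurable X]setTI; exact: measurable_rV_uncons.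
rewrite /lebesgue_rV_step /pushforward -comp_preimage.
by rewrite (_ : _ \o _ = id) ?preimage_id//; apply/funext; exact: rV_consK.
Qed.

HB.instance Definition _ := Measure_isSigmaFinite.Build _ _ _ lebesgue_rV_step
  step_sigma_finite.

End lebesgue_rV_step.

Fixpoint lebesgue_rV (R : realType) n :
    {sigma_finite_measure set 'rV[R]_n -> \bar R} :=
  match n with
  | 0 => dirac (0 : 'rV[R]_0)
  | n.+1 => lebesgue_rV_step (lebesgue_rV R n)
  end.

Lemma lebesgue_rV_box (R : realType) n (A : 'I_n -> set (measurableTypeR R)) :
  (forall i, measurable (A i)) ->
  (lebesgue_rV R n [set v | forall i, A i (v ord0 i)] =
   \prod_(i < n) lebesgue_measure (A i))%E.
Proof.
elim: n A => [|n IHn] A mA /=.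
  by rewrite big_ord0 diracE mem_set//= => -[].
rewrite big_ord_recl -IHn//.
rewrite /lebesgue_rV_step /pushforward.
rewrite (_ : _ @^-1` _ =
  A ord0 `*` [set v : 'rV[R]_n | forall i, A (lift ord0 i) (v ord0 i)]).
  rewrite product_measure1E//.
  rewrite (_ : [set _ | _] = \bigcap_(i in [set: 'I_n])
    (@rV_coord R n i @^-1` A (lift ord0 i))).
    apply: fin_bigcap_measurable => // i _.
    by rewrite -[X in measurable X]setTI; exact: measurable_rV_coord.
  by apply/seteqP; split => v /= Av i => [_|]; exact: Av.
apply/seteqP; split => -[x v] /=.
  move=> Av; split; first by have := Av ord0; rewrite mxE unlift_none.
  by move=> i; have := Av (lift ord0 i); rewrite mxE liftK.
move=> [Ax Av] i; rewrite mxE.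
by case: unliftP => [j ->|->] //=.
Qed.

Section calculus.
Context {R : realType} {N : nat}.
Implicit Types (x y : 'rV[R]_N) (Omega K : set 'rV[R]_N) (f u psi : 'rV[R]_N -> R).

(* The norm `|x| of the library on row vectors is the sup norm. *)
Definition dot x y : R := \sum_(i < N) x ord0 i * y ord0 i.
Definition enorm x : R := Num.sqrt (dot x x).

Definition partial (i : 'I_N) f : 'rV[R]_N -> R :=
  'D_(delta_mx ord0 i : 'rV[R]_N) f.

Definition grad f x : 'rV[R]_N := \row_i partial i f x.

Fixpoint Cn (k : nat) Omega f : Prop :=
  match k with
  | 0 => forall x, Omega x -> {for x, continuous f}
  | k.+1 => (forall x, Omega x -> differentiable f x) /\
            forall i, Cn k Omega (partial i f)
  end.

Definition test_function Omega psi :=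
  [/\ forall k, Cn k setT psi,
      compact (closure [set x | psi x != 0]) &
      closure [set x | psi x != 0] `<=` Omega].

Definition L1loc Omega f := forall K, compact K -> K `<=` Omega ->
  (lebesgue_rV R N).-integrable K (EFin \o f).

Definition domain Omega := [/\ Omega !=set0, open Omega & connected Omega].

Definition boundary Omega := closure Omega `\` interior Omega.

(* +oo when the boundary is empty *)
Definition dist x Omega : \bar R :=
  ereal_inf [set (enorm (x - y))%:E | y in boundary Omega].

(* dist(x, boundary of Omega)^-s, with (+oo)^-s = 0; the distance is positive
   for x in an open Omega, so 0^-s does not occur. *)
Definition distN (s : R) x Omega : R :=
  if dist x Omega is r%:E then r `^ (- s) else 0.

End calculus.

(* As Omega is open, the values of u outside Omega are irrelevant; u^p is the
   real power, meant for u > 0. *)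
Section equation.
Context {R : realType} {N : nat}.
Implicit Types (p q M : R) (Omega : set 'rV[R]_N) (u : 'rV[R]_N -> R).
Local Notation mu := (lebesgue_rV R N).

Definition solution p q M Omega u :=
  [/\ Cn 1 Omega u,
      L1loc Omega (fun x => enorm (grad u x) `^ q) &
      forall psi, test_function Omega psi ->
        \int[mu]_(x in Omega) dot (grad u x) (grad psi x) =
        \int[mu]_(x in Omega) (u x `^ p * psi x) +
        M * \int[mu]_(x in Omega) (enorm (grad u x) `^ q * psi x)].

Definition positive_solution p q M Omega u :=
  solution p q M Omega u /\ forall x, Omega x -> 0 < u x.

End equation.

Definition M0 (R : realType) (N : nat) (p : R) : R :=
  2 `^ (- ((p - 1) / (p + 1))) * (6 * N%:R) `^ (p / (p + 1)) *
  (N%:R + 2) `^ ((p - 1) / (p + 1)) * (p - 1) `^ ((p - 1) / (p + 1)) *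
  p `^ (- (p / (p + 1))) * (p + 1).

(* Main.v *)
Require Import Defs.
From HB Require Import structures.
From mathcomp Require Import all_boot all_order all_algebra.
From mathcomp Require Import all_classical all_reals all_analysis.
From mathcomp Require Import measurable_realfun ring lra.

Set Implicit Arguments.
Unset Strict Implicit.
Unset Printing Implicit Defensive.

Import Order.TTheory GRing.Theory Num.Theory.
Import numFieldNormedType.Exports.

Local Open Scope classical_set_scope.
Local Open Scope ring_scope.

(* A Bernstein argument that needs no second derivatives.  Write the equation
   as -Delta u = F with F continuous.  The maximum of |grad u|^2 minus a
   barrier is replaced by that of
     u(x) - u(y) - |x - y|^2 / (2 d) - d B(y),
   with d small and B a barrier blowing up at the boundary of a ball of radius
   R; there x - y = d grad u(x).  Testing the weak equation with dilates of a
   radial bump shows that the averages of u over balls of radius s about x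
   differ from u(x) by a multiple of s^2 F(x) up to o(s^2), so the maximum may
   be compared along x + a w and y + b w for any a, b >= 0.  With b = 1 and
   a = 1 - d F(x) / (2 N) this gives, as d tends to 0, a lower bound
     F^2 / (2 N) <= 2 p u^(p-1) |grad u|^2 + barrier terms,
   whereas M >= M0 and the arithmetic-geometric mean inequality yield
   F^2 >= 8 N p u^(p-1) |grad u|^2.  Hence |grad u| <= C R^(-1/(q-1)).
   If u(x) is large compared with R^(-2/(p-1)), this bound keeps u above u(x)/2
   on a ball of radius R/2, which contradicts -Delta u >= u^p on comparison
   with a paraboloid.  For solutions bounded by m the same bound suffices when
   1 <= m^(p-1) R^2; otherwise the linear interior gradient estimate, applied
   where (R - |y - x|) |grad u(y)| is largest, can absorb the term |grad u|^q. *)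

(** * Euclidean geometry of row vectors *)

(** As u is only C^1 and F contains |grad u|^q, the equation cannot be differentiated and no Hessian
    is available at a maximum. The doubled function is a finite-difference form of the Bernstein
    quantity: for a smooth u, maximising over x leaves d (|grad u(y)|^2 / 2 - B(y)) up to O(d^2).
    Moving both points by the same w would only compare F(x) with F(y), the counterpart of the term
    grad u . grad F in Bernstein's identity. The counterpart of |D^2 u|^2 >= (Delta u)^2 / N comes
    from unequal speeds: a = 1 - d s costs d s^2 / 2 in the penalty and gains about 2 d s F(x); once
    d F(x) <= N, the best s is F(x) / (2 N). Every term is then a multiple of d, so d need only be
    small and no limit is taken. Half of F^2 / (2 N) absorbs the term in u^(p-1) |grad u|^2. The
    other half keeps M^2 |grad u|^(2 q) / (4 N) against the barrier, so the first- and second-order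
    terms of the barrier must be small multiples of |grad u|^(2 q); this dictates its blow-up
    exponent and the power of R. *)

Section euclid.
Context {R : realType} {N : nat}.
Implicit Types (x y z : 'rV[R]_N) (a b : R).

Lemma dotC x y : dot x y = dot y x.
Proof. by apply: eq_bigr => i _; rewrite mulrC. Qed.

Lemma dotDl x y z : dot (x + y) z = dot x z + dot y z.
Proof. by rewrite /dot -big_split/=; apply: eq_bigr => i _; rewrite mxE mulrDl. Qed.

Lemma dotZl a x y : dot (a *: x) y = a * dot x y.
Proof. by rewrite /dot mulr_sumr; apply: eq_bigr => i _; rewrite mxE mulrA. Qed.

Lemma dotDr x y z : dot x (y + z) = dot x y + dot x z.
Proof. by rewrite dotC dotDl !(dotC x). Qed.

Lemma dotZr a x y : dot x (a *: y) = a * dot x y.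
Proof. by rewrite dotC dotZl dotC. Qed.

Lemma dotNl x y : dot (- x) y = - dot x y.
Proof. by rewrite -scaleN1r dotZl mulN1r. Qed.

Lemma dotNr x y : dot x (- y) = - dot x y.
Proof. by rewrite dotC dotNl dotC. Qed.

Lemma dot0l x : dot 0 x = 0.
Proof. by rewrite /dot big1// => i _; rewrite mxE mul0r. Qed.

Lemma dot0r x : dot x 0 = 0.
Proof. by rewrite dotC dot0l. Qed.

Definition dotE := (dotDl, dotDr, dotZl, dotZr, dotNl, dotNr, dot0l, dot0r).

Lemma dot_ge0 x : 0 <= dot x x.
Proof. by apply: sumr_ge0 => i _; rewrite -expr2 sqr_ge0. Qed.

Lemma enorm_ge0 x : 0 <= enorm x.
Proof. exact: sqrtr_ge0. Qed.

Lemma sqr_enorm x : enorm x ^+ 2 = dot x x.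
Proof. by rewrite sqr_sqrtr// dot_ge0. Qed.

Lemma coord_le_enorm x i : `|x ord0 i| <= enorm x.
Proof.
rewrite -sqrtr_sqr ler_wsqrtr// expr2 /dot (bigD1 i)//= lerDl.
by apply: sumr_ge0 => j _; rewrite -expr2 sqr_ge0.
Qed.

Lemma enorm_eq0 x : (enorm x == 0) = (x == 0).
Proof.
apply/eqP/eqP => [x0|->]; last by rewrite /enorm dot0l sqrtr0.
apply/rowP => i; rewrite mxE; apply/eqP; rewrite -normr_eq0 eq_le normr_ge0 andbT.
by rewrite -x0 coord_le_enorm.
Qed.

Lemma enorm0 : enorm (0 : 'rV[R]_N) = 0.
Proof. by apply/eqP; rewrite enorm_eq0. Qed.

Lemma enormZ a x : enorm (a *: x) = `|a| * enorm x.
Proof.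
by rewrite /enorm dotZl dotZr mulrA -expr2 sqrtrM ?sqr_ge0// sqrtr_sqr.
Qed.

Lemma enormN x : enorm (- x) = enorm x.
Proof. by rewrite -scaleN1r enormZ normrN1 mul1r. Qed.

Lemma CauchySchwarz_dot x y : `|dot x y| <= enorm x * enorm y.
Proof.
have [/eqP|x0] := eqVneq (enorm x) 0.
  by rewrite enorm_eq0 => /eqP ->; rewrite dot0l normr0 enorm0 mul0r.
have x_gt0 : 0 < enorm x by rewrite lt_def x0 enorm_ge0.
rewrite -(ler_pXn2r (n := 2))// ?nnegrE ?mulr_ge0 ?enorm_ge0// exprMn !sqr_enorm.
have := dot_ge0 (dot x x *: y - dot x y *: x).
rewrite !dotE (dotC y x) => h.
rewrite real_normK ?num_real//.
have xx : 0 < dot x x by rewrite -sqr_enorm exprn_gt0.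
rewrite -(ler_pM2l xx).
nra.
Qed.

Lemma dot_le_enorm x y : dot x y <= enorm x * enorm y.
Proof. exact: le_trans (ler_norm _) (CauchySchwarz_dot x y). Qed.

Lemma enormD x y : enorm (x + y) <= enorm x + enorm y.
Proof.
rewrite -(ler_pXn2r (n := 2))// ?nnegrE ?addr_ge0 ?enorm_ge0//.
rewrite sqr_enorm !dotE sqrrD !sqr_enorm (dotC y x).
have := dot_le_enorm x y; lra.
Qed.

Lemma enorm_le_mx_norm x : enorm x <= N%:R * `|x|.
Proof.
rewrite -(ler_pXn2r (n := 2))// ?nnegrE ?mulr_ge0 ?enorm_ge0//.
have cx i : `|x ord0 i| <= `|x|.
  rewrite [leRHS]/Num.norm/= mx_normrE.
  exact: (le_bigmax _ (fun ij : 'I_1 * 'I_N => `|x ij.1 ij.2|) (ord0, i)).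
rewrite sqr_enorm (@le_trans _ _ (\sum_(i < N) `|x| ^+ 2))//.
  apply: ler_sum => i _; rewrite -expr2 -[leLHS]real_normK ?num_real//.
  by rewrite lerXn2r ?nnegrE.
rewrite sumr_const card_ord -[leLHS]mulr_natl exprMn ler_wpM2r ?sqr_ge0//.
by rewrite -natrX ler_nat; case: (N) => // n; rewrite -{1}(expn1 n.+1) leq_pexp2l.
Qed.

Lemma mx_norm_le_enorm x : `|x| <= enorm x.
Proof.
rewrite [leLHS]/Num.norm/= mx_normrE; apply/bigmax_leP; split; first exact: enorm_ge0.
by move=> [i j] _ /=; rewrite ord1 coord_le_enorm.
Qed.

Lemma cvg_dot (T : Type) (F : set_system T) (f g : T -> 'rV[R]_N) x y :
  Filter F -> f @ F --> x -> g @ F --> y ->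
  (fun t => dot (f t) (g t)) @ F --> dot x y.
Proof.
move=> FF fx gy; rewrite /dot; apply: cvg_big => [|i _]; first exact: add_continuous.
apply: cvgM.
  by apply: (@cvg_comp _ _ _ f (fun v : 'rV[R]_N => v ord0 i) _ _ _ fx);
    exact: coord_continuous.
by apply: (@cvg_comp _ _ _ g (fun v : 'rV[R]_N => v ord0 i) _ _ _ gy);
  exact: coord_continuous.
Qed.

Lemma cvg_enorm (T : Type) (F : set_system T) (f : T -> 'rV[R]_N) x :
  Filter F -> f @ F --> x -> (fun t => enorm (f t)) @ F --> enorm x.
Proof.
move=> FF fx; apply: (@cvg_comp _ _ _ (fun t => dot (f t) (f t)) Num.sqrt _ _ _ (cvg_dot FF fx fx)).
exact: sqrt_continuous.
Qed.

Lemma continuous_enorm : continuous (@enorm R N).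
Proof. by move=> x; exact: (@cvg_enorm _ (nbhs x) id x). Qed.

Definition eball x a : set 'rV[R]_N := [set y | enorm (y - x) <= a].

Lemma eball_center x a : 0 <= a -> eball x a x.
Proof. by rewrite /eball/= subrr enorm0. Qed.

Lemma closed_eball x a : closed (eball x a).
Proof.
apply: (@preimage_closed _ _ (fun y => enorm (y - x)) [set t | t <= a]).
  move=> y _; apply: (@cvg_enorm _ (nbhs y) (fun z => z - x)).
  by apply: cvgB; [exact: cvg_id|exact: cvg_cst].
exact: closed_le.
Qed.

Lemma compact_eball x a : compact (eball x a).
Proof.
apply: bounded_closed_compact; last exact: closed_eball.
exists (`|x| + a); split; first exact: num_real.
move=> b ab y yx; apply: le_trans (ltW ab).
rewrite -[y](subrK x) addrC (le_trans (ler_normD _ _))// lerD2l.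
exact: le_trans (mx_norm_le_enorm _) yx.
Qed.

Lemma eballS x a b : a <= b -> eball x a `<=` eball x b.
Proof. by move=> ab y yx; exact: le_trans yx ab. Qed.

Lemma eball_sub x y a b : enorm (y - x) + b <= a -> eball y b `<=` eball x a.
Proof.
move=> h z zy; rewrite /eball/= -(subrK y z) -addrA.
apply: le_trans (enormD _ _) _; apply: le_trans _ h.
by rewrite [leLHS]addrC lerD2l.
Qed.

Lemma nbhs_eball x (A : set 'rV[R]_N) : nbhs x A <-> exists2 e, 0 < e & eball x e `<=` A.
Proof.
split.
  move=> /nbhs_ballP[e /= e0 eA]; exists (e / 2); first by rewrite divr_gt0.
  move=> y yx; apply: eA; rewrite -ball_normE /= distrC.
  rewrite (le_lt_trans (mx_norm_le_enorm _))// (le_lt_trans yx)//.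
  by rewrite ltr_pdivrMr// ltr_pMr// ltr1n.
move=> [e e0 eA]; apply/nbhs_ballP; exists (e / N.+1%:R) => /=.
  by rewrite divr_gt0.
move=> y; rewrite -ball_normE /= => yx; apply: eA.
rewrite /eball/= (le_trans (enorm_le_mx_norm _))// distrC.
rewrite (@le_trans _ _ (N.+1%:R * `|x - y|))//.
  by rewrite ler_wpM2r// ler_nat.
by rewrite mulrC -ler_pdivlMr// ltW.
Qed.

End euclid.

(** * Uniform continuity and derivatives along lines *)

Section calculus_lemmas.
Context {R : realType} {N : nat}.
Implicit Types (x y w : 'rV[R]_N) (Omega K : set 'rV[R]_N) (u : 'rV[R]_N -> R).

(** The second point may leave K, because f is continuous at the points of K as points of the whole
    space. *)
Lemma compact_unif_continuous (V : normedModType R) (f : 'rV[R]_N -> V) K (e : R) :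
  compact K -> (forall x, K x -> {for x, continuous f}) -> 0 < e ->
  exists2 d : R, 0 < d &
    forall x y, K x -> enorm (y - x) <= d -> `|f y - f x| <= e.
Proof.
move=> /compact_near_coveringP cK cf e0.
have : \forall d \near 0^'+, K `<=` [set x | forall y, enorm (y - x) <= d -> `|f y - f x| <= e].
  apply: cK => x Kx.
  have : \forall y \near x, `|f y - f x| <= e / 2.
    have := cf x Kx; rewrite /continuous_at => /cvgrPdist_le/(_ (e / 2)).
    rewrite divr_gt0// => /(_ isT); apply: filterS => y; by rewrite distrC.
  move=> /nbhs_eball[r r0 rf].
  exists (eball x (r / 2), [set d : R | d <= r / 2]) => /=.
    split; first by apply/nbhs_eball; exists (r / 2); rewrite ?divr_gt0.
    by apply: nbhs_right_le; rewrite divr_gt0.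
  move=> [x' d] /= [x'x dr] y yx'.
  rewrite -(subrK (f x) (f y)) -addrA (le_trans (ler_normD _ _))//.
  rewrite [leRHS]splitr lerD//.
    apply: rf; apply: (@eball_sub _ _ x x' r (r / 2)).
      by rewrite [leRHS]splitr lerD2r.
    exact: le_trans yx' dr.
  by rewrite distrC; apply: rf; apply: eballS x'x; rewrite ler_pdivrMr// ler_pMr// ler1n.
move=> h; have [d [d0 hd]] : exists d : R, 0 < d /\ K `<=` [set x | forall y, enorm (y - x) <= d -> `|f y - f x| <= e].
  near (0 : R)^'+ => d; exists d; split; first by near: d; exact: nbhs_right_gt.
  by near: d.
by exists d => // x y Kx; exact: hd.
Unshelve. all: by end_near. Qed.

Lemma derive_dot u x w : differentiable u x -> 'D_w u x = dot (grad u x) w.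
Proof.
move=> du; rewrite deriveE// {1}(row_sum_delta w) linear_sum/=.
by apply: eq_bigr => i _; rewrite linearZ/= /grad mxE /partial deriveE// mulrC.
Qed.

Lemma is_derive_line u x w (t : R) : differentiable u (x + t *: w) ->
  is_derive t 1 (fun s => u (x + s *: w)) (dot (grad u (x + t *: w)) w).
Proof.
move=> du.
have E : (fun h : R => h^-1 *: (((fun s => u (x + s *: w)) \o shift t) (h *: (1:R)) - u (x + t *: w)))
   = (fun h : R => h^-1 *: ((u \o shift (x + t *: w)) (h *: w) - u (x + t *: w))).
  by apply/funext => h /=; rewrite [h *: 1]mulr1 scalerDl addrCA.
have dw := diff_derivable (v := w) du.
apply: DeriveDef; first by rewrite /derivable E.
by rewrite -derive_dot// /derive E.
Qed.

Lemma mvt_line u x w : (forall t : R, t \in `[0, 1]%R -> differentiable u (x + t *: w)) ->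
  exists2 t : R, t \in `]0, 1[%R & u (x + w) - u x = dot (grad u (x + t *: w)) w.
Proof.
move=> du.
have dl (t : R) : t \in `]0, 1[%R -> is_derive t 1 (fun s => u (x + s *: w)) (dot (grad u (x + t *: w)) w).
  by move=> t01; apply/is_derive_line/du/subset_itv_oo_cc.
have cl : {within `[0, 1], continuous (fun s : R => u (x + s *: w))}.
  apply: derivable_within_continuous => t t01.
  by have := is_derive_line (du t t01) => -[].
have [t t01] := MVT ltr01 dl cl; rewrite scale1r scale0r addr0 subr0 mulr1.
by exists t.
Qed.

End calculus_lemmas.

(** * Lebesgue measure on row vectors *)

Section open_measurable_rV.
Context {R : realType} {N : nat}.
Implicit Types (A : set 'rV[R]_N).

Lemma measurable_rV_box (A : 'I_N -> set (measurableTypeR R)) :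
  (forall i, measurable (A i)) ->
  measurable [set v : 'rV[R]_N | forall i, A i (v ord0 i)].
Proof.
move=> mA.
rewrite (_ : [set _ | _] = \bigcap_(i in [set: 'I_N])
    (@rV_coord R N i @^-1` A i)).
  apply: fin_bigcap_measurable => // i _.
  by rewrite -[X in measurable X]setTI; exact: measurable_rV_coord.
by apply/seteqP; split => v /= Av i => [_|]; exact: Av.
Qed.

(** Measurability refers to the sigma-algebra of the coordinates, so A is written as the countable
    union of the cubes with rational centre and half-side 1/(k+1) that it contains. *)
Lemma open_measurable_rV A : open A -> measurable A.
Proof.
move=> oA.
pose B (z : 'rV[rat]_N * nat) : set 'rV[R]_N :=
  [set v | forall i, `]ratr (z.1 ord0 i) - z.2.+1%:R^-1,
                       ratr (z.1 ord0 i) + z.2.+1%:R^-1[%classic (v ord0 i)].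
pose C z := if `[< B z `<=` A >] then B z else set0.
rewrite (_ : A = \bigcup_z C z).
  apply: countable_bigcupT_measurable => // z; rewrite /C; case: ifPn => // _.
  apply: (@measurable_rV_box (fun i => `]ratr (z.1 ord0 i) - z.2.+1%:R^-1,
    ratr (z.1 ord0 i) + z.2.+1%:R^-1[%classic)) => i; exact: measurable_itv.
apply/seteqP; split => [v Av|v [z _]]; last first.
  by rewrite /C; case: ifPn => // /asboolP; exact.
have /nbhs_ballP[e /= e0 vA] : nbhs v A by exact: open_nbhs_nbhs.
(* The point v is within 1/(k+1) of a rational centre, so the cube about that centre stays within
   2/(k+1) < e of v. *)
pose k := Num.truncn (2 / e).
have ke : (k.+1%:R : R)^-1 < e / 2.
  by rewrite invf_plt ?posrE ?divr_gt0// invf_div /k truncnS_gt.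
have k0 : 0 < (k.+1%:R : R)^-1 by rewrite invr_gt0.
move: (k) k0 ke => {}k k0 ke; set d : R := k.+1%:R^-1 in k0 ke.
have /choice[q qP] (i : 'I_N) : exists q : rat, ratr q \in `]v ord0 i - d, v ord0 i + d[.
  have /rat_in_itvoo[q] : v ord0 i - d < v ord0 i + d by lra.
  by exists q.
exists (\row_i q i, k) => //; rewrite /C.
have -> : `[< B (\row_i q i, k) `<=` A >].
  apply/asboolP => w Bw; apply: vA.
  split => // i j; rewrite ord1; have := Bw j; have := qP j.
  rewrite -/d /ball/= !in_itv/= mxE -/d.
  by rewrite ltr_norml => /andP[? ?] /andP[? ?]; apply/andP; split; lra.
move=> i /=; have := qP i; rewrite !in_itv/= mxE -/d => /andP[? ?].
by apply/andP; split; lra.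
Qed.

Lemma closed_measurable_rV A : closed A -> measurable A.
Proof. by move/closed_openC/open_measurable_rV/measurableC; rewrite setCK. Qed.

Lemma continuous_measurable_rV (f : 'rV[R]_N -> R) :
  continuous f -> measurable_fun setT f.
Proof.
move=> /continuousP cf; apply: (measurability _ (measurable_realfun.RGenOpens.measurableE R)).
move=> _ [_ [a [b ->] <-]]; rewrite setTI; apply: open_measurable_rV.
exact/cf/interval_open.
Qed.

End open_measurable_rV.

(** The measurability proof is an explicit argument, so that the pushforward comes with its measure
    structure and can be passed to [mscale]. *)
Definition pushforward_measure d d' (T1 : measurableType d)
    (T2 : measurableType d') (R : realType) (m : {measure set T1 -> \bar R})
    (f : T1 -> T2) (mf : measurable_fun setT f) : {measure set T2 -> \bar R} :=
  measure_function_pushforward__canonical__measure_function_Measure m mf.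

(** * Affine changes of variables *)

Section affine_change_of_variables.
Context {R : realType}.

(** Lebesgue measure is determined by its values on half-open intervals, and r times the pushforward
    under t -> x + r t takes the same values there. *)
Lemma lebesgue_measure_affine (x r : R) (A : set (measurableTypeR R)) :
  (0 < r)%R -> measurable A ->
  lebesgue_measure ((fun t : measurableTypeR R => (x + r * t)%R : measurableTypeR R) @^-1` A) =
  ((r^-1)%:E * lebesgue_measure A)%E.
Proof.
move=> r0 mA; pose T : measurableTypeR R -> measurableTypeR R := fun t => (x + r * t)%R.
have mT : measurable_fun setT T.
  by apply: measurable_funD => //; exact: measurable_funM.
pose m2 := mscale (NngNum (ltW r0)) (pushforward_measure lebesgue_measure mT).
have -> : lebesgue_measure A = m2 A.
  apply: lebesgue_measure_unique => // _ [[a b] _ <-].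
  have E : (T @^-1` `]a, b])%classic = `]((a - x) / r)%R, ((b - x) / r)%R]%classic.
    apply/seteqP; split => t; rewrite /T /= !in_itv/=;
      by rewrite ltr_pdivrMr// ler_pdivlMr// (mulrC t) ltrBlDl lerBrDl.
  change (lebesgue_measure `]a, b]%classic = r%:E * lebesgue_measure (T @^-1` `]a, b]))%E.
  rewrite E.
  rewrite !lebesgue_measure_itv/= !lte_fin ltr_pM2r ?invr_gt0// ltrD2r.
  case: ifPn => _; last by rewrite mule0.
  rewrite -!EFinD -EFinM; congr EFin.
  by field; rewrite gt_eqF.
by rewrite /m2 /mscale/= muleA -EFinM mulVf ?gt_eqF// mul1e.
Qed.

Context {N : nat}.
Local Notation mu := (lebesgue_rV R N).

Lemma lebesgue_rV_cube (c : R) :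
  (mu [set v | forall i, `[(- c)%R, c]%classic (v ord0 i)] < +oo)%E.
Proof.
rewrite (@lebesgue_rV_box R N (fun=> `[- c, c]%classic)); last by move=> i; exact: measurable_itv.
set P := (X in (X < +oo)%E); suff /andP[] : (0 <= P < +oo)%E by [].
apply: (@big_ind _ (fun x : \bar R => 0 <= x < +oo)%E) => //.
- by rewrite lee01 ltry.
- by move=> y z /andP[y0 yoo] /andP[z0 zoo]; rewrite mule_ge0//= lte_mul_pinfty// ge0_fin_numE.
by move=> i _; rewrite measure_ge0/= lebesgue_measure_itv/=; case: ifP => _; rewrite -?EFinD ltry.
Qed.

Definition rV_affine (x : 'rV[R]_N) (r : R) (w : 'rV[R]_N) : 'rV[R]_N := (x + r *: w)%R.

Lemma measurable_rV_affine (x : 'rV[R]_N) (r : R) : measurable_fun setT (rV_affine x r).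
Proof.
apply: measurable_fun_rVP => i.
rewrite (_ : _ \o _ = fun w => (x ord0 i + r * rV_coord i w)%R); last first.
  by apply/funext => w; rewrite /rV_affine /rV_coord/= !mxE.
apply: measurable_funD => //; apply: measurable_funM => //.
exact: measurable_rV_coord.
Qed.

(** Boxes with measurable sides are stable under intersection, generate the sigma-algebra and
    include cubes of finite measure that exhaust the space, so comparing on boxes suffices. There
    each side contributes r^-1, and r^N cancels the product. *)
Lemma lebesgue_rV_affine (x : 'rV[R]_N) (r : {posnum R}) A : measurable A ->
  mu A = mscale (r%:num ^+ N)%:nng
    (pushforward_measure mu (measurable_rV_affine x r%:num)) A.
Proof.
move=> mA.
pose G := [set [set v : 'rV[R]_N | forall i, B i (v ord0 i)] |
  B in [set B : 'I_N -> set (measurableTypeR R) | forall i, measurable (B i)]].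
pose g (k : nat) := [set v : 'rV[R]_N | forall i, `[- k%:R, k%:R]%classic (v ord0 i)].
apply: (measure_unique G g) => //.
- apply/seteqP; split => B.
    apply: smallest_sub; first exact: smallest_sigma_algebra.
    move=> C; rewrite -bigcup_seq/= => -[i _ [D mD <-]].
    apply: sub_sigma_algebra; exists (fun j => if j == i then D else setT).
      by move=> j /=; case: ifP.
    rewrite setTI; apply/seteqP; split => v /=.
      by move=> /(_ i); rewrite eqxx.
    by move=> Dv j; case: eqP => // ->.
  apply: smallest_sub; first exact: sigma_algebra_measurable.
  by move=> _ [D mD <-]; exact: measurable_rV_box.
- move=> _ _ [B mB <-] [C mC <-]; exists (fun i => B i `&` C i).
    by move=> i; apply: measurableI; [exact: mB|exact: mC].
  apply/seteqP; split => v /=; first by move=> BC; split => i; have [] := BC i.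
  by move=> [Bv Cv] i; split.
- by move=> k; exists (fun=> `[- k%:R, k%:R]%classic) => // i; exact: measurable_itv.
- apply/seteqP; split => // v _.
  exists (Num.truncn `|v|).+1 => // i.
  rewrite /= in_itv/= -ler_norml (le_trans _ (ltW (truncnS_gt _)))//.
  rewrite [leRHS]/Num.norm/= mx_normrE.
  exact: (le_bigmax _ (fun ij : 'I_1 * 'I_N => `|v ij.1 ij.2|) (ord0, i)).
- move=> _ [B mB <-]; pose T i (t : measurableTypeR R) : measurableTypeR R := x ord0 i + r%:num * t.
  have mT i : measurable_fun setT (T i).
    by apply: measurable_funD => //; exact: measurable_funM.
  have E : rV_affine x r%:num @^-1` [set v | forall i, B i (v ord0 i)] =
      [set v | forall i, (T i @^-1` B i) (v ord0 i)].
    by apply/seteqP; split => v /= Bv i; have := Bv i; rewrite /rV_affine !mxE.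
  transitivity (\prod_(i < N) lebesgue_measure (B i))%E; first exact: lebesgue_rV_box.
  transitivity ((r%:num ^+ N)%:E * mu (rV_affine x r%:num @^-1` [set v | forall i, B i (v ord0 i)]))%E; last by [].
  rewrite E (@lebesgue_rV_box R N (fun i => T i @^-1` B i)); last first.
    by move=> i; rewrite -[X in measurable X]setTI; exact: mT.
  rewrite [X in (_ * X)%E](eq_bigr (fun i => ((r%:num)^-1)%:E * lebesgue_measure (B i))%E); last first.
    by move=> i _; exact: lebesgue_measure_affine.
  rewrite big_split/= muleA [X in (X * _)%E](_ : _ = 1%E) ?mul1e//.
  rewrite prodEFin -EFinM prodr_const card_ord exprVn mulfV //.

by move=> k; exact: lebesgue_rV_cube.
Qed.

Lemma integral_rV_affine (x : 'rV[R]_N) (r : R) (f : 'rV[R]_N -> R) : (0 < r)%R ->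
  mu.-integrable setT (EFin \o f) ->
  mu.-integrable setT (EFin \o (f \o rV_affine x r)) ->
  \int[mu]_w f (x + r *: w) = r^-1 ^+ N * \int[mu]_w f w.
Proof.
move=> r0 intf intfT; pose rp := PosNum r0.
have mf := measurable_int _ intf.
have pushf : (\int[pushforward mu (rV_affine x r)]_w (f w)%:E = \int[mu]_w (f (x + r *: w))%:E)%E.
  exact: (@integral_pushforward _ _ _ _ _ (rV_affine x r) (measurable_rV_affine x r) mu setT (EFin \o f)).
have : (\int[mu]_w (f w)%:E = (r ^+ N)%:E * \int[mu]_w (f (x + r *: w))%:E)%E.
  rewrite -pushf.
  rewrite (eq_measure_integral (mscale (rp%:num ^+ N)%:nng (pushforward_measure mu (measurable_rV_affine x rp%:num)))); last first.
    by move=> A mA _; exact: (lebesgue_rV_affine x rp mA).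
  set m1 := mscale _ _.
  have sc (h : 'rV[R]_N -> \bar R) : measurable_fun setT h -> (forall w, 0 <= h w)%E ->
      (\int[m1]_w h w =
      (r ^+ N)%:E * \int[pushforward mu (rV_affine x r)]_w h w)%E.
    by move=> mh h0; exact: ge0_integral_mscale.
  (* The scaling rule [sc] is for nonnegative functions, hence the split into positive and negative
     parts. *)
  transitivity ((r ^+ N)%:E * (\int[pushforward mu (rV_affine x r)]_w (EFin \o f)^\+ w) -
      (r ^+ N)%:E * (\int[pushforward mu (rV_affine x r)]_w (EFin \o f)^\- w))%E.
    rewrite [LHS]integralE; congr (_ - _)%E; apply: sc => //.
      exact: measurable_funepos.
    exact: measurable_funeneg.
  rewrite [in RHS]integralE.
    exact: measurable_rV_affine.
  move=> mT; rewrite -muleBr//=.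
  have ip := integrable_pushforward (measurable_rV_affine x r) mf intfT measurableT.
  by apply: fin_num_adde_defr; exact: integrable_pos_fin_num ip.
move=> /(congr1 fine); rewrite fineM//; last exact: integrable_fin_num.
rewrite /Rintegral => -> /=.
by rewrite mulrA -exprMn mulVf ?gt_eqF// expr1n mul1r.
Qed.

End affine_change_of_variables.

(** * Bump functions *)

Section bump.
Context {R : realType}.
Implicit Types (t : R) (n : nat).

(* The index n makes the family closed under differentiation. *)
Definition flat n t : R := if 0 < t then t^-1 ^+ n * expR (- t^-1) else 0.

Lemma flat_ge0 n t : 0 <= flat n t.
Proof.
rewrite /flat; case: ifPn => // t0; rewrite mulr_ge0 ?expR_ge0//.
by rewrite exprn_ge0// invr_ge0 ltW.
Qed.

Lemma flat_gt0 n t : 0 < t -> 0 < flat n t.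
Proof. by move=> t0; rewrite /flat t0 mulr_gt0 ?expR_gt0// exprn_gt0// invr_gt0. Qed.

Lemma flat0 n t : t <= 0 -> flat n t = 0.
Proof. by rewrite /flat leNgt => /negbTE ->. Qed.

Lemma flatSE n t : flat n.+1 t * t = flat n t.
Proof.
have [t0|t0] := ltP 0 t; last by rewrite !flat0// mul0r.
rewrite /flat t0 exprS; set e := expR _; field.
by rewrite gt_eqF.
Qed.

(** Comes from exp(1/t) >= (1/t)^(n+1) / (n+1)!. Applied to [n.+1], it gives the derivative 0 at the
    origin, where the difference quotient of [flat n] is [flat n.+1]. *)
Lemma flat_le n t : flat n t <= n.+1`!%:R * `|t|.
Proof.
have [t0|t0] := ltP 0 t; last by rewrite flat0// mulr_ge0.
rewrite /flat t0 gtr0_norm// expRN.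
have h : (t^-1) ^+ n.+1 / n.+1`!%:R <= expR t^-1.
  apply: le_trans (expR_ge1Dxn n _); first by rewrite lerDr.
  by rewrite invr_ge0 ltW.
have f0 : 0 < n.+1`!%:R :> R by rewrite ltr0n fact_gt0.
rewrite ler_pdivrMr ?expR_gt0// -mulrA.
rewrite -ler_pdivrMl//; apply: le_trans (_ : t * (t^-1 ^+ n.+1 / n.+1`!%:R) <= _).
  by rewrite exprS le_eqVlt; apply/orP; left; apply/eqP; field; rewrite gt_eqF//= gt_eqF.
by rewrite ler_pM2l.
Qed.

Lemma is_derive_flat n t :
  is_derive t 1 (flat n) (- n%:R * flat n.+1 t + flat n.+2 t).
Proof.
have [t0|t0|->] := ltgtP t 0.
- apply: (@near_eq_is_derive _ _ _ (cst 0)).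
    near=> s; rewrite flat0//; near: s.
    by apply: filterS (lt_nbhsl t0) => s /ltW.
  by apply: is_derive_eq; rewrite !flat0 ?(ltW t0)// mulr0 addr0.
- have tn0 : t != 0 by rewrite gt_eqF.
  have dV : is_derive t 1 (fun s : R => s^-1 : R) (- t^-1 ^+ 2).
    apply: is_derive_eq; first exact: (@is_deriveV _ id _ _ _ tn0 (is_derive_id _ _)).
    by rewrite [LHS]mulr1 exprVn.
  have dE : is_derive t 1 (fun s : R => expR (- s^-1) : R) (expR (- t^-1) * t^-1 ^+ 2).
    have := @is_derive1_comp _ expR (fun s => - s^-1) _ _ _ (is_derive_expR (- t^-1)) (is_deriveN dV).
    by move/is_derive_eq; apply; rewrite opprK mulrC.
  have dX := is_deriveX n dV.
  have : is_derive t 1 (fun s : R => s^-1 ^+ n * expR (- s^-1) : R)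
      (- n%:R * flat n.+1 t + flat n.+2 t).
    have -> : (fun s : R => s^-1 ^+ n * expR (- s^-1) : R) =
        (fun s : R => s^-1 : R) ^+ n * (fun s : R => expR (- s^-1) : R).
      by apply/funext => s; rewrite exprfctE.
    have := is_deriveM dX dE.
    move/is_derive_eq; apply; rewrite /flat t0 /GRing.scale/=.
    case: n dX => [|n] _ /=; first by rewrite !(expr0,mul0r,mulr0n,addr0,mul1r); ring.
    rewrite !exprfctE !exprS expr0; move: (t^-1) => V; move: (expR (- V)) => e; ring.
  apply: near_eq_is_derive.
  near=> s; rewrite /flat ifT//; near: s.
  exact: lt_nbhsr.
- rewrite !flat0// mulr0 addr0.
  have cv : (fun h : R => h^-1 *: ((flat n \o shift 0) (h *: (1 : R)) - flat n 0)) @ 0^' --> (0 : R).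
    apply/cvgrPdist_le => e e0; near=> h.
    rewrite sub0r normrN /= [h *: 1]mulr1 addr0 (flat0 n (lexx 0)) subr0 -flatSE.
    rewrite /GRing.scale/= mulrCA mulVf ?mulr1; last by near: h; exact: nbhs_dnbhs_neq.
    rewrite ger0_norm ?flat_ge0// (le_trans (flat_le _ _))//.
    rewrite -ler_pdivlMl ?ltr0n ?fact_gt0//.
    near: h; apply: dnbhs0_le; rewrite mulr_gt0// invr_gt0 ltr0n fact_gt0//.
  by apply: DeriveDef; [apply/cvg_ex; exists 0|exact: cvg_lim cv].
Unshelve. all: by end_near. Qed.

Lemma continuous_flat n : continuous (flat n).
Proof.
move=> t; apply: differentiable_continuous; apply/derivable1_diffP.
by case: (is_derive_flat n t).
Qed.

End bump.

(** * Smooth functions and the radial kernels *)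

Section smooth.
Context {R : realType} {N : nat}.
Implicit Types (f g : 'rV[R]_N -> R) (k n : nat) (i j : 'I_N) (x w : 'rV[R]_N).

Lemma CnS k f : Cn k.+1 setT f -> Cn k setT f.
Proof.
elim: k f => [|k IHk] f [df dif].
  by move=> x _; exact/differentiable_continuous/df.
by split=> // i; exact: IHk.
Qed.

Lemma Cn_cst k (c : R) : Cn k setT (cst c : 'rV[R]_N -> R).
Proof.
elim: k c => [|k IHk] c; first by move=> x _; exact: cst_continuous.
split=> [x _|i]; first exact: differentiable_cst.
suff -> : partial i (cst c) = cst 0 by exact: IHk.
by apply/funext => x; rewrite /partial derive_cst.
Qed.

Lemma CnD k f g : Cn k setT f -> Cn k setT g -> Cn k setT (f + g).
Proof.
elim: k f g => [|k IHk] f g.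
  by move=> cf cg x _; apply: continuousD; [exact: cf|exact: cg].
move=> [df dif] [dg dig]; split=> [x _|i].
  by apply: differentiableD; [exact: df|exact: dg].
suff -> : partial i (f + g) = partial i f + partial i g by exact: IHk (dif i) (dig i).
apply/funext => x; rewrite /partial deriveD//; apply: diff_derivable.
  exact: df.
exact: dg.
Qed.

Lemma CnM k f g : Cn k setT f -> Cn k setT g -> Cn k setT (f * g).
Proof.
elim: k f g => [|k IHk] f g.
  by move=> cf cg x _; apply: continuousM; [exact: cf|exact: cg].
move=> f1 g1; have [df dif] := f1; have [dg dig] := g1; split=> [x _|i].
  by apply: differentiableM; [exact: df|exact: dg].
suff -> : partial i (f * g) = f * partial i g + g * partial i f.
  by apply: CnD; apply: IHk; by [exact: CnS|exact: dif|exact: dig].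
apply/funext => x; rewrite /partial deriveM//; apply: diff_derivable.
  exact: df.
exact: dg.
Qed.

Lemma is_derive_coord j x v : is_derive x v (fun w : 'rV[R]_N => w ord0 j) (v ord0 j).
Proof.
apply: DeriveDef; first exact/diff_derivable/differentiable_coord.
apply: cvg_lim => //; apply: cvg_near_cst.
near=> h; rewrite /= !mxE addrK /GRing.scale/= mulrA mulVf ?mul1r//.
by near: h; exact: nbhs_dnbhs_neq.
Unshelve. all: by end_near. Qed.

Lemma Cn_coord k j : Cn k setT (fun w : 'rV[R]_N => w ord0 j).
Proof.
case: k => [|k]; first by move=> x _; exact: coord_continuous.
split=> [x _|i]; first exact: differentiable_coord.
suff -> : partial i (fun w : 'rV[R]_N => w ord0 j) = cst ((i == j)%:R) by exact: Cn_cst.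
apply/funext => x; rewrite /partial.
have [_ ->] := is_derive_coord j x (delta_mx ord0 i).
by rewrite mxE eqxx eq_sym.
Qed.

Lemma Cn_sum k (I : Type) (s : seq I) (F : I -> 'rV[R]_N -> R) :
  (forall a, Cn k setT (F a)) -> Cn k setT (fun x => \sum_(a <- s) F a x).
Proof.
move=> cF; elim: s => [|a s IHs].
  rewrite (_ : (fun _ => _) = cst 0); first exact: Cn_cst.
  by apply/funext => x; rewrite big_nil.
rewrite (_ : (fun _ => _) = F a + (fun x => \sum_(b <- s) F b x)); first exact: CnD.
by apply/funext => x; rewrite big_cons.
Qed.

Lemma Cn_dot k : Cn k setT (fun w : 'rV[R]_N => dot w w).
Proof. by apply: Cn_sum => i; apply: CnM; exact: Cn_coord. Qed.

Lemma is_derive_comp_diff (f : R -> R) g x v (a : R) : differentiable g x ->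
  is_derive (g x) 1 f a -> is_derive x v (f \o g) (a * 'D_v g x).
Proof.
move=> dg [/derivable1_diffP df <-].
apply: DeriveDef; first exact/diff_derivable/differentiable_comp.
rewrite !deriveE//; last exact: differentiable_comp.
by rewrite diff_comp//= -[X in 'd f _ X = _]mulr1 [LHS]linearZ/= mulrC.
Qed.

Lemma Cn_flat k n g : (forall k, Cn k setT g) -> Cn k setT (flat n \o g).
Proof.
elim: k n => [|k IHk] n cg.
  move=> x _; apply: continuous_comp; first exact: (cg 0%N).
  exact: continuous_flat.
have dg x : differentiable g x by have [+ _] := cg 1%N; exact.
have dfg x v := is_derive_comp_diff v (dg x) (is_derive_flat n (g x)).
split=> [x _|i].
  apply: differentiable_comp => //; apply/derivable1_diffP.
  by have [] := is_derive_flat n (g x).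
rewrite (_ : partial i _ = (cst (- n%:R) * (flat n.+1 \o g) + (flat n.+2 \o g)) * partial i g).
  apply: CnM; last by have [_] := cg k.+1; exact.
  by apply: CnD; [apply: CnM; [exact: Cn_cst|exact: IHk]|exact: IHk].
by apply/funext => x; rewrite /partial; have [_ ->] := dfg x (delta_mx ord0 i).
Qed.

Lemma is_derive_affine f x (a : R) z v : differentiable f (a *: (z - x)) ->
  is_derive z v (fun z => f (a *: (z - x))) (a * 'D_v f (a *: (z - x))).
Proof.
move=> df.
have E : (fun h : R => h^-1 *: (((fun z => f (a *: (z - x))) \o shift z) (h *: v) - f (a *: (z - x))))
    = (fun h : R => h^-1 *: ((f \o shift (a *: (z - x))) (h *: (a *: v)) - f (a *: (z - x)))).
  apply/funext => h /=; congr (_ *: (f _ - _)).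
  by rewrite -addrA scalerDr !scalerA (mulrC a).
have dv := diff_derivable (v := a *: v) df.
have -> : a * 'D_v f (a *: (z - x)) = 'D_(a *: v) f (a *: (z - x)).
  by rewrite !deriveE// linearZ.
by apply: DeriveDef; rewrite /derivable /derive E.
Qed.

Lemma Cn_affine k f x (a : R) : Cn k setT f -> Cn k setT (fun z => f (a *: (z - x))).
Proof.
elim: k f => [|k IHk] f.
  move=> cf z _.
  have cA : {for z, continuous (fun z : 'rV[R]_N => a *: (z - x))}.
    have H : {for z, continuous (fun z : 'rV[R]_N => z - x)}.
      by apply: (@continuousB _ _ _ id (cst x)); [exact: cvg_id|exact: cst_continuous].
    exact: cvgZl_tmp H.
  exact: (continuous_comp cA (cf _ I)).
move=> [df dif]; split=> [z _|i].
  apply: (@differentiable_comp _ _ _ _ (fun z => a *: (z - x)) f); last exact: df.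
  by apply: differentiableZ; apply: differentiableB; exact: ex_diff.
rewrite (_ : partial i _ = cst a * (fun z => partial i f (a *: (z - x)))).
  by apply: CnM; [exact: Cn_cst|apply: IHk; exact: dif].
by apply/funext => z; have [_] := is_derive_affine (delta_mx ord0 i) (df (a *: (z - x)) I).
Qed.

Lemma test_function_affine Omega x (r : R) f : 0 < r ->
  (forall k, Cn k setT f) -> (forall w, 1 <= enorm w -> f w = 0) ->
  eball x r `<=` Omega -> test_function Omega (fun z => f (r^-1 *: (z - x))).
Proof.
move=> r0 cf f0 xr.
have S : closure [set z | f (r^-1 *: (z - x)) != 0] `<=` eball x r.
  rewrite [X in _ `<=` X]((closure_id (eball x r)).1 (@closed_eball _ _ x r)).
  apply: closureS => z /=; apply: contra_neqP; rewrite /eball/= => /negP.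
  rewrite -ltNge => zr; apply: f0; rewrite enormZ gtr0_norm ?invr_gt0//.
  by rewrite mulrC ler_pdivlMr// mul1r ltW.
split; [by move=> k; exact: Cn_affine| |exact: subset_trans xr].
apply: subclosed_compact S; [exact: closed_closure|exact: compact_eball].
Qed.

(** [kerK] is the standard bump exp(-1/(1-|x|^2)) of the unit ball, and [kerk] is the radial factor
    of its gradient: grad [kerK] at x is - [kerk] x *: x. Testing the equation with dilates of
    [kerK] thereby computes the derivative in s of [kerk]-weighted means. *)
Definition kerK x : R := flat 0 (1 - dot x x).
Definition kerk x : R := 2 * flat 2 (1 - dot x x).

Lemma kerK_smooth k : Cn k setT kerK.
Proof.
apply: (@Cn_flat k 0 (fun x => 1 - dot x x)) => {}k.
rewrite (_ : (fun _ => _) = cst 1 + cst (-1) * (fun w : 'rV[R]_N => dot w w)).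
  by apply: CnD; [exact: Cn_cst|apply: CnM; [exact: Cn_cst|exact: Cn_dot]].
by apply/funext => x; rewrite !fctE mulN1r.
Qed.

Lemma kerk_smooth k : Cn k setT kerk.
Proof.
rewrite (_ : kerk = cst 2 * (flat 2 \o (fun x => 1 - dot x x))) //.
apply: CnM; first exact: Cn_cst.
apply: Cn_flat => {}k.
rewrite (_ : (fun _ => _) = cst 1 + cst (-1) * (fun w : 'rV[R]_N => dot w w)).
  by apply: CnD; [exact: Cn_cst|apply: CnM; [exact: Cn_cst|exact: Cn_dot]].
by apply/funext => x; rewrite !fctE mulN1r.
Qed.

Lemma kerK_ge0 x : 0 <= kerK x. Proof. exact: flat_ge0. Qed.
Lemma kerk_ge0 x : 0 <= kerk x. Proof. by rewrite mulr_ge0// flat_ge0. Qed.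

Lemma kerK0 x : 1 <= enorm x -> kerK x = 0.
Proof.
move=> x1; rewrite /kerK flat0// subr_le0 -sqr_enorm.
by rewrite -[leLHS](expr1n _ 2) lerXn2r ?nnegrE ?enorm_ge0.
Qed.

Lemma kerk0 x : 1 <= enorm x -> kerk x = 0.
Proof.
move=> x1; rewrite /kerk flat0 ?mulr0// subr_le0 -sqr_enorm.
by rewrite -[leLHS](expr1n _ 2) lerXn2r ?nnegrE ?enorm_ge0.
Qed.

Lemma differentiable_dot x : differentiable (fun w : 'rV[R]_N => dot w w) x.
Proof. by have [+ _] := Cn_dot 1; exact. Qed.

Lemma derive_dot_sqr x v : 'D_v (fun w : 'rV[R]_N => dot w w) x = 2 * dot x v.
Proof.
rewrite (_ : (fun _ => _) = \sum_(i < N) (fun w : 'rV[R]_N => w ord0 i * w ord0 i)); last first.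
  by apply/funext => w; rewrite /dot fct_sumE.
rewrite derive_sum => [|i]; last first.
  by apply: derivableM; apply/diff_derivable/differentiable_coord.
rewrite /dot mulr_sumr; apply: eq_bigr => i _.
have [_] := is_deriveM (is_derive_coord i x v) (is_derive_coord i x v).
by rewrite /GRing.scale/= => ->; ring.
Qed.

Lemma partial_kerK i x : partial i kerK x = - (x ord0 i * kerk x).
Proof.
have dg : differentiable (fun w : 'rV[R]_N => 1 - dot w w) x.
  by apply: differentiableB; [exact: differentiable_cst|exact: differentiable_dot].
have [_] := is_derive_comp_diff (delta_mx ord0 i) dg (is_derive_flat 0 (1 - dot x x)).
rewrite /partial => ->.
rewrite deriveB; last 2 first.
  exact: derivable_cst.
  exact/diff_derivable/differentiable_dot.
rewrite derive_cst derive_dot_sqr /kerk oppr0 mul0r add0r sub0r.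
have -> : dot x (delta_mx ord0 i) = x ord0 i.
  rewrite /dot (bigD1 i)//= big1 ?addr0 ?mxE ?eqxx ?mulr1// => j ji.
  by rewrite mxE eqxx (negbTE ji) mulr0.
ring.
Qed.

End smooth.

(** * Integration by parts against compactly supported functions *)

Section compactly_supported_integrals.
Context {R : realType} {N : nat}.
Local Notation mu := (lebesgue_rV R N).
Implicit Types (f g : 'rV[R]_N -> R) (c : R) (x w v : 'rV[R]_N) (i : 'I_N).

Definition supp_in c f := forall w, c < enorm w -> f w = 0.

Lemma measurable_eball x c : measurable (eball x c).
Proof. by apply: closed_measurable_rV; exact: closed_eball. Qed.

Lemma eball_finite c : (mu (eball 0 c) < +oo)%E.
Proof.
apply: le_lt_trans (@lebesgue_rV_cube R N c); apply: le_measure; rewrite ?inE.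
- exact: measurable_eball.
- by apply: (@measurable_rV_box R N (fun=> `[- c, c]%classic)) => i; exact: measurable_itv.
move=> w wc i /=; rewrite in_itv/= -ler_norml.
by apply: le_trans (coord_le_enorm w i) _; rewrite /eball/= subr0 in wc.
Qed.

Lemma supp_in_restrict c f : supp_in c f -> f \_ (eball 0 c) = f.
Proof.
move=> f0; apply/funext => w; rewrite patchE; case: ifPn => // /negP wc.
rewrite f0// ltNge; apply/negP => cw; apply: wc; rewrite inE /eball/= subr0//.
Qed.

Lemma bounded_supp_integrable c (C : R) f : measurable_fun setT f ->
  supp_in c f -> (forall w, `|f w| <= C) -> mu.-integrable setT (EFin \o f).
Proof.
move=> mf f0 fC.
have : mu.-integrable (eball 0 c) (EFin \o f).
  apply: measurable_bounded_integrable.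
  - exact: measurable_eball.
  - exact: eball_finite.
  - exact: measurable_funTS.
  - exists C; split; first exact: num_real.
    by move=> y Cy w _ /=; exact: le_trans (fC w) (ltW Cy).
rewrite integrable_mkcond; last exact: measurable_eball.
by rewrite restrict_EFin supp_in_restrict.
Qed.

Lemma continuous_bounded_eball f x c : 0 <= c ->
  (forall w, eball x c w -> {for w, continuous f}) ->
  exists2 C, 0 <= C & forall w, eball x c w -> `|f w| <= C.
Proof.
move=> c0 cf.
have [||z /set_mem zc zmax] := @compact_EVT_max _ _ (fun w => `|f w|) (eball x c) _ (@compact_eball _ _ x c).
- by exists x; exact: eball_center.
- apply: continuous_in_subspaceT => w /set_mem wc.
  by apply: (continuous_comp (cf w wc)); exact: norm_continuous.
by exists `|f z| => // w wc; apply: zmax; exact/mem_set.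
Qed.

Lemma continuous_supp_bounded c f : 0 <= c -> continuous f -> supp_in c f ->
  exists2 C, 0 <= C & forall w, `|f w| <= C.
Proof.
move=> c0 cf f0; have [C C0 fC] := @continuous_bounded_eball f 0 c c0 (fun w _ => cf w).
exists C => // w; have [wc|wc] := leP (enorm w) c; last by rewrite f0// normr0.
by apply: fC; rewrite /eball/= subr0.
Qed.

Lemma continuous_supp_integrable c f : 0 <= c -> continuous f -> supp_in c f ->
  mu.-integrable setT (EFin \o f).
Proof.
move=> c0 cf f0; have [C _ fC] := continuous_supp_bounded c0 cf f0.
apply: bounded_supp_integrable f0 fC.
exact: continuous_measurable_rV.
Qed.

Lemma open_enorm_gt c : open [set w : 'rV[R]_N | c < enorm w].
Proof.
by apply: (@open_comp _ _ _ [set t | c < t]) => [w _|]; [exact: continuous_enorm|exact: open_gt].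
Qed.

Lemma near_supp0 c f w : supp_in c f -> c < enorm w -> \near w, 0 = f w.
Proof.
move=> f0 wc; have : nbhs w [set z | c < enorm z].
  by apply: open_nbhs_nbhs; split => //; exact: open_enorm_gt.
by apply: filterS => z /f0 ->.
Qed.

(** Beyond radius c the product vanishes near the point, so g, typically u read along a small ball,
    need be continuous only where f can be nonzero. *)
Lemma continuous_mul_supp c f g : (forall w, enorm w <= c -> {for w, continuous g}) ->
  continuous f -> supp_in c f -> continuous (fun w => g w * f w).
Proof.
move=> cg cf f0.
suff H (w : 'rV[R]_N) : {for w, continuous (fun w => g w * f w)} by exact: H.
have [wc|wc] := leP (enorm w) c.
  by apply: continuousM; [exact: cg|exact: cf].
have : (fun w => g w * f w) @ w --> (0 : R).
  apply: (@cvg_near_cst _ _ 0 (fun w => g w * f w) (nbhs w)); near=> z.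
  by have <- : 0 = f z; [near: z; exact: near_supp0 f0 wc|rewrite mulr0].
by have <- : g w * f w = 0 by rewrite f0 ?mulr0.
Unshelve. all: by end_near. Qed.

(** The constant C on the ball of radius c, which has finite measure, dominates all the derivatives
    in s. *)
Lemma is_derive_under_integral c (C a u v : R) (f df : R -> 'rV[R]_N -> R) : 0 <= c ->
  a \in `]u, v[%R ->
  (forall s, s \in `]u, v[%R -> continuous (f s)) ->
  (forall s, s \in `]u, v[%R -> supp_in c (f s)) ->
  (forall s w, s \in `]u, v[%R -> is_derive s 1 (f ^~ w) (df s w)) ->
  (forall s w, s \in `]u, v[%R -> `|df s w| <= C) ->
  (forall s, s \in `]u, v[%R -> supp_in c (df s)) ->
  is_derive a 1 (fun s => \int[mu]_w f s w) (\int[mu]_w df a w).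
Proof.
move=> c0 auv cf f0 dff dfC df0.
have C0 : 0 <= C by apply: le_trans (dfC a 0 auv).
pose G := (cst C : 'rV[R]_N -> R) \_ (eball 0 c).
have intf s : `]u, v[%classic s -> mu.-integrable setT (EFin \o f s).
  by move=> suv; apply: (@continuous_supp_integrable c) => //; [exact: cf|exact: f0].
have intG : mu.-integrable setT (EFin \o G).
  apply: (@bounded_supp_integrable c C).
  - apply/(@measurable_restrictT _ _ _ _ (eball 0 c)) => //; exact: measurable_eball.
  - move=> w wc; rewrite /G patchE; case: ifPn => // /set_mem.
    by rewrite /eball/= subr0 leNgt wc.
  - by move=> w; rewrite /G patchE; case: ifPn => _; rewrite ?normr0// ger0_norm.
have p1 s w : s \in `]u, v[%R -> partial1of2 f s w = df s w.
  by move=> suv; rewrite partial1of2E; have [_] := dff s w suv.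
have G_ge0 w : 0 <= G w by rewrite /G patchE; case: ifPn.
have G_ub s w : `]u, v[%classic s -> setT w -> `|partial1of2 f s w| <= G w.
  move=> suv _; rewrite p1// /G patchE; case: ifPn => [_|/negP wc]; first exact: dfC.
  rewrite df0 ?normr0// ltNge; apply/negP => cw; apply: wc.
  by rewrite inE /eball/= subr0.
have der s w : `]u, v[%classic s -> setT w -> derivable (f ^~ w) s 1.
  by move=> suv _; have [] := dff s w suv.
apply: DeriveDef.
  exact: (derivable_under_integral measurableT auv intf der G_ge0 intG G_ub).
rewrite -derive1E (differentiation_under_integral measurableT auv intf der G_ge0 intG G_ub).
by apply: eq_Rintegral => w _; exact: p1.
Qed.

Lemma supp_in_mul c f g : supp_in c f -> supp_in c (fun w => g w * f w).
Proof. by move=> f0 w /f0 ->; rewrite mulr0. Qed.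

(* Differentiate the translation-invariant integral of f along v. *)
Lemma integral_derive0 c f g v : 0 <= c -> continuous f -> supp_in c f ->
  continuous g -> supp_in c g -> (forall w, is_derive w v f (g w)) ->
  \int[mu]_w g w = 0.
Proof.
move=> c0 cf f0 cg g0 dfg.
have [C _ gC] := continuous_supp_bounded c0 cg g0.
have trC (h : 'rV[R]_N -> R) (s : R) : continuous h -> continuous (fun w => h (s *: v + 1 *: w)).
  move=> ch w.
  have cA : {for w, continuous (fun w : 'rV[R]_N => s *: v + 1 *: w)}.
    have H : {for w, continuous (fun w : 'rV[R]_N => 1 *: w)}.
      by apply: (@cvgZl_tmp _ _ _ (nbhs w) _ 1 id w); exact: cvg_id.
    by apply: (@continuousD _ _ _ (cst (s *: v)) (fun w => 1 *: w)); [exact: cst_continuous|exact: H].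
  exact: (continuous_comp cA (ch _)).
(* Restricting s to ]-1, 1[ keeps all the translated supports in one ball, of radius c + |v|. *)
have tr0 (h : 'rV[R]_N -> R) (s : R) : supp_in c h -> s \in `](-1), 1[%R ->
    supp_in (c + enorm v) (fun w => h (s *: v + 1 *: w)).
  move=> h0; rewrite in_itv/= -ltr_norml => s1 w cw; apply: h0.
  have := enormD (s *: v + 1 *: w) (- (s *: v)).
  rewrite addrAC subrr add0r scale1r enormN enormZ.
  have : `|s| * enorm v <= enorm v by rewrite ler_piMl ?enorm_ge0// ltW.
  lra.
have cv0 : 0 <= c + enorm v by rewrite addr_ge0// enorm_ge0.
have int1 s : s \in `](-1), 1[%R -> \int[mu]_w f (s *: v + 1 *: w) = \int[mu]_w f w.
  move=> s1; rewrite integral_rV_affine//.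
  - by rewrite invr1 expr1n mul1r.
  - exact: continuous_supp_integrable cf f0.
  - by apply: continuous_supp_integrable cv0 (trC _ _ cf) _; exact: tr0.
have z1 : (0 : R) \in `](-1), 1[%R by rewrite in_itv/= ltrN10 ltr01.
have der : is_derive (0 : R) 1 (fun s : R => \int[mu]_w f (s *: v + 1 *: w)) (\int[mu]_w g (0 *: v + 1 *: w)).
  apply: (@is_derive_under_integral (c + enorm v) C 0 (-1) 1 (fun s w => f (s *: v + 1 *: w)) (fun s w => g (s *: v + 1 *: w))) => //.
  - by move=> s _; exact: trC.
  - by move=> s s1; exact: tr0.
  - move=> s w _; have [dw dE] := dfg (s *: v + 1 *: w).
    have E : (fun h : R => h^-1 *: (((fun s => f (s *: v + 1 *: w)) \o shift s) (h *: (1:R)) - f (s *: v + 1 *: w)))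
        = (fun h : R => h^-1 *: ((f \o shift (s *: v + 1 *: w)) (h *: v) - f (s *: v + 1 *: w))).
      by apply/funext => h /=; rewrite [h *: 1]mulr1 scalerDl addrA.
    by apply: DeriveDef; rewrite -?dE /derivable /derive E.
  - by move=> s s1; exact: tr0.
have [_ D0] := der.
have : 'D_1 (fun s : R => \int[mu]_w f (s *: v + 1 *: w)) 0 = 0.
  rewrite (near_eq_derive (g := cst (\int[mu]_w f w))) ?derive_cst//.
  near=> s; apply: int1; near: s; exact: near_in_itvoo.
rewrite D0 => <-; apply: eq_Rintegral => w _.
by rewrite scale0r add0r scale1r.
Unshelve. all: by end_near. Qed.

End compactly_supported_integrals.

(** * Weak solutions and mean values *)

Section weak_equation.
Context {R : realType} {N : nat}.
Local Notation mu := (lebesgue_rV R N).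
Implicit Types (f g u F chi : 'rV[R]_N -> R) (c r s : R) (x y w v z : 'rV[R]_N) (i : 'I_N).
Implicit Types (Omega : set 'rV[R]_N).

Lemma continuous_grad Omega u x : Cn 1 Omega u -> Omega x -> {for x, continuous (grad u)}.
Proof.
move=> [_ dif] Ox.
rewrite (_ : grad u = fun z => \sum_(i < N) partial i u z *: delta_mx ord0 i); last first.
  apply/funext => z; rewrite [LHS]row_sum_delta; apply: eq_bigr => i _.
  by rewrite /grad mxE.
apply: (@cvg_big _ _ _ _ _ (@add_continuous _) _ (nbhs x) _
  (fun i z => partial i u z *: delta_mx ord0 i)) => i _.
by apply: (@cvgZr_tmp _ _ _ (nbhs x)); exact: dif.
Qed.

Lemma grad_bounded Omega u x c : 0 <= c -> Cn 1 Omega u -> eball x c `<=` Omega ->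
  exists2 C, 0 <= C & forall z, eball x c z -> enorm (grad u z) <= C.
Proof.
move=> c0 cu xc.
have [C C0 uC] := @continuous_bounded_eball _ _ (fun z => enorm (grad u z)) x c c0 (fun w wc =>
  continuous_comp (continuous_grad cu (xc _ wc)) (@continuous_enorm _ _ (grad u w))).
by exists C => // z zc; apply: le_trans (ler_norm _) (uC z zc).
Qed.

Lemma eball_affine x r s w : 0 <= r -> `|s| <= r -> enorm w <= 1 -> eball x r (x + s *: w).
Proof.
move=> r0 sr w1; rewrite /eball/= addrAC subrr add0r enormZ.
by rewrite -[leRHS]mulr1 ler_pM ?enorm_ge0.
Qed.

Lemma continuous_affine x s : continuous (fun w => x + s *: w).
Proof.
move=> w.
have H : {for w, continuous (fun w : 'rV[R]_N => s *: w)}.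
  by apply: (@cvgZl_tmp _ _ _ (nbhs w) _ s id w); exact: cvg_id.
by apply: (@continuousD _ _ _ (cst x) (fun w => s *: w)); [exact: cst_continuous|exact: H].
Qed.

Lemma continuous_comp_affine f x s w : {for (x + s *: w), continuous f} ->
  {for w, continuous (fun w => f (x + s *: w))}.
Proof.
move=> cf.
have cA : {for w, continuous (fun w : 'rV[R]_N => x + s *: w)} by exact: continuous_affine.
exact: (continuous_comp cA cf).
Qed.

(** Negative s are included so that the means are also differentiable at s = 0, from where the
    expansion at x starts. *)
Lemma is_derive_integral_dilation Omega u x r s chi : 0 < r -> Cn 1 Omega u ->
  eball x r `<=` Omega -> continuous chi -> supp_in 1 chi -> s \in `](- r), r[%R ->
  is_derive s 1 (fun s => \int[mu]_w (u (x + s *: w) * chi w))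
    (\int[mu]_w (dot (grad u (x + s *: w)) w * chi w)).
Proof.
move=> r0 cu xr cchi chi0 sr.
have [C C0 uC] := grad_bounded (ltW r0) cu xr.
have [D D0 chiD] := continuous_supp_bounded ler01 cchi chi0.
have inO t w : t \in `](- r), r[%R -> enorm w <= 1 -> Omega (x + t *: w).
  rewrite in_itv/= -ltr_norml => /ltW tr w1.
  by apply: xr; apply: eball_affine => //; exact: ltW.
apply: (@is_derive_under_integral _ _ 1 (C * D) s (- r) r (fun s w => u (x + s *: w) * chi w)
  (fun s w => dot (grad u (x + s *: w)) w * chi w)) => //.
- move=> t tr; apply: (@continuous_mul_supp _ _ 1 chi (fun w => u (x + t *: w))) => // w w1.
  apply: continuous_comp_affine; apply: differentiable_continuous.
  by have [du _] := cu; apply: du; exact: inO.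
- by move=> t _; exact: supp_in_mul.
- move=> t w tr; have [w1|w1] := leP (enorm w) 1; last first.
    rewrite (_ : (fun _ => _) = cst 0); last by apply/funext => y; rewrite /= chi0// mulr0.
    by apply: is_derive_eq; rewrite chi0// mulr0.
  have du : differentiable u (x + t *: w) by have [du _] := cu; apply: du; exact: inO.
  have := is_deriveM (is_derive_line du) (is_derive_cst (chi w) t 1).
  by move/is_derive_eq; apply; rewrite scaler0 add0r /GRing.scale/= mulrC.
- move=> t w tr; have [w1|w1] := leP (enorm w) 1; last first.
    by rewrite chi0// mulr0 normr0 mulr_ge0.
  rewrite normrM ler_pM// (le_trans (CauchySchwarz_dot _ _))//.
  rewrite -[leRHS]mulr1 ler_pM ?enorm_ge0// uC//.
  apply: eball_affine => //; first exact: ltW.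
  by move: tr; rewrite in_itv/= -ltr_norml => /ltW.
- by move=> t _; exact: supp_in_mul.
Unshelve. all: by end_near. Qed.

Lemma supp_in_partial c f i : supp_in c f -> supp_in c (partial i f).
Proof.
move=> f0 w wc; rewrite /partial -(near_eq_derive (f := cst 0)) ?derive_cst//.
exact: near_supp0 f0 wc.
Qed.

Lemma continuous_smooth f : (forall k, Cn k setT f) -> continuous f.
Proof. by move=> sf x; exact: (sf 0%N). Qed.

Lemma continuous_partial_smooth f i : (forall k, Cn k setT f) -> continuous (partial i f).
Proof. by move=> sf x; have [_] := sf 1%N; exact. Qed.

Lemma is_derive_partial f i w : differentiable f w -> is_derive w (delta_mx ord0 i) f (partial i f w).
Proof. by move=> df; exact/derivableP/diff_derivable. Qed.

Lemma supp_in_ge1 f : (forall w, 1 <= enorm w -> f w = 0) -> supp_in 1 f.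
Proof. by move=> f0 w /ltW /f0. Qed.

Lemma supp_in_kerK : supp_in 1 (@kerK R N).
Proof. exact: supp_in_ge1 (@kerK0 R N). Qed.

Lemma supp_in_kerk : supp_in 1 (@kerk R N).
Proof. exact: supp_in_ge1 (@kerk0 R N). Qed.

Lemma continuous_kerK : continuous (@kerK R N).
Proof. exact: continuous_smooth (@kerK_smooth R N). Qed.

Lemma continuous_kerk : continuous (@kerk R N).
Proof. exact: continuous_smooth (@kerk_smooth R N). Qed.

Lemma continuous_coord_mul i f : continuous f -> continuous (fun w => w ord0 i * f w).
Proof.
move=> cf; suff H w : {for w, continuous (fun w => w ord0 i * f w)} by exact: H.
by apply: continuousM; [exact: coord_continuous|exact: cf].
Qed.

Definition kappa := \int[mu]_w (kerK w).

Lemma integrable_kerK : mu.-integrable setT (EFin \o @kerK R N).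
Proof. exact: continuous_supp_integrable ler01 continuous_kerK supp_in_kerK. Qed.

(** By continuity [kerK] exceeds half its value at 0 on a small cube, whose measure is explicit and
    positive. *)
Lemma kappa_gt0 : 0 < kappa.
Proof.
pose c := kerK (0 : 'rV[R]_N) / 2.
have c0 : 0 < c by rewrite divr_gt0// flat_gt0// dot0l subr0.
have : nbhs (0 : 'rV[R]_N) [set w | c <= kerK w].
  have := @continuous_kerK 0 => /cvgrPdist_le/(_ c c0); apply: filterS => w /=.
  by rewrite ler_norml => /andP[_]; rewrite {1}(_ : kerK 0 = c + c) /c; [lra|rewrite -splitr].
move=> /nbhs_ballP[e /= e0 eK].
pose B := [set w : 'rV[R]_N | forall i, `[- (e / 2), e / 2]%classic (w ord0 i)].
have mB : measurable B.
  by apply: (@measurable_rV_box R N (fun=> `[- (e / 2), e / 2]%classic)) => i; exact: measurable_itv.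
have muB : mu B = ((e / 2 - (- (e / 2))) ^+ N)%:E.
  rewrite (@lebesgue_rV_box R N (fun=> `[- (e / 2), e / 2]%classic)); last by move=> i; exact: measurable_itv.
  rewrite big_const card_ord lebesgue_measure_itv/= lte_fin.
  rewrite ifT; last by lra.
  by rewrite -EFinD; elim: (N) => //= n ->; rewrite -EFinM exprS.
have muBoo : (mu B < +oo)%E by rewrite muB ltry.
have iB : mu.-integrable B (EFin \o cst c).
  apply: measurable_bounded_integrable => //.
  exists `|c|; split; first exact: num_real.
  by move=> y cy w _ /=; exact: ltW.
apply: (@lt_le_trans _ _ (\int[mu]_(w in B) c)).
  rewrite Rintegral_cst// mulr_gt0//.
  have -> : fine (mu B) = (e / 2 - (- (e / 2))) ^+ N by exact: (congr1 fine muB).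
  rewrite exprn_gt0//; lra.
rewrite Rintegral_mkcond; apply: le_Rintegral => //.
- by move/(integrable_mkcond _ mB) : iB; rewrite restrict_EFin.
- exact: integrable_kerK.
move=> w _; rewrite patchE; case: ifPn => [|_]; last exact: kerK_ge0.
rewrite inE => wB; apply: eK; rewrite -ball_normE/= sub0r normrN.
rewrite [ltLHS]/Num.norm/= mx_normrE; apply/bigmax_ltP; split => // -[i j] _ /=.
have := wB j; rewrite /= in_itv/= -ler_norml => h; rewrite [i]ord1; apply: le_lt_trans h _; lra.
Qed.

(** The i-th partial derivative of w_i [kerK] is [kerK] - w_i^2 [kerk] and has integral 0, so each
    coordinate contributes one [kappa]. *)
Lemma integral_sqr_kerk : \int[mu]_w (dot w w * kerk w) = N%:R * kappa.
Proof.
have ci i : continuous (fun w : 'rV[R]_N => w ord0 i * (w ord0 i * kerk w)).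
  exact/continuous_coord_mul/continuous_coord_mul/continuous_kerk.
have si i : supp_in 1 (fun w : 'rV[R]_N => w ord0 i * (w ord0 i * kerk w)).
  exact/supp_in_mul/supp_in_mul/supp_in_kerk.
have ii i := continuous_supp_integrable ler01 (ci i) (si i).
have E i : \int[mu]_w (w ord0 i * (w ord0 i * kerk w)) = kappa.
  have := @integral_derive0 R N 1 (fun w => w ord0 i * kerK w)
    (fun w => kerK w - w ord0 i * (w ord0 i * kerk w)) (delta_mx ord0 i) ler01.
  rewrite RintegralB//; last exact: integrable_kerK.
  move=> h; apply/esym/eqP; rewrite -subr_eq0; apply/eqP; apply: h.
  - exact/continuous_coord_mul/continuous_kerK.
  - exact/supp_in_mul/supp_in_kerK.
  - by move=> w; apply: continuousB; [exact: continuous_kerK|exact: ci].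
  - by move=> w w1; rewrite supp_in_kerK// si// subr0.
  move=> w; have dK : differentiable (@kerK R N) w by have [+ _] := @kerK_smooth R N 1; exact.
  have := is_deriveM (is_derive_coord i w (delta_mx ord0 i)) (is_derive_partial i dK).
  move/is_derive_eq; apply; rewrite /GRing.scale/= partial_kerK mxE !eqxx mulr1.
  by rewrite mulrN addrC.
transitivity (\sum_(i < N) \int[mu]_w (w ord0 i * (w ord0 i * kerk w))); last first.
  by rewrite (eq_bigr (fun=> kappa)) // sumr_const card_ord mulr_natl.
have S (s : seq 'I_N) : mu.-integrable setT (EFin \o (fun w : 'rV[R]_N => \sum_(i <- s) w ord0 i * (w ord0 i * kerk w))) /\
  \int[mu]_w (\sum_(i <- s) w ord0 i * (w ord0 i * kerk w)) = \sum_(i <- s) \int[mu]_w (w ord0 i * (w ord0 i * kerk w)).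
  elim: s => [|a s [IHi IHs]].
    split.
      rewrite (_ : _ \o _ = cst 0%E); first exact: integrable0.
      by apply/funext => w; rewrite /= big_nil.
    rewrite big_nil; under eq_Rintegral do rewrite big_nil.
    by rewrite Rintegral_cst// mul0r.
  split.
    have := integrableD measurableT (ii a) IHi.
    by apply: eq_integrable => // w _; rewrite /= big_cons EFinD.
  rewrite big_cons -IHs -RintegralD//.
  by under eq_Rintegral do rewrite big_cons.
rewrite -(S _).2; apply: eq_Rintegral => w _.
by rewrite /dot mulr_suml; apply: eq_bigr => i _; rewrite mulrA.
Qed.

(** The equation -Delta u = F with F a given continuous function: mean values and comparisons do not
    see how F depends on u. *)
Definition weak_solution Omega u F :=
  [/\ open Omega, Cn 1 Omega u, (forall x, Omega x -> {for x, continuous F}) &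
   forall psi, test_function Omega psi ->
    \int[mu]_(x in Omega) dot (grad u x) (grad psi x) = \int[mu]_(x in Omega) (F x * psi x)].

Lemma integral_rescale f x r : 0 < r -> continuous f -> supp_in 1 f ->
  \int[mu]_z f (r^-1 *: (z - x)) = r ^+ N * \int[mu]_w f w.
Proof.
move=> r0 cf f0; pose g z := f (r^-1 *: (z - x)).
have E w : g (x + r *: w) = f w.
  by rewrite /g addrAC subrr add0r scalerA mulVf ?gt_eqF// scale1r.
have cg : continuous g.
  rewrite (_ : g = fun z => f (- (r^-1 *: x) + r^-1 *: z)); last first.
    by apply/funext => y; rewrite /g scalerBr addrC.
  by move=> z; apply: (@continuous_comp_affine f); exact: cf.
have g0 : supp_in (enorm x + r) g.
  move=> z zr; apply: f0; rewrite enormZ gtr0_norm ?invr_gt0// mulrC ltr_pdivlMr// mul1r.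
  have := enormD (z - x) x; rewrite subrK; lra.
have xr : 0 <= enorm x + r by rewrite addr_ge0 ?enorm_ge0// ltW.
have ge : g \o rV_affine x r = f by apply/funext => w; exact: E.
have := @integral_rV_affine R N x r g r0 (continuous_supp_integrable xr cg g0).
rewrite ge => /(_ (continuous_supp_integrable ler01 cf f0)).
under eq_Rintegral do rewrite E.
move=> ->; rewrite mulrA -exprMn mulfV ?gt_eqF// expr1n mul1r//.
Qed.

Lemma Rintegral_supp (A : set 'rV[R]_N) f : (forall x, ~ A x -> f x = 0) ->
  \int[mu]_(x in A) f x = \int[mu]_x f x.
Proof.
move=> f0; rewrite Rintegral_mkcond; apply: eq_Rintegral => x _.
by rewrite patchE; case: ifPn => // /negP; rewrite inE => /f0 ->.
Qed.

Lemma continuous_dot_grad Omega u chi x r : 0 < r -> Cn 1 Omega u -> eball x r `<=` Omega ->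
  (forall k, Cn k setT chi) -> supp_in 1 chi ->
  continuous (fun w => dot (grad u (x + r *: w)) (grad chi w)).
Proof.
move=> r0 cu xr schi chi0.
suff H w : {for w, continuous (fun w => \sum_(i < N) partial i u (x + r *: w) * partial i chi w)}.
  rewrite (_ : (fun _ => _) = (fun w => \sum_(i < N) partial i u (x + r *: w) * partial i chi w)) //.
  by apply/funext => w; rewrite /dot; apply: eq_bigr => i _; rewrite /grad !mxE.
apply: (@cvg_big _ _ _ _ _ (@add_continuous _) _ (nbhs w) _
  (fun i w => partial i u (x + r *: w) * partial i chi w)) => i _.
apply: (@continuous_mul_supp _ _ 1 (partial i chi) (fun w => partial i u (x + r *: w))).
- move=> {}w w1; apply: (@continuous_comp_affine (partial i u)).
  have [_] := cu; apply; apply: xr.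
  by apply: eball_affine => //; [exact: ltW|rewrite gtr0_norm].
- exact: continuous_partial_smooth.
- exact: supp_in_partial.
Qed.

Lemma supp_in_dot_grad v chi (w : 'rV[R]_N) : supp_in 1 chi -> 1 < enorm w -> dot v (grad chi w) = 0.
Proof.
move=> chi0 w1; rewrite /dot big1// => i _.
by rewrite /grad [X in _ * X]mxE (supp_in_partial i chi0)// mulr0.
Qed.

(** The test function is chi((z - x)/r), followed by z = x + r w: the factors r^N of the two
    integrals cancel, and the gradient of the test function supplies r^-1. *)
Lemma weak_solution_dilation Omega u F x r chi : weak_solution Omega u F -> 0 < r ->
  eball x r `<=` Omega -> (forall k, Cn k setT chi) ->
  (forall w, 1 <= enorm w -> chi w = 0) ->
  \int[mu]_w dot (grad u (x + r *: w)) (grad chi w) =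
  r * \int[mu]_w (F (x + r *: w) * chi w).
Proof.
move=> [oO cu cF weak] r0 xr schi chi1.
have chi0 := supp_in_ge1 chi1.
have rn0 : r != 0 by rewrite gt_eqF.
have xO w : enorm w <= 1 -> Omega (x + r *: w).
  by move=> w1; apply: xr; apply: eball_affine => //; [exact: ltW|rewrite gtr0_norm].
have back z : x + r *: (r^-1 *: (z - x)) = z.
  by rewrite scalerA mulfV// scale1r addrC subrK.
have outO z : ~ Omega z -> 1 < enorm (r^-1 *: (z - x)).
  by move=> Oz; rewrite ltNge; apply/negP => /xO; rewrite back.
have := weak _ (test_function_affine r0 schi chi1 xr).
have gpsi z : grad (fun z => chi (r^-1 *: (z - x))) z = r^-1 *: grad chi (r^-1 *: (z - x)).
  apply/rowP => i; rewrite !mxE /partial.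
  have dchi : differentiable chi (r^-1 *: (z - x)) by have [+ _] := schi 1%N; exact.
  by have [_ ->] := is_derive_affine (delta_mx ord0 i) dchi.
rewrite (@Rintegral_supp Omega (fun z => dot (grad u z) (grad (fun z => chi (r^-1 *: (z - x))) z))); last first.
  by move=> z /outO z1; rewrite gpsi dotZr (supp_in_dot_grad _ chi0 z1) mulr0.
rewrite (@Rintegral_supp Omega (fun z => F z * chi (r^-1 *: (z - x)))); last first.
  by move=> z /outO /chi0 ->; rewrite mulr0.
pose h1 w := r^-1 * dot (grad u (x + r *: w)) (grad chi w).
pose h2 w := F (x + r *: w) * chi w.
have cd := continuous_dot_grad r0 cu xr schi chi0.
have c1 : continuous h1.
  suff H w : {for w, continuous h1} by exact: H.
  by apply: continuousM; [exact: cst_continuous|exact: cd].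
have s0 : supp_in 1 (fun w => dot (grad u (x + r *: w)) (grad chi w)).
  by move=> w w1; exact: supp_in_dot_grad.
have s1 : supp_in 1 h1 by move=> w w1; rewrite /h1 s0// mulr0.
have c2 : continuous h2.
  apply: (@continuous_mul_supp _ _ 1 chi (fun w => F (x + r *: w))) => //.
    by move=> w w1; apply: continuous_comp_affine; apply: cF; exact: xO.
  exact: continuous_smooth.
have s2 : supp_in 1 h2 by exact: supp_in_mul.
have -> : \int[mu]_z dot (grad u z) (grad (fun z => chi (r^-1 *: (z - x))) z) = \int[mu]_z h1 (r^-1 *: (z - x)).
  by apply: eq_Rintegral => z _; rewrite /h1 gpsi dotZr back.
have -> : \int[mu]_z (F z * chi (r^-1 *: (z - x))) = \int[mu]_z h2 (r^-1 *: (z - x)).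
  by apply: eq_Rintegral => z _; rewrite /h2 back.
rewrite !integral_rescale// => /mulfI; rewrite expf_neq0// => /(_ isT).
rewrite /h1 RintegralZl//; last exact: continuous_supp_integrable ler01 cd s0.
by move=> /(congr1 ( *%R r)); rewrite mulrA mulfV// mul1r.
Qed.

End weak_equation.

(** * Weighted means over small balls and second-order comparison *)

Section mean_value.
Context {R : realType} {N : nat}.
Local Notation mu := (lebesgue_rV R N).
Local Notation kappa := (@kappa R N).
Implicit Types (f g u F h chi : 'rV[R]_N -> R) (c r s e : R) (x y w v z : 'rV[R]_N) (i : 'I_N).
Implicit Types (Omega : set 'rV[R]_N).

Lemma continuous_dilation_mul Omega h x r s chi : 0 <= r -> eball x r `<=` Omega ->
  (forall z, Omega z -> {for z, continuous h}) -> continuous chi -> supp_in 1 chi ->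
  `|s| <= r -> continuous (fun w => h (x + s *: w) * chi w).
Proof.
move=> r0 xr ch cchi chi0 sr.
apply: (@continuous_mul_supp _ _ 1 chi (fun w => h (x + s *: w))) => // w w1.
by apply: continuous_comp_affine; apply: ch; apply: xr; exact: eball_affine sr w1.
Qed.

Lemma integrable_dilation_mul Omega h x r s chi : 0 <= r -> eball x r `<=` Omega ->
  (forall z, Omega z -> {for z, continuous h}) -> continuous chi -> supp_in 1 chi ->
  `|s| <= r -> mu.-integrable setT (EFin \o (fun w => h (x + s *: w) * chi w)).
Proof.
move=> r0 xr ch cchi chi0 sr; apply: (continuous_supp_integrable ler01).
  exact: continuous_dilation_mul r0 xr ch cchi chi0 sr.
exact: supp_in_mul.
Qed.

Lemma norm_Rintegral_le f g : mu.-integrable setT (EFin \o f) ->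
  mu.-integrable setT (EFin \o g) -> (forall w, `|f w| <= g w) ->
  `|\int[mu]_w f w| <= \int[mu]_w g w.
Proof.
move=> fi gi fg; apply: le_trans (le_normr_Rintegral measurableT fi) _.
apply: le_Rintegral => //; exact: integrable_norm.
Qed.

Lemma average_continuous Omega h x e : open Omega -> Omega x -> 0 < e ->
  (forall z, Omega z -> {for z, continuous h}) ->
  exists2 d, 0 < d & eball x d `<=` Omega /\ forall s, `|s| <= d ->
    `|\int[mu]_w (h (x + s *: w) * kerK w) - h x * kappa| <= e * kappa.
Proof.
move=> oO Ox e0 ch.
have : nbhs x (Omega `&` [set z | `|h z - h x| <= e]).
  apply: filterI; first exact: open_nbhs_nbhs.
  by have := ch x Ox => /cvgrPdist_le/(_ e e0); apply: filterS => z; rewrite distrC.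
move=> /nbhs_eball[d d0 xd]; exists d => //; split; first by move=> z /xd[].
move=> s sd.
have dO : eball x d `<=` Omega by move=> z /xd[].
have Ki := @integrable_kerK R N.
have hi := integrable_dilation_mul (ltW d0) dO ch (@continuous_kerK R N) (@supp_in_kerK R N) sd.
have hKi : mu.-integrable setT (EFin \o (fun w => h x * kerK w)).
  have := integrable_dilation_mul (ltW d0) (x := x) (fun _ _ => I) (fun z _ => @cst_continuous _ _ (h x) z) (@continuous_kerK R N) (@supp_in_kerK R N) sd.
  exact.
have eKi : mu.-integrable setT (EFin \o (fun w => e * kerK w)).
  have := integrable_dilation_mul (ltW d0) (x := x) (fun _ _ => I) (fun z _ => @cst_continuous _ _ e z) (@continuous_kerK R N) (@supp_in_kerK R N) sd.
  exact.
rewrite /kappa -!RintegralZl// -RintegralB//.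
apply: norm_Rintegral_le => //.
  have := integrableB measurableT hi hKi.
  by apply: eq_integrable.
move=> w; rewrite -mulrBl normrM (ger0_norm (kerK_ge0 w)).
have [w1|w1] := leP (enorm w) 1; last by rewrite supp_in_kerK// !mulr0.
rewrite ler_wpM2r ?kerK_ge0//.
by have [_] := xd _ (eball_affine x (ltW d0) sd w1).
Qed.

Lemma grad_kerK w : grad kerK w = - (kerk w *: w).
Proof. by apply/rowP => i; rewrite !mxE partial_kerK mulrC. Qed.

(** The derivative in s integrates (grad u(x + s w) . w) [kerk] w, which is - grad u(x + s w) . grad
    [kerK] w; the equation tested with the dilated [kerK] evaluates it. *)
Lemma is_derive_average Omega u F x r s : weak_solution Omega u F -> 0 < r ->
  eball x r `<=` Omega -> s \in `]0, r[%R ->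
  is_derive s 1 (fun s => \int[mu]_w (u (x + s *: w) * kerk w))
    (- (s * \int[mu]_w (F (x + s *: w) * kerK w))).
Proof.
move=> ws r0 xr; rewrite in_itv/= => /andP[s0 sr].
have [oO cu cF _] := ws.
have sr' : s \in `](- r), r[%R by rewrite in_itv/= sr andbT (lt_trans _ s0)// oppr_lt0.
have := is_derive_integral_dilation r0 cu xr (@continuous_kerk R N) (@supp_in_kerk R N) sr'.
move/is_derive_eq; apply.
have xs : eball x s `<=` Omega by apply: subset_trans xr; apply: eballS; exact: ltW.
rewrite -(weak_solution_dilation ws s0 xs (@kerK_smooth R N) (@kerK0 R N)).
have di : mu.-integrable setT (EFin \o (fun w => dot (grad u (x + s *: w)) (grad kerK w))).
  apply: (continuous_supp_integrable ler01).
    exact: (continuous_dot_grad s0 cu xs (@kerK_smooth R N) (@supp_in_kerK R N)).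
  by move=> w w1; exact: (supp_in_dot_grad _ (@supp_in_kerK R N)).
rewrite -mulN1r -RintegralZl//; apply: eq_Rintegral => w _.
by rewrite grad_kerK dotNr dotZr mulN1r opprK mulrC.
Qed.

(** The derivative of the mean is -t times a [kerK]-mean of F near x, hence within e [kappa] t of -
    t F(x) [kappa]. The mean value theorem on [0, s] turns this into an error e [kappa] s^2. *)
Lemma mean_value_expansion Omega u F x e : weak_solution Omega u F -> Omega x -> 0 < e ->
  exists2 d, 0 < d & eball x d `<=` Omega /\ forall s, 0 <= s <= d ->
    `|\int[mu]_w ((u (x + s *: w) - u x) * kerk w) + s ^+ 2 / 2 * (F x * kappa)| <= e * kappa * s ^+ 2.
Proof.
move=> ws Ox e0; have [oO cu cF _] := ws.
have [r r0 [xr rF]] := average_continuous oO Ox e0 cF.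
have cuO z : Omega z -> {for z, continuous u}.
  by move=> Oz; apply: differentiable_continuous; have [+ _] := cu; exact.
(* Halving keeps [0, s] inside the open interval on which the mean is differentiable. *)
exists (r / 2); first by rewrite divr_gt0.
split; first by apply: subset_trans xr; apply: eballS; lra.
move=> s /andP[s0 sr2].
pose g s := \int[mu]_w (u (x + s *: w) * kerk w).
have ui t : `|t| <= r -> mu.-integrable setT (EFin \o (fun w => u (x + t *: w) * kerk w)).
  exact: (integrable_dilation_mul (ltW r0) xr cuO (@continuous_kerk R N) (@supp_in_kerk R N)).
have -> : \int[mu]_w ((u (x + s *: w) - u x) * kerk w) = g s - g 0.
  rewrite /g -RintegralB//; last 2 first.
  - by apply: ui; rewrite ger0_norm//; lra.
  - by apply: ui; rewrite normr0 ltW.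
  by apply: eq_Rintegral => w _; rewrite scale0r addr0 mulrBl.
pose h t := g t + t ^+ 2 / 2 * (F x * kappa).
have hE : g s - g 0 + s ^+ 2 / 2 * (F x * kappa) = h s - h 0.
  by rewrite /h expr0n/= !mul0r addr0 addrAC.
have d2 (t : R) : is_derive t 1 (fun t : R => t ^+ 2 / 2 * (F x * kappa) : R) (t * (F x * kappa)).
  rewrite (_ : (fun _ => _) = (F x * kappa / 2) *: (@id R) ^+ 2); last first.
    by apply/funext => y; rewrite /GRing.scale/= !fctE /GRing.scale/=; ring.
  by apply: is_derive_eq; rewrite /GRing.scale/= expr1; field.
have dh (t : R) : t \in `]0, r[%R -> is_derive t 1 h (- (t * \int[mu]_w (F (x + t *: w) * kerK w)) + t * (F x * kappa)).
  by move=> tr; exact: is_deriveD (is_derive_average ws r0 xr tr) (d2 t).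
have ch : {within `[0, s], continuous h}.
  apply: derivable_within_continuous => t; rewrite in_itv/= => /andP[t0 ts].
  have tr : t \in `](- r), r[%R by rewrite in_itv/=; apply/andP; split; lra.
  have [dg _] := is_derive_integral_dilation r0 cu xr (@continuous_kerk R N) (@supp_in_kerk R N) tr.
  have [d2t _] := d2 t; exact: derivableD dg d2t.
have ds t : t \in `]0, s[%R -> is_derive t 1 h (- (t * \int[mu]_w (F (x + t *: w) * kerK w)) + t * (F x * kappa)).
  by rewrite in_itv/= => /andP[t0 ts]; apply: dh; rewrite in_itv/= t0/=; lra.
have [t] := MVT_segment s0 ds ch.
rewrite in_itv/= => /andP[t0 ts] E.
rewrite hE E subr0 normrM (ger0_norm s0) expr2 mulrA ler_wpM2r//.
rewrite -mulrN -mulrDr normrM (ger0_norm t0) mulrC addrC distrC.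
by rewrite ler_pM// rF// ger0_norm//; lra.
Qed.

(** The integrand is the derivative of - [kerK] along v. Thus the linear part of a touching
    quadratic drops out of the means. *)
Lemma integral_dot_kerk v : \int[mu]_w (dot v w * kerk w) = 0.
Proof.
have cd : continuous (fun w : 'rV[R]_N => dot v w).
  by move=> w; apply: (@cvg_dot _ _ _ (nbhs w) (cst v) id); [exact: cvg_cst|exact: cvg_id].
apply: (@integral_derive0 R N 1 (fun w => - kerK w) _ v) => //.
- by move=> w; apply: continuousN; exact: continuous_kerK.
- by move=> w /supp_in_kerK ->; rewrite oppr0.
- apply: (@continuous_mul_supp _ _ 1); first by move=> w _; exact: cd.
    exact: continuous_kerk.
  exact: supp_in_kerk.
- exact/supp_in_mul/supp_in_kerk.
move=> w; have dK : differentiable (@kerK R N) w by have [+ _] := @kerK_smooth R N 1; exact.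
have := is_deriveN (derivableP (diff_derivable (v := v) dK)).
by rewrite derive_dot// grad_kerK dotNl opprK dotZl dotC mulrC.
Qed.

(* A second-order comparison at a pair of points replaces the Hessian test of
   the maximum principle, which needs u to be C^2. *)
Lemma two_point_comparison Omega u F x y v (a b Q e : R) : weak_solution Omega u F ->
  Omega x -> Omega y -> 0 <= a -> 0 <= b -> 0 < e ->
  (forall w, enorm w <= e ->
    u (x + a *: w) - u (y + b *: w) <= u x - u y + dot v w + Q * dot w w) ->
  - a ^+ 2 * F x + b ^+ 2 * F y <= 2 * N%:R * Q.
Proof.
move=> ws Ox Oy a0 b0 e0 uQ; have [oO cu cF _] := ws.
apply/ler_addgt0Pr => e1 e10.
(* The two expansions together lose 2 e2 (a^2 + b^2), which has to stay below e1. *)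
pose e2 := e1 / (2 * (a ^+ 2 + b ^+ 2) + 1).
have D0 : 0 < 2 * (a ^+ 2 + b ^+ 2) + 1.
  by rewrite ltr_wpDl// mulr_ge0// addr_ge0// sqr_ge0.
have e20 : 0 < e2 by rewrite divr_gt0.
have [d1 d10 [xd1 mx]] := mean_value_expansion ws Ox e20.
have [d2 d20 [yd2 my]] := mean_value_expansion ws Oy e20.
have cuO z : Omega z -> {for z, continuous u}.
  by move=> Oz; apply: differentiable_continuous; have [+ _] := cu; exact.
have [r [r0 re ar br]] : exists r : R, [/\ 0 < r, r <= e, a * r <= d1 & b * r <= d2].
  (* The added 1 in the denominators covers a = 0 and b = 0. *)
  exists (Num.min e (Num.min (d1 / (a + 1)) (d2 / (b + 1)))); split.
  - by rewrite !lt_min e0 !divr_gt0 ?ltr_wpDl.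
  - by rewrite ge_min lexx.
  - apply: le_trans (_ : a * (d1 / (a + 1)) <= _).
      by rewrite ler_wpM2l// !ge_min lexx orbT.
    rewrite mulrA ler_pdivrMr ?ltr_wpDl// mulrC ler_pM2l//; lra.
  - apply: le_trans (_ : b * (d2 / (b + 1)) <= _).
      by rewrite ler_wpM2l// !ge_min lexx !orbT.
    rewrite mulrA ler_pdivrMr ?ltr_wpDl// mulrC ler_pM2l//; lra.
have ar0 : 0 <= a * r by rewrite mulr_ge0// ltW.
have br0 : 0 <= b * r by rewrite mulr_ge0// ltW.
have := mx (a * r); rewrite ar0 ar => /(_ isT) {}mx.
have := my (b * r); rewrite br0 br => /(_ isT) {}my.
have ci z c d : 0 < d -> eball z d `<=` Omega -> 0 <= c <= d ->
  mu.-integrable setT (EFin \o (fun w => (u (z + c *: w) - u z) * kerk w)).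
  move=> d0 zd /andP[c0 cd].
  apply: (@integrable_dilation_mul Omega (fun y => u y - u z) z d) => //.
  - exact: ltW.
  - by move=> y' Oy'; apply: continuousB; [exact: cuO|exact: cst_continuous].
  - exact: continuous_kerk.
  - exact: supp_in_kerk.
  - by rewrite ger0_norm.
have Ix := ci x (a * r) d1 d10 xd1.
have Iy := ci y (b * r) d2 d20 yd2.
rewrite ar0 ar in Ix; rewrite br0 br in Iy.
move: (Ix isT) (Iy isT) => {ci}Ix {}Iy.
have cdot p : continuous (fun w : 'rV[R]_N => dot p w).
  by move=> w; apply: (@cvg_dot _ _ _ (nbhs w) (cst p) id); [exact: cvg_cst|exact: cvg_id].
have cdd : continuous (fun w : 'rV[R]_N => dot w w).
  by move=> w; apply: (@cvg_dot _ _ _ (nbhs w) id id); exact: cvg_id.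
have Iv : mu.-integrable setT (EFin \o (fun w => r * (dot v w * kerk w))).
  apply: (continuous_supp_integrable ler01).
    suff H w : {for w, continuous (fun w => r * (dot v w * kerk w))} by exact: H.
    apply: continuousM; first exact: cst_continuous.
    by apply: continuousM; [exact: cdot|exact: continuous_kerk].
  exact/supp_in_mul/supp_in_mul/supp_in_kerk.
have Iv' : mu.-integrable setT (EFin \o (fun w => dot v w * kerk w)).
  apply: (continuous_supp_integrable ler01).
    suff H w : {for w, continuous (fun w => dot v w * kerk w)} by exact: H.
    by apply: continuousM; [exact: cdot|exact: continuous_kerk].
  exact/supp_in_mul/supp_in_kerk.
have Iq : mu.-integrable setT (EFin \o (fun w => Q * r ^+ 2 * (dot w w * kerk w))).
  apply: (continuous_supp_integrable ler01).
    suff H w : {for w, continuous (fun w => Q * r ^+ 2 * (dot w w * kerk w))} by exact: H.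
    apply: continuousM; first exact: cst_continuous.
    by apply: continuousM; [exact: cdd|exact: continuous_kerk].
  exact/supp_in_mul/supp_in_mul/supp_in_kerk.
have Iq' : mu.-integrable setT (EFin \o (fun w => dot w w * kerk w)).
  apply: (continuous_supp_integrable ler01).
    suff H w : {for w, continuous (fun w => dot w w * kerk w)} by exact: H.
    by apply: continuousM; [exact: cdd|exact: continuous_kerk].
  exact/supp_in_mul/supp_in_kerk.
(* The hypothesis is taken at r w, multiplied by [kerk] w and integrated; the quadratic term yields
   N [kappa]. *)
have : \int[mu]_w ((u (x + (a * r) *: w) - u x) * kerk w) -
       \int[mu]_w ((u (y + (b * r) *: w) - u y) * kerk w) <= Q * r ^+ 2 * (N%:R * kappa).
  rewrite -integral_sqr_kerk -RintegralZl//.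
  have -> : \int[mu]_w (Q * r ^+ 2 * (dot w w * kerk w)) =
      \int[mu]_w (r * (dot v w * kerk w) + Q * r ^+ 2 * (dot w w * kerk w)).
    by rewrite RintegralD// [in RHS]RintegralZl// integral_dot_kerk mulr0 add0r.
  rewrite -RintegralB//; apply: le_Rintegral => //.
  - by have := integrableB measurableT Ix Iy; exact: eq_integrable.
  - by have := integrableD measurableT Iv Iq; exact: eq_integrable.
  move=> w _; have [w1|w1] := leP (enorm w) 1; last by rewrite supp_in_kerk// !mulr0 subr0 addr0.
  have -> : r * (dot v w * kerk w) + Q * r ^+ 2 * (dot w w * kerk w) =
    (r * dot v w + Q * r ^+ 2 * dot w w) * kerk w by ring.
  rewrite -mulrBl ler_wpM2r ?kerk_ge0//.
  have := uQ (r *: w); rewrite !scalerA => H.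
  have {H} := H _; rewrite enormZ gtr0_norm// => H.
  have rwe : r * enorm w <= e.
    by apply: le_trans re; rewrite ler_piMr// ltW.
  have := H rwe; rewrite !dotE.
  have -> : Q * (r * (r * dot w w)) = Q * r ^+ 2 * dot w w by ring.
  lra.
move: mx my; rewrite !ler_norml => /andP[mx _] /andP[_ my] E.
have k0 := @kappa_gt0 R N.
have {mx my E} : (- a ^+ 2 * F x + b ^+ 2 * F y - 2 * e2 * (a ^+ 2 + b ^+ 2)) * (r ^+ 2 * kappa / 2) <=
  2 * N%:R * Q * (r ^+ 2 * kappa / 2).
  by move: mx my E; rewrite !exprMn; set X := \int[mu]_w _; set Y := \int[mu]_w _; lra.
rewrite ler_pM2r; last by rewrite divr_gt0// mulr_gt0// exprn_gt0.
have : 2 * e2 * (a ^+ 2 + b ^+ 2) <= e1.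
  rewrite /e2 mulrAC mulrA ler_pdivrMr//; nra.
lra.
Qed.

End mean_value.

(** * The interior gradient estimate for -Delta u = F *)

Section linear_gradient_estimate.
Context {R : realType} {N : nat}.
Local Notation mu := (lebesgue_rV R N).
Local Notation kappa := (@kappa R N).
Implicit Types (f g u F h chi : 'rV[R]_N -> R) (c r s e m A : R) (x y w v z : 'rV[R]_N) (i : 'I_N).
Implicit Types (Omega : set 'rV[R]_N).

Lemma is_derive_dilation u x s w v : differentiable u (x + s *: w) ->
  is_derive w v (fun w => u (x + s *: w)) (s * 'D_v u (x + s *: w)).
Proof.
move=> du.
have E : (fun h : R => h^-1 *: (((fun w => u (x + s *: w)) \o shift w) (h *: v) - u (x + s *: w)))
    = (fun h : R => h^-1 *: ((u \o shift (x + s *: w)) (h *: (s *: v)) - u (x + s *: w))).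
  apply/funext => h /=; congr (_ *: (u _ - _)).
  by rewrite scalerDr addrCA !scalerA (mulrC s).
have dv := diff_derivable (v := s *: v) du.
have -> : s * 'D_v u (x + s *: w) = 'D_(s *: v) u (x + s *: w).
  by rewrite !deriveE// linearZ.
by apply: DeriveDef; rewrite /derivable /derive E.
Qed.

(** Integration by parts in w moves the derivative from u to [kerK], so the mean of a partial
    derivative at scale s is controlled by sup |u| / s. *)
Lemma partial_average Omega u x r s i : Cn 1 Omega u -> 0 < r -> eball x r `<=` Omega ->
  `|s| <= r ->
  \int[mu]_w (u (x + s *: w) * (w ord0 i * kerk w)) =
  s * \int[mu]_w (partial i u (x + s *: w) * kerK w).
Proof.
move=> cu r0 xr sr.
have [du dpu] := cu.
have cuO z : Omega z -> {for z, continuous u}.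
  by move=> Oz; apply: differentiable_continuous; exact: du.
have ck : continuous (fun w : 'rV[R]_N => w ord0 i * kerk w).
  exact/continuous_coord_mul/continuous_kerk.
have sk : supp_in 1 (fun w : 'rV[R]_N => w ord0 i * kerk w) by exact/supp_in_mul/supp_in_kerk.
have c1 := continuous_dilation_mul (ltW r0) xr (dpu i) (@continuous_kerK R N) (@supp_in_kerK R N) sr.
have c2 := continuous_dilation_mul (ltW r0) xr cuO ck sk sr.
have c3 := continuous_dilation_mul (ltW r0) xr cuO (@continuous_kerK R N) (@supp_in_kerK R N) sr.
have i1 := integrable_dilation_mul (ltW r0) xr (dpu i) (@continuous_kerK R N) (@supp_in_kerK R N) sr.
have i2 := integrable_dilation_mul (ltW r0) xr cuO ck sk sr.
have cs1 : continuous (fun w => s * (partial i u (x + s *: w) * kerK w)).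
  suff H w : {for w, continuous (fun w => s * (partial i u (x + s *: w) * kerK w))} by exact: H.
  by apply: continuousM; [exact: cst_continuous|exact: c1].
have si1 : mu.-integrable setT (EFin \o (fun w => s * (partial i u (x + s *: w) * kerK w))).
  apply: (continuous_supp_integrable ler01 cs1).
  exact/supp_in_mul/supp_in_mul/supp_in_kerK.
rewrite -RintegralZl//.
apply/esym/eqP; rewrite -subr_eq0 -RintegralB//; apply/eqP.
apply: (@integral_derive0 R N 1 (fun w => u (x + s *: w) * kerK w) _ (delta_mx ord0 i)) => //.
- exact/supp_in_mul/supp_in_kerK.
- suff H w : {for w, continuous (fun w => s * (partial i u (x + s *: w) * kerK w) -
    u (x + s *: w) * (w ord0 i * kerk w))} by exact: H.
  by apply: continuousB; [exact: cs1|exact: c2].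
- by move=> w w1; rewrite supp_in_kerK// supp_in_kerk// !mulr0 subr0.
move=> w; have [w1|w1] := leP (enorm w) 1; last first.
  (* Here u need not be differentiable at x + s w, but [kerK] vanishes near w. *)
  apply: (@near_eq_is_derive _ _ _ (cst 0)).
    near=> y; rewrite /= [kerK y](_ : _ = 0) ?mulr0//.
    by apply/esym; near: y; exact: near_supp0 (@supp_in_kerK R N) w1.
  by apply: is_derive_eq; rewrite supp_in_kerK// supp_in_kerk// !mulr0 subr0.
have duw : differentiable u (x + s *: w) by apply/du/xr/(eball_affine x (ltW r0) sr w1).
have dK : differentiable (@kerK R N) w by have [+ _] := @kerK_smooth R N 1; exact.
have := is_deriveM (is_derive_dilation (delta_mx ord0 i) duw) (is_derive_partial i dK).
move/is_derive_eq; apply; rewrite /GRing.scale/= partial_kerK -/(partial i u _) /partial; ring.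
Unshelve. all: by end_near. Qed.

Lemma partial_coord_kerK i w : grad (fun w => w ord0 i * kerK w) w =
  kerK w *: delta_mx ord0 i - (w ord0 i * kerk w) *: w.
Proof.
apply/rowP => j; rewrite !mxE.
have dK : differentiable (@kerK R N) w by have [+ _] := @kerK_smooth R N 1; exact.
have [_] := is_deriveM (is_derive_coord i w (delta_mx ord0 j)) (is_derive_partial j dK).
rewrite /partial => ->; rewrite -/(partial j kerK w) partial_kerK /GRing.scale/= !mxE !eqxx/=.
by rewrite eq_sym; ring.
Qed.

Lemma coord_kerK_smooth i k : Cn k setT (fun w : 'rV[R]_N => w ord0 i * kerK w).
Proof. by apply: CnM; [exact: Cn_coord|exact: kerK_smooth]. Qed.

(** By [partial_average] the function is the [kerK]-mean of [partial i u], in a form that can be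
    differentiated although [partial i u] is only continuous. Testing with w_i [kerK] w gives D = Z
    - s times the integral of F w_i [kerK]; the product rule then cancels Z. *)
Lemma is_derive_partial_average Omega u F x r s i : weak_solution Omega u F -> 0 < r ->
  eball x r `<=` Omega -> s \in `]0, r[%R ->
  is_derive s 1 (fun s => s^-1 * \int[mu]_w (u (x + s *: w) * (w ord0 i * kerk w)))
    (- \int[mu]_w (F (x + s *: w) * (w ord0 i * kerK w))).
Proof.
move=> ws r0 xr; rewrite in_itv/= => /andP[s0 sr].
have [oO cu cF _] := ws; have [du dpu] := cu.
have ck : continuous (fun w : 'rV[R]_N => w ord0 i * kerk w).
  exact/continuous_coord_mul/continuous_kerk.
have sk : supp_in 1 (fun w : 'rV[R]_N => w ord0 i * kerk w) by exact/supp_in_mul/supp_in_kerk.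
have sr' : s \in `](- r), r[%R by rewrite in_itv/= sr andbT (lt_trans _ s0)// oppr_lt0.
have dY := is_derive_integral_dilation r0 cu xr ck sk sr'.
have xs : eball x s `<=` Omega by apply: subset_trans xr; apply: eballS; exact: ltW.
have sr1 : `|s| <= r by rewrite gtr0_norm// ltW.
have K0 w : 1 <= enorm w -> w ord0 i * kerK w = 0 by move=> /kerK0 ->; rewrite mulr0.
have := weak_solution_dilation ws s0 xs (@coord_kerK_smooth i) K0.
have i1 := integrable_dilation_mul (ltW r0) xr (dpu i) (@continuous_kerK R N) (@supp_in_kerK R N) sr1.
set Z := \int[mu]_w (partial i u (x + s *: w) * kerK w) in i1 *.
set D := \int[mu]_w (dot (grad u (x + s *: w)) w * (w ord0 i * kerk w)) in dY *.
have i2 : mu.-integrable setT (EFin \o (fun w => dot (grad u (x + s *: w)) w * (w ord0 i * kerk w))).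
  apply: (continuous_supp_integrable ler01); last exact: supp_in_mul.
  apply: (@continuous_mul_supp _ _ 1 _ (fun w => dot (grad u (x + s *: w)) w)) => // w w1.
  apply: (@cvg_dot _ _ _ (nbhs w) (fun w => grad u (x + s *: w)) id); last exact: cvg_id.
  have xw : Omega (x + s *: w) by apply: xr; exact: eball_affine (ltW r0) sr1 w1.
  have cA : {for w, continuous (fun w : 'rV[R]_N => x + s *: w)} by exact: continuous_affine.
  exact: (continuous_comp cA (continuous_grad cu xw)).
have -> : \int[mu]_w dot (grad u (x + s *: w)) (grad (fun w => w ord0 i * kerK w) w) = Z - D.
  rewrite /Z /D -RintegralB//; apply: eq_Rintegral => w _.
  rewrite partial_coord_kerK dotDr dotNr !dotZr mulrC; congr (_ * _ - _); last by rewrite mulrC.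
  rewrite /dot (bigD1 i)//= big1 ?addr0 ?mxE ?eqxx ?mulr1// => j ji.
  by rewrite [X in _ * X]mxE eqxx (negbTE ji) mulr0.
move=> E.
have dV : is_derive s 1 (fun s : R => s^-1 : R) (- s ^- 2).
  apply: is_derive_eq; first exact: (@is_deriveV _ id _ _ _ (lt0r_neq0 s0) (is_derive_id _ _)).
  by rewrite [LHS]mulr1.
have := is_deriveM dV dY; move/is_derive_eq; apply.
rewrite (partial_average i cu r0 xr sr1) -/Z /GRing.scale/=.
have -> : D = Z - s * \int[mu]_w (F (x + s *: w) * (w ord0 i * kerK w)) by rewrite -E; ring.
by field; rewrite gt_eqF.
Qed.

(** The [kerK]-mean of [partial i u] tends to [kappa] times its value at x as s tends to 0, is at
    most a multiple of m/r at s = r/2 by integration by parts, and varies by at most r A [kappa] in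
    between. *)
Lemma partial_estimate Omega u F x r m A i : weak_solution Omega u F -> 0 < r ->
  eball x r `<=` Omega -> 0 <= m -> 0 <= A ->
  (forall z, eball x r z -> `|u z| <= m) -> (forall z, eball x r z -> `|F z| <= A) ->
  `|partial i u x| <= (2 * (\int[mu]_w kerk w) / kappa + 1) * (m / r + r * A).
Proof.
move=> ws r0 xr m0 A0 um FA.
have [oO cu cF _] := ws; have [du dpu] := cu.
have k0 := @kappa_gt0 R N.
have Ox : Omega x by apply: xr; apply: eball_center; exact: ltW.
have cuO z : Omega z -> {for z, continuous u}.
  by move=> Oz; apply: differentiable_continuous; exact: du.
set k1 := \int[mu]_w kerk w.
have k10 : 0 <= k1 by apply: Rintegral_ge0 => w _; exact: kerk_ge0.
have ck : continuous (fun w : 'rV[R]_N => w ord0 i * kerk w).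
  exact/continuous_coord_mul/continuous_kerk.
have sk : supp_in 1 (fun w : 'rV[R]_N => w ord0 i * kerk w) by exact/supp_in_mul/supp_in_kerk.
have cK : continuous (fun w : 'rV[R]_N => w ord0 i * kerK w).
  exact/continuous_coord_mul/continuous_kerK.
have sK : supp_in 1 (fun w : 'rV[R]_N => w ord0 i * kerK w) by exact/supp_in_mul/supp_in_kerK.
have cst_int (a : R) f : continuous f -> supp_in 1 f -> mu.-integrable setT (EFin \o (fun w => a * f w)).
  move=> cf sf; apply: (continuous_supp_integrable ler01); last exact: supp_in_mul.
  suff H w : {for w, continuous (fun w => a * f w)} by exact: H.
  by apply: continuousM; [exact: cst_continuous|exact: cf].
have ki := continuous_supp_integrable ler01 (@continuous_kerk R N) (@supp_in_kerk R N).
pose Y s := \int[mu]_w (u (x + s *: w) * (w ord0 i * kerk w)).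
pose FK s := \int[mu]_w (F (x + s *: w) * (w ord0 i * kerK w)).
have wi (w : 'rV[R]_N) : enorm w <= 1 -> `|w ord0 i| <= 1.
  by move=> w1; exact: le_trans (coord_le_enorm w i) w1.
have Yb s : `|s| <= r -> `|Y s| <= m * k1.
  move=> sr; rewrite /k1 -RintegralZl//; apply: norm_Rintegral_le.
  - exact: integrable_dilation_mul (ltW r0) xr cuO ck sk sr.
  - exact: cst_int (@continuous_kerk R N) (@supp_in_kerk R N).
  move=> w; have [w1|w1] := leP (enorm w) 1; last first.
    by rewrite supp_in_kerk// !mulr0 normr0.
  rewrite 2!normrM (ger0_norm (kerk_ge0 w)) ler_pM ?(mulr_ge0 (normr_ge0 _) (kerk_ge0 _))//.
    by apply: um; exact: eball_affine (ltW r0) sr w1.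
  by rewrite ler_piMl ?kerk_ge0// wi.
have FKb s : `|s| <= r -> `|FK s| <= A * kappa.
  move=> sr; rewrite /kappa -RintegralZl//; last exact: integrable_kerK.
  apply: norm_Rintegral_le.
  - exact: integrable_dilation_mul (ltW r0) xr cF cK sK sr.
  - exact: cst_int (@continuous_kerK R N) (@supp_in_kerK R N).
  move=> w; have [w1|w1] := leP (enorm w) 1; last first.
    by rewrite supp_in_kerK// !mulr0 normr0.
  rewrite 2!normrM (ger0_norm (kerK_ge0 w)) ler_pM ?(mulr_ge0 (normr_ge0 _) (kerK_ge0 _))//.
    by apply: FA; exact: eball_affine (ltW r0) sr w1.
  by rewrite ler_piMl ?kerK_ge0// wi.
have main e : 0 < e -> `|partial i u x| * kappa <= (2 * k1 * m / r + A * kappa * r) + e * kappa.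
  move=> e0.
  have [d d0 [xd dZ]] := average_continuous oO Ox e0 (dpu i).
  (* The bound d makes the mean close to its limit, and r/4 keeps s below r/2. *)
  pose s := Num.min d (r / 4).
  have s0 : 0 < s by rewrite lt_min d0 divr_gt0.
  have sd : s <= d by rewrite ge_min lexx.
  have sr4 : s <= r / 4 by rewrite ge_min lexx orbT.
  have := dZ s; rewrite (gtr0_norm s0) => /(_ sd) {}dZ.
  have sr : `|s| <= r by rewrite gtr0_norm//; lra.
  have r2r : `|r / 2| <= r by rewrite gtr0_norm; lra.
  pose h t := t^-1 * Y t.
  have hs : h s = \int[mu]_w (partial i u (x + s *: w) * kerK w).
    by rewrite /h /Y (partial_average i cu r0 xr sr) mulrA mulVf ?mul1r// gt_eqF.
  rewrite -hs in dZ.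
  have dh (t : R) : t \in `[s, r / 2]%R -> is_derive t 1 h (- FK t).
    rewrite in_itv/= => /andP[st tr]; apply: (is_derive_partial_average i ws r0 xr).
    by rewrite in_itv/=; apply/andP; split; lra.
  have dh' (t : R) : t \in `]s, (r / 2)[%R -> is_derive t 1 h (- FK t).
    by move=> /subset_itv_oo_cc; exact: dh.
  have ch : {within `[s, r / 2], continuous h}.
    by apply: derivable_within_continuous => t /dh[].
  have sr2 : s <= r / 2 by lra.
  have [t] := MVT_segment sr2 dh' ch.
  rewrite in_itv/= => /andP[st tr] E.
  have tr' : `|t| <= r by rewrite ger0_norm; lra.
  have h2 : `|h (r / 2)| <= 2 * k1 * m / r.
    rewrite /h normrM gtr0_norm ?invr_gt0 ?divr_gt0// invf_div.
    have -> : 2 * k1 * m / r = 2 / r * (m * k1) by ring.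
    by rewrite ler_wpM2l// ?Yb// divr_ge0// ltW.
  have h3 : `|h s - h (r / 2)| <= A * kappa * r.
    rewrite distrC E normrM normrN ler_pM// ?FKb//.
    by rewrite ger0_norm; lra.
  have -> : `|partial i u x| * kappa = `|partial i u x * kappa| by rewrite normrM (gtr0_norm k0).
  have -> : partial i u x * kappa = h (r / 2) + (h s - h (r / 2)) + (partial i u x * kappa - h s) by ring.
  rewrite (le_trans (ler_normD _ _))// lerD//; last by rewrite distrC.
  by rewrite (le_trans (ler_normD _ _))// lerD.
have {main} : `|partial i u x| * kappa <= 2 * k1 * m / r + A * kappa * r.
  apply/ler_addgt0Pr => e e0; have := main (e / kappa) (divr_gt0 e0 k0).
  by rewrite divfK// gt_eqF.
rewrite -ler_pdivlMr// => /le_trans; apply.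
have -> : (2 * k1 * m / r + A * kappa * r) / kappa = 2 * k1 / kappa * (m / r) + r * A.
  by field; rewrite !gt_eqF.
rewrite mulrDl mul1r mulrDr.
have a1 : 0 <= m / r by rewrite divr_ge0// ltW.
have a2 : 0 <= 2 * k1 / kappa * (r * A) by rewrite !mulr_ge0// ?invr_ge0// ltW.
lra.
Qed.

(** The constant precedes Omega, u, F and r: it is built from N and the integrals of the two kernels
    only. *)
Lemma linear_gradient_estimate : exists2 C : R, 0 < C &
  forall Omega u F x r m A, weak_solution Omega u F -> 0 < r ->
  eball x r `<=` Omega -> 0 <= m -> 0 <= A ->
  (forall z, eball x r z -> `|u z| <= m) -> (forall z, eball x r z -> `|F z| <= A) ->
  enorm (grad u x) <= C * (m / r + r * A).
Proof.
have k1 : 0 <= 2 * (\int[mu]_w kerk w) / kappa + 1.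
  rewrite addr_ge0// divr_ge0 ?(ltW (@kappa_gt0 R N))// mulr_ge0//.
  by apply: Rintegral_ge0 => w _; exact: kerk_ge0.
exists (N%:R * (2 * (\int[mu]_w kerk w) / kappa + 1) + 1); first by rewrite ltr_wpDl// mulr_ge0.
move=> Omega u F x r m A ws r0 xr m0 A0 um FA.
have B0 : 0 <= m / r + r * A by rewrite addr_ge0 ?divr_ge0 ?mulr_ge0// ltW.
apply: le_trans (enorm_le_mx_norm _) _.
rewrite mulrDl mul1r -[leLHS]addr0 lerD// -[leRHS]mulrA ler_wpM2l//.
rewrite [leLHS]/Num.norm/= mx_normrE; apply/bigmax_leP; split; first exact: mulr_ge0.
move=> [a i] _ /=; rewrite /grad mxE.
exact: partial_estimate ws r0 xr m0 A0 um FA.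
Qed.

End linear_gradient_estimate.

(** * The doubled maximum *)

Section powers.
Context {R : realType}.
Implicit Types (a b p q t : R).

(** Convexity of t^q in the form of Young's inequality for a^(q-1) b with exponents q/(q-1) and q,
    so that a = 0 is no exception. *)
Lemma powR_tangent_le a b q : 0 <= a -> 0 <= b -> 1 < q ->
  a `^ q + q * a `^ (q - 1) * (b - a) <= b `^ q.
Proof.
move=> a0 b0 q1; have q0 : 0 < q by lra.
have q10 : 0 < q - 1 by lra.
have aq : a * a `^ (q - 1) = a `^ q by exact: mulr_powRB1.
have := @conjugate_powR R (a `^ (q - 1)) b (q / (q - 1)) q (powR_ge0 _ _) b0.
rewrite divr_gt0// => /(_ isT q0).
rewrite invf_div -powRrM => H.
have {H} := H _; rewrite (_ : (q - 1) * (q / (q - 1)) = q); last by field; rewrite gt_eqF.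
have -> : (q - 1) / q + q^-1 = 1 by field; rewrite gt_eqF.
move=> /(_ erefl) H.
have : q * (a `^ (q - 1) * b) <= q * (a `^ q * ((q - 1) / q) + b `^ q / q).
  by rewrite ler_pM2l.
have -> : q * (a `^ q * ((q - 1) / q) + b `^ q / q) = (q - 1) * a `^ q + b `^ q.
  by field; rewrite !gt_eqF.
rewrite mulrBr -[q * _ * a]mulrA [_ * a]mulrC aq; lra.
Qed.

Lemma powR_diff_le a b q : 0 <= a -> 0 <= b -> 1 < q ->
  a `^ q - b `^ q <= q * a `^ (q - 1) * (a - b).
Proof.
move=> a0 b0 q1; have := powR_tangent_le a0 b0 q1.
rewrite -[b - a]opprB mulrN; lra.
Qed.

(** An upper Taylor bound for (1+e)^-n. The lower bound on e gives (1+e)^-1 <= 2, the source of the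
    factor 2 in the recursion C -> 2 (1 + n + C). *)
Lemma inv_expr_le (n : nat) : exists2 C : R, 0 <= C &
  forall e : R, - (1 / 2) <= e -> (1 + e)^-1 ^+ n <= 1 - n%:R * e + C * e ^+ 2.
Proof.
elim: n => [|n [C C0 IH]].
  by exists 0 => // e _; rewrite expr0 !mul0r subr0 addr0.
exists (2 * (1 + n%:R + C)); first by rewrite mulr_ge0// !addr_ge0.
move=> e e2; have e1 : 0 < 1 + e by lra.
have i0 : 0 < (1 + e)^-1 by rewrite invr_gt0.
have i2 : (1 + e)^-1 <= 2.
  by rewrite -[leRHS]invrK lef_pV2 ?posrE ?invr_gt0//; lra.
rewrite exprSr.
apply: le_trans (ler_wpM2r (ltW i0) (IH e e2)) _.
have -> : (1 - n%:R * e + C * e ^+ 2) / (1 + e) =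
  1 - n.+1%:R * e + (1 + n%:R + C) * e ^+ 2 * (1 + e)^-1.
  by rewrite -natr1; field; rewrite gt_eqF.
rewrite lerD2l (_ : 2 * _ * _ = (1 + n%:R + C) * e ^+ 2 * 2); last by ring.
by rewrite ler_wpM2l// mulr_ge0 ?sqr_ge0// !addr_ge0.
Qed.

(* Weighted arithmetic-geometric mean for u^p + M W^q, with weights
   (p-1)/(2p) and (p+1)/(2p). *)
Lemma critical_M_young (N : nat) (p M u W : R) : (0 < N)%N -> 1 < p -> M0 N p <= M ->
  0 < u -> 0 < W ->
  8 * N%:R * p * u `^ (p - 1) * W ^+ 2 <= (u `^ p + M * W `^ (2 * p / (p + 1))) ^+ 2.
Proof.
move=> N0 p1 MM u0 W0.
have pp : 0 < p by lra.
have p0 : p != 0 by rewrite gt_eqF.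
have pm : 0 < p - 1 by lra.
have pP : 0 < p + 1 by lra.
have N0' : 0 < N%:R :> R by rewrite ltr0n.
have Mpos : 0 < M.
  by apply: lt_le_trans MM; rewrite /M0 !mulr_gt0// powR_gt0// ?mulr_gt0// addr_gt0.
set q := 2 * p / (p + 1).
have X0 : 0 < u `^ p by exact: powR_gt0.
have Y0 : 0 < M * W `^ q by rewrite mulr_gt0// powR_gt0.
pose al := (p - 1) / (2 * p); pose be := (p + 1) / (2 * p).
have al0 : 0 < al by rewrite divr_gt0// mulr_gt0.
have be0 : 0 < be by rewrite divr_gt0// mulr_gt0.
have amgm : (u `^ p / al) `^ al * (M * W `^ q / be) `^ be <= u `^ p + M * W `^ q.
  have := @conjugate_powR R ((u `^ p / al) `^ al) ((M * W `^ q / be) `^ be) al^-1 be^-1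
    (powR_ge0 _ _) (powR_ge0 _ _).
  rewrite !invr_gt0 !invrK => /(_ al0 be0) H; have {H} := H _.
  have Xa : 0 <= u `^ p / al by exact/ltW/divr_gt0.
  have Yb : 0 <= M * W `^ q / be by exact/ltW/divr_gt0.
  rewrite -!powRrM !mulfV ?gt_eqF// !powRr1//.
  by rewrite !divfK ?gt_eqF//; apply; rewrite /al /be; field.
have E0 : 0 < (u `^ p / al) `^ al * (M * W `^ q / be) `^ be.
  by rewrite mulr_gt0// powR_gt0// divr_gt0.
apply: (@le_trans _ _ (((u `^ p / al) `^ al * (M * W `^ q / be) `^ be) ^+ 2)); last first.
  by rewrite lerXn2r// nnegrE ltW//; exact: addr_gt0.
have PE (a x : R) : 0 < a -> a `^ x = expR (x * ln a) by move=> a0; rewrite /powR gt_eqF.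
have L (a b : R) : 0 < a -> 0 < b -> ln (a * b) = ln a + ln b by move=> a0 b0; rewrite lnM ?posrE.
have Ld (a b : R) : 0 < a -> 0 < b -> ln (a / b) = ln a - ln b by move=> a0 b0; rewrite ln_div ?posrE.
have N2 : 0 < N%:R + 2 :> R by lra.
have N6 : 0 < 6 * N%:R :> R by rewrite mulr_gt0.
have M00 : 0 < M0 N p by rewrite /M0 !mulr_gt0// powR_gt0.
have lnM0 : ln (M0 N p) = - ((p - 1) / (p + 1)) * ln 2 + p / (p + 1) * (ln 6 + ln N%:R) +
   (p - 1) / (p + 1) * ln (N%:R + 2) + (p - 1) / (p + 1) * ln (p - 1) - p / (p + 1) * ln p + ln (p + 1).
  rewrite /M0 L//; last by rewrite !mulr_gt0// powR_gt0.
  by rewrite !PE// -!expRD expRK L// [X in _ + X + ln (p + 1)]mulNr.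
have lnMM : ln (M0 N p) <= ln M by rewrite ler_ln ?posrE.
(* With both sides as exponentials the claim is linear in the logarithms. *)
rewrite [leLHS](_ : _ = expR (3 * ln 2 + ln N%:R + ln p + (p - 1) * ln u + 2 * ln W)); last first.
  rewrite !expRD PE// (_ : 3 * ln 2 = ln 8); last first.
    by rewrite -ln_powR powR_mulrn//; congr ln; ring.
  rewrite (_ : 2 * ln W = ln (W ^+ 2)); last by rewrite lnXn// mulr_natl.
  by rewrite !lnK ?posrE ?exprn_gt0.
rewrite (PE _ _ (divr_gt0 X0 al0)) (PE _ _ (divr_gt0 Y0 be0)).
rewrite -expRD -expRM_natl ler_expR.
rewrite (Ld _ _ X0 al0) (Ld _ _ Y0 be0) (L M)// ?powR_gt0// !ln_powR.
have -> : ln al = ln (p - 1) - ln 2 - ln p by rewrite /al Ld ?mulr_gt0// L// opprD addrA.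
have -> : ln be = ln (p + 1) - ln 2 - ln p by rewrite /be Ld ?mulr_gt0// L// opprD addrA.
have l6 : ln 6 = ln 2 + ln 3 :> R by rewrite -L//; congr ln; lra.
have l3 : 0 <= ln 3 :> R by rewrite ln_ge0//; lra.
have lN : ln 2 <= ln (N%:R + 2) :> R by rewrite ler_ln ?posrE//; lra.
rewrite -(ler_pM2l pp).
have -> : p * (2%:R * (al * (p * ln u - (ln (p - 1) - ln 2 - ln p)) +
    be * (ln M + q * ln W - (ln (p + 1) - ln 2 - ln p)))) =
  (p - 1) * (p * ln u - (ln (p - 1) - ln 2 - ln p)) + (p + 1) * ln M + 2 * p * ln W
   - (p + 1) * (ln (p + 1) - ln 2 - ln p).
  by rewrite /al /be /q; field; rewrite p0 gt_eqF.
have : (p + 1) * ln (M0 N p) <= (p + 1) * ln M by rewrite ler_pM2l.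
have -> : (p + 1) * ln (M0 N p) = - (p - 1) * ln 2 + p * (ln 6 + ln N%:R) +
   (p - 1) * ln (N%:R + 2) + (p - 1) * ln (p - 1) - p * ln p + (p + 1) * ln (p + 1).
  by rewrite lnM0; field; rewrite gt_eqF.
(* Once ln M is bounded below by ln of [M0] and 6 is split as 2 times 3, the difference of the two
   sides is the sum of these two terms. *)
have h1 : 0 <= p * ln 3 by rewrite mulr_ge0// ltW.
have h2 : 0 <= (p - 1) * (ln (N%:R + 2) - ln 2) by rewrite mulr_ge0 ?subr_ge0// ltW.
rewrite l6; nra.
Qed.

End powers.

(** * Touching quadratics and the Taylor bound of the barrier *)

Section doubling.
Context {R : realType} {N : nat}.
Implicit Types (u : 'rV[R]_N -> R) (x y w v z b : 'rV[R]_N) (r e k A : R).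
Implicit Types (Omega : set 'rV[R]_N).

(** If w = grad u x - b were nonzero, a small step h w would raise u by about h (b . w + |w|^2),
    more than the quadratic allows. *)
Lemma grad_of_touch u x b k e : 0 < e -> differentiable u x ->
  (forall w, enorm w <= e -> u (x + w) - u x <= dot b w + k * dot w w) -> grad u x = b.
Proof.
move=> e0 du touch; apply/eqP; rewrite -subr_eq0; set w := grad u x - b.
apply/negPn/negP => w0.
have ww : 0 < dot w w.
  rewrite -sqr_enorm exprn_gt0// lt_def enorm_ge0 andbT.
  by rewrite enorm_eq0.
have Dw : dot (grad u x) w = dot b w + dot w w by rewrite -dotDl; congr dot; rewrite /w addrC subrK.
have cv : (fun h : R => h^-1 *: ((u \o shift x) (h *: w) - u x)) @ 0^' --> 'D_w u x.
  exact: (diff_derivable (v := w) du).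
rewrite derive_dot// Dw in cv.
have eps0 : 0 < dot w w / 2 by rewrite divr_gt0.
have := cv; move=> /cvgrPdist_le/(_ _ eps0); rewrite /dnbhs /= => /nbhs_ballP[d /= d0 dP].
(* The bounds put h in the range of the difference quotient and h w in that of the touching, and
   make k h at most 1/4: the quotient is at least b . w + |w|^2 / 2 but at most b . w + |w|^2 /
   4. *)
pose h := Num.min (d / 2) (Num.min (e / (enorm w + 1)) (4^-1 / (`|k| + 1))).
have h0 : 0 < h.
  rewrite !lt_min !divr_gt0 ?invr_gt0 ?ltr_wpDl ?enorm_ge0//.
have hd : h <= d / 2 by rewrite ge_min lexx.
have he : h <= e / (enorm w + 1) by rewrite !ge_min lexx orbT.
have hk : h <= 4^-1 / (`|k| + 1) by rewrite !ge_min lexx !orbT.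
have /= := dP h; rewrite /ball/= sub0r normrN gtr0_norm// => H; have {H} := H _ _.
rewrite (le_lt_trans hd) ?ltr_pdivrMr// ?ltr_pMr ?ltr1n// => /(_ isT).
rewrite gt_eqF// => /(_ isT) {dP}; rewrite ler_norml => /andP[_].
rewrite lerBlDr => H.
have hw : enorm (h *: w) <= e.
  rewrite enormZ gtr0_norm//.
  apply: (@le_trans _ _ (e / (enorm w + 1) * enorm w)); first by rewrite ler_wpM2r ?enorm_ge0.
  rewrite mulrAC ler_pdivrMr ?ltr_wpDl ?enorm_ge0// ler_pM2l// lerDl//.
clearbody w h.
have := touch _ hw; rewrite !dotE (addrC x) => T.
have : h^-1 * (u (h *: w + x) - u x) <= dot b w + k * h * dot w w.
  rewrite ler_pdivrMl//; apply: le_trans T _; rewrite le_eqVlt; apply/orP; left; apply/eqP; ring.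
have : k * h <= 4^-1.
  apply: (@le_trans _ _ (`|k| * (4^-1 / (`|k| + 1)))).
    apply: (@le_trans _ _ (`|k| * h)); first by rewrite ler_wpM2r ?ler_norm// ltW.
    by rewrite ler_wpM2l.
  rewrite mulrA ler_pdivrMr ?ltr_wpDl// mulrC ler_pM2l// lerDl//.
rewrite /GRing.scale/= in H; nra.
Qed.

Definition gap x r y : R := r ^+ 2 - dot (y - x) (y - x).

Lemma gap_gt0_enorm x r y : 0 < r -> 0 < gap x r y -> enorm (y - x) <= r.
Proof.
move=> r0; rewrite subr_gt0 -sqr_enorm => h.
by rewrite -(ler_pXn2r (n := 2))// ?nnegrE ?enorm_ge0// ltW// ltW.
Qed.

Lemma gapD x r y w : gap x r (y + w) = gap x r y - (2 * dot (y - x) w + dot w w).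
Proof. by rewrite /gap (addrAC y w) !dotE (dotC w y) (dotC w x); ring. Qed.

(** Moving by w multiplies the gap t by 1 + ep with |ep| <= 3 r |w| / t, and (1 + ep)^-n has a
    Taylor bound. Both error terms are relative to the barrier itself, each derivative costing a
    factor r/t, and C depends on n alone. *)
Lemma barrier_touch (n : nat) : exists2 C : R, 0 <= C & forall x r A y,
  0 < r -> 0 <= A -> 0 < gap x r y ->
  exists2 e, 0 < e & exists2 z, enorm z <= 2 * n%:R * (A * (r ^+ 2 / gap x r y) ^+ n) * (r / gap x r y) &
  forall w, enorm w <= e ->
    0 < gap x r (y + w) /\
    A * (r ^+ 2 / gap x r (y + w)) ^+ n <= A * (r ^+ 2 / gap x r y) ^+ n + dot z w +
      C * (A * (r ^+ 2 / gap x r y) ^+ n) * (r / gap x r y) ^+ 2 * dot w w.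
Proof.
have [C0 C00 inv] := @inv_expr_le R n.
exists (n%:R + 9 * C0); first by rewrite addr_ge0// mulr_ge0.
move=> x r A y r0 A0 t0; set t := gap x r y in t0 *.
have dr := gap_gt0_enorm r0 t0.
set d := y - x in dr *.
have tr : t <= r ^+ 2 by rewrite /t /gap lerBlDr lerDl dot_ge0.
(* With |w| <= r the gap changes by at most 3 r |w|, and with |w| <= t/(6 r) by at most t/2, so ep
   >= -1/2. *)
exists (Num.min r (t / (6 * r))).
  by rewrite lt_min r0 divr_gt0// mulr_gt0.
set B := A * (r ^+ 2 / t) ^+ n.
have B0 : 0 <= B by rewrite mulr_ge0// exprn_ge0// divr_ge0 ?sqr_ge0// ltW.
exists ((2 * n%:R * B / t) *: d).
  have nB : 0 <= 2 * n%:R * B by exact: (mulr_ge0 (mulr_ge0 (ler0n _ 2) (ler0n _ n)) B0).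
  rewrite enormZ ger0_norm; last by rewrite divr_ge0// ltW.
  by rewrite -[leLHS]mulrA ler_wpM2l// mulrC ler_pM2r// invr_gt0.
move=> w; rewrite le_min => /andP[wr wt].
have ww : dot w w = enorm w ^+ 2 by rewrite sqr_enorm.
have w0 := enorm_ge0 w.
have dw : `|2 * dot d w + dot w w| <= 3 * r * enorm w.
  rewrite (le_trans (ler_normD _ _))// normrM [`|2|]ger0_norm// [`|dot w w|]ger0_norm ?dot_ge0//.
  have := CauchySchwarz_dot d w.
  have : enorm d * enorm w <= r * enorm w by rewrite ler_wpM2r.
  rewrite ww; nra.
have wt' : 3 * r * enorm w <= t / 2.
  by move: wt; rewrite ler_pdivlMr ?mulr_gt0//; lra.
pose ep := - (2 * dot d w + dot w w) / t.
have ept : ep * t = - (2 * dot d w + dot w w) by rewrite /ep divfK// gt_eqF.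
have ep2 : - (1 / 2) <= ep.
  rewrite /ep ler_pdivlMr//; move: dw; rewrite ler_norml => /andP[_]; lra.
have gE : gap x r (y + w) = t * (1 + ep) by rewrite gapD -/d -/t mulrDr mulr1 (mulrC t) ept.
have ep1 : 0 < 1 + ep by lra.
split; first by rewrite gE mulr_gt0.
rewrite gE invfM mulrA exprMn mulrA -/B.
apply: le_trans (ler_wpM2l B0 (inv ep ep2)) _.
rewrite dotZl.
have ti0 : 0 < t^-1 by rewrite invr_gt0.
have epsq : ep ^+ 2 <= 9 * (r / t) ^+ 2 * dot w w.
  have : `|ep| <= 3 * r * enorm w / t.
    by rewrite /ep normrM normrN (gtr0_norm ti0) ler_pM2r.
  rewrite -(ler_pXn2r (n := 2))// ?nnegrE//; last by rewrite divr_ge0 ?(ltW t0)// !mulr_ge0// ltW.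
  rewrite real_normK ?num_real// => /le_trans; apply.
  rewrite !exprMn ww le_eqVlt; apply/orP; left; apply/eqP; ring.
have t1 : t^-1 <= (r / t) ^+ 2.
  by rewrite exprMn -[leLHS]mul1r expr2 mulrA ler_pM2r// ler_pdivlMr// mul1r.
rewrite mulrDr mulrBr mulr1 -!addrA lerD2l.
have -> : 2 * n%:R * B / t * dot d w = B * n%:R * (2 * dot d w / t) by ring.
have -> : - (B * (n%:R * ep)) = B * n%:R * (2 * dot d w / t) + B * n%:R * dot w w * t^-1.
  by rewrite /ep; ring.
rewrite -addrA lerD2l.
have h1 : B * n%:R * dot w w * t^-1 <= B * n%:R * dot w w * (r / t) ^+ 2.
  by rewrite ler_wpM2l// (mulr_ge0 (mulr_ge0 B0 (ler0n _ _)))// dot_ge0.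
have h2 : B * (C0 * ep ^+ 2) <= B * (C0 * (9 * (r / t) ^+ 2 * dot w w)).
  by rewrite ler_wpM2l// ler_wpM2l.
lra.
Qed.

Lemma eball_convex x r y z (t : R) : eball x r y -> eball x r z -> 0 <= t <= 1 ->
  eball x r (y + t *: (z - y)).
Proof.
move=> yx zx /andP[t0 t1]; rewrite /eball/=.
have -> : y + t *: (z - y) - x = (1 - t) *: (y - x) + t *: (z - x).
  by apply/rowP => i; rewrite !mxE; ring.
rewrite (le_trans (enormD _ _))// !enormZ !ger0_norm ?subr_ge0//.
have : (1 - t) * enorm (y - x) <= (1 - t) * r by rewrite ler_wpM2l// subr_ge0.
have : t * enorm (z - x) <= t * r by rewrite ler_wpM2l.
lra.
Qed.

End doubling.

Section doubling_maximum.
Context {R : realType} {N : nat}.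
Implicit Types (u : 'rV[R]_N -> R) (x y w v z b : 'rV[R]_N) (r e k A d : R).
Implicit Types (Omega : set 'rV[R]_N).

Lemma continuous_gap x r : continuous (gap x r).
Proof.
suff H y : {for y, continuous (gap x r)} by exact: H.
apply: (@continuousB _ _ _ (cst (r ^+ 2)) (fun y => dot (y - x) (y - x))).
  exact: cst_continuous.
have c : (fun z : 'rV[R]_N => z - x) @ nbhs y --> y - x.
  by apply: (@continuousB _ _ _ id (cst x)); [exact: cvg_id|exact: cst_continuous].
exact: (cvg_dot _ c c).
Qed.

(** It equals A at the centre and blows up at the sphere of radius r; n is adjusted to q later. *)
Definition barrier x r A (n : nat) y : R := A * (r ^+ 2 / gap x r y) ^+ n.

Lemma continuous_barrier x r A n y : 0 < gap x r y -> {for y, continuous (barrier x r A n)}.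
Proof.
move=> g0; apply: (@continuousM _ _ (cst A) (fun y => (r ^+ 2 / gap x r y) ^+ n)).
  exact: cst_continuous.
have c : {for y, continuous (fun y => r ^+ 2 / gap x r y)}.
  apply: (@continuousM _ _ (cst (r ^+ 2)) (fun y => (gap x r y)^-1)); first exact: cst_continuous.
  by apply: continuousV; [rewrite gt_eqF|exact: continuous_gap].
exact: (continuous_comp c (@exprn_continuous _ n _)).
Qed.

Definition doubled u x0 r A n d x y : R :=
  u x - u y - dot (x - y) (x - y) / (2 * d) - d * barrier x0 r A n y.

Lemma continuous_doubled Omega u x0 r A n d x y : Cn 1 Omega u -> Omega x -> Omega y ->
  0 < gap x0 r y ->
  {for (x, y), continuous (fun z : 'rV[R]_N * 'rV[R]_N => doubled u x0 r A n d z.1 z.2)}.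
Proof.
move=> [du _] Ox Oy gy.
have c1 : (fun z : 'rV[R]_N * 'rV[R]_N => z.1) @ nbhs (x, y) --> x by exact: cvg_fst.
have c2 : (fun z : 'rV[R]_N * 'rV[R]_N => z.2) @ nbhs (x, y) --> y by exact: cvg_snd.
have cx : {for x, continuous u} by exact/differentiable_continuous/du.
have cy : {for y, continuous u} by exact/differentiable_continuous/du.
have u1 : (fun z : 'rV[R]_N * 'rV[R]_N => u z.1) @ nbhs (x, y) --> u x.
  exact: (@cvg_comp _ _ _ _ u _ _ _ c1 cx).
have u2 : (fun z : 'rV[R]_N * 'rV[R]_N => u z.2) @ nbhs (x, y) --> u y.
  exact: (@cvg_comp _ _ _ _ u _ _ _ c2 cy).
have b2 : (fun z : 'rV[R]_N * 'rV[R]_N => barrier x0 r A n z.2) @ nbhs (x, y) --> barrier x0 r A n y.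
  exact: (@cvg_comp _ _ _ _ (barrier x0 r A n) _ _ _ c2 (continuous_barrier (A := A) (n := n) gy)).
have c12 : (fun z : 'rV[R]_N * 'rV[R]_N => z.1 - z.2) @ nbhs (x, y) --> x - y.
  exact: cvgB.
have dd := cvg_dot _ c12 c12.
apply: (cvgB (cvgB (cvgB u1 u2) _) _).
  by apply: cvgM; [exact: dd|exact: cvg_cst].
by apply: cvgM; [exact: cvg_cst|exact: b2].
Qed.

(** The maximum is taken over a compact product on which the barrier is finite. Its positivity
    forces x close to y and bounds the barrier at y, so both points are interior and the maximum is
    a free local one. Uniform continuity of grad u then expresses all the bounds through |grad
    u(x)|, for a positive d instead of in a limit. *)
Lemma doubling_max Omega u x0 R0 A (n : nat) d0 : Cn 1 Omega u -> 0 < R0 ->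
  eball x0 R0 `<=` Omega -> 0 < A -> (0 < n)%N -> 0 < d0 ->
  A < enorm (grad u x0) ^+ 2 / 2 ->
  exists d x y e, [/\ 0 < d <= d0, 0 < e, eball x0 R0 x, 0 < gap x0 (R0 / 2) y &
   [/\ grad u x = d^-1 *: (x - y),
    barrier x0 (R0 / 2) A n y <= 3 / 2 * enorm (grad u x) ^+ 2,
    u x - u y <= 2 * d * enorm (grad u x) ^+ 2 &
    forall x' y', enorm (x' - x) <= e -> enorm (y' - y) <= e ->
     doubled u x0 (R0 / 2) A n d x' y' <= doubled u x0 (R0 / 2) A n d x y]].
Proof.
move=> cu R00 xR A0 n0 d00 Ag; have [du dpu] := cu.
set r := R0 / 2.
have r0 : 0 < r by rewrite divr_gt0.
have R0E : R0 = 2 * r by rewrite /r; field.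
have [C C0 uC] := grad_bounded (ltW R00) cu xR.
set g0 := enorm (grad u x0).
have x0K : eball x0 R0 x0 by apply: eball_center; exact: ltW.
have g0C : g0 <= C by exact: uC.
have g00 : 0 < g0.
  rewrite lt_def enorm_ge0 andbT; apply/eqP => g00.
  by move: Ag; rewrite -/g0 g00 expr0n/= mul0r ltNge (ltW A0).
have C1 : 0 < C by exact: lt_le_trans g0C.
pose gm := g0 ^+ 2 / 2 - A.
have gm0 : 0 < gm by rewrite subr_gt0.
pose sA := Num.sqrt A.
have sA0 : 0 < sA by rewrite sqrtr_gt0.
have sAE : sA ^+ 2 = A by rewrite sqr_sqrtr// ltW.
(* The second bound makes the maximum positive; the first will give eta <= |grad u(x)|. *)
pose eta := Num.min (sA / 2) (gm / (2 * g0)).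
have eta0 : 0 < eta by rewrite lt_min !divr_gt0// mulr_gt0.
have eta1 : eta <= sA / 2 by rewrite ge_min lexx.
have eta2 : eta * g0 <= gm / 2.
  apply: (@le_trans _ _ (gm / (2 * g0) * g0)).
    by rewrite ler_wpM2r ?(ltW g00)// ge_min lexx orbT.
  by rewrite invfM mulrA divfK// gt_eqF.
have cg z : eball x0 R0 z -> {for z, continuous (grad u)}.
  by move=> zR; exact: continuous_grad cu (xR _ zR).
have N10 : 0 < N%:R + 1 :> R by rewrite ltr_wpDl.
have en0 : 0 < eta / (N%:R + 1) by rewrite divr_gt0.
have [d1 d10 ucg'] := compact_unif_continuous (@compact_eball _ _ x0 R0) cg en0.
have ucg z z' : eball x0 R0 z -> enorm (z' - z) <= d1 -> enorm (grad u z' - grad u z) <= eta.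
  move=> zR zd; apply: le_trans (enorm_le_mx_norm _) _.
  apply: (@le_trans _ _ ((N%:R + 1) * (eta / (N%:R + 1)))).
    by rewrite ler_pM// ?lerDl// ucg'.
  by rewrite mulrC divfK// gt_eqF.
clear ucg'; clearbody eta.
(* At the maximum |x - y| <= 2 d C, which must lie within the range d1 of uniform continuity and
   below r/2, so that x stays r/2 away from the sphere of radius R0. *)
pose d := Num.min d0 (Num.min (d1 / (2 * C)) (r / (4 * C))).
have C20 : 0 < 2 * C by rewrite mulr_gt0.
have C40 : 0 < 4 * C by rewrite mulr_gt0.
have dp : 0 < d by rewrite !lt_min d00 !divr_gt0.
have dd0 : d <= d0 by rewrite ge_min lexx.
have dd1 : 2 * d * C <= d1.
  have : d <= d1 / (2 * C) by rewrite !ge_min lexx orbT.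
  by rewrite ler_pdivlMr//; lra.
have ddr : 2 * d * C <= r / 2.
  have : d <= r / (4 * C) by rewrite !ge_min lexx !orbT.
  by rewrite ler_pdivlMr//; lra.
clearbody d.
(* The barrier at y will be below C^2, which forces gap > r^2 / (C^2 / A) > t0, so y is interior to
   S; also t0 <= r^2, so S contains x0. *)
pose t0 := r ^+ 2 / (C ^+ 2 / A + 2).
have CA0 : 0 < C ^+ 2 / A by rewrite divr_gt0// exprn_gt0.
have r20 : 0 < r ^+ 2 by rewrite exprn_gt0.
have t00 : 0 < t0 by rewrite divr_gt0// addr_gt0.
pose S := [set y | t0 <= gap x0 r y].
have SR y : S y -> eball x0 r y.
  by move=> Sy; apply: gap_gt0_enorm => //; exact: lt_le_trans Sy.
have rR : r <= R0 by rewrite R0E; lra.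
have SR0 y : S y -> eball x0 R0 y by move=> /SR; exact: eballS.
have cS : compact S.
  apply: (subclosed_compact _ (@compact_eball _ _ x0 r) SR).
  apply: (@preimage_closed _ _ (gap x0 r) [set t | t0 <= t]).
    by move=> y _; exact: continuous_gap.
  exact: closed_ge.
have Sx0 : S x0.
  rewrite /S/= /gap subrr dot0l subr0 /t0 ler_pdivrMr ?addr_gt0//.
  rewrite ler_peMr ?ltW//; lra.
pose Phi (z : 'rV[R]_N * 'rV[R]_N) := doubled u x0 r A n d z.1 z.2.
pose G := grad u x0.
have z0R : eball x0 R0 (x0 + d *: G).
  rewrite /eball/= addrAC subrr add0r enormZ gtr0_norm//.
  have : d * enorm G <= d * C by rewrite ler_pM2l.
  lra.
have [|||[x y] /set_mem [/= xK yS] zmax] := @compact_EVT_max _ _ Phi (eball x0 R0 `*` S).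
- by exists (x0, x0).
- by apply: compact_setX => //; exact: compact_eball.
- apply: continuous_in_subspaceT => -[a b] /set_mem [/= aK bS].
  apply: (continuous_doubled cu) => //; [exact: xR|exact/xR/SR0|exact: lt_le_trans bS].
have max a b : eball x0 R0 a -> S b -> doubled u x0 r A n d a b <= doubled u x0 r A n d x y.
  by move=> aK bS; apply: (zmax (a, b)); apply/mem_set; split.
(* At (x0 + d G, x0), the best choice for the linear part of u, the value is at least d (|G|^2 / 2 -
   A - eta |G|). *)
have Phi0 : 0 < doubled u x0 r A n d x y.
  apply: lt_le_trans (max _ _ z0R Sx0).
  have dif (t : R) : t \in `[0, 1]%R -> differentiable u (x0 + t *: (d *: G)).
    rewrite in_itv/= => t01; apply/du/xR.
    have := eball_convex x0K z0R t01.
    by rewrite (addrC x0 (d *: G)) addrK addrC.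
  have [t t01 E] := mvt_line dif.
  have xG : x0 + d *: G - x0 = d *: G by rewrite addrAC subrr add0r.
  rewrite /doubled E xG !dotE.
  have -> : barrier x0 r A n x0 = A.
    by rewrite /barrier /gap subrr dot0l subr0 divff ?gt_eqF// expr1n mulr1.
  have GG : dot G G = g0 ^+ 2 by rewrite sqr_enorm.
  set H := grad u _.
  have HG : enorm (H - G) <= eta.
    apply: ucg => //; rewrite addrAC subrr add0r !enormZ -/g0.
    move: t01; rewrite in_itv/= => /andP[t0' t1]; rewrite !gtr0_norm//.
    have dg : d * g0 <= d * C by rewrite ler_pM2l.
    have dg0 : 0 <= d * g0 by rewrite mulr_ge0// ltW.
    have : t * (d * g0) <= d * g0 by rewrite ler_piMl// ltW.
    lra.
  have : - (eta * g0) <= dot (H - G) G.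
    have := CauchySchwarz_dot (H - G) G; rewrite ler_norml => /andP[+ _].
    have : enorm (H - G) * enorm G <= eta * g0 by rewrite ler_wpM2r ?enorm_ge0.
    lra.
  rewrite dotDl dotNl GG => h.
  have -> : d * dot H G - d * (d * g0 ^+ 2) / (2 * d) - d * A = d * (dot H G - g0 ^+ 2 / 2 - A).
    by field; rewrite gt_eqF.
  rewrite mulr_gt0//; move: eta2 gm0; rewrite /gm; lra.
pose h := enorm (x - y).
have h0 : 0 <= h by exact: enorm_ge0.
have yK := SR0 _ yS.
have dif (t : R) : t \in `[0, 1]%R -> differentiable u (y + t *: (x - y)).
  by rewrite in_itv/= => t01; apply/du/xR/eball_convex.
have [t t01 E] := mvt_line dif.
rewrite (addrC y (x - y)) subrK in E.
set H := grad u _ in E.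
have t01' : 0 <= t <= 1 by move: t01; rewrite in_itv/= => /andP[? ?]; rewrite !ltW.
have HC : enorm H <= C by apply: uC; exact: eball_convex.
have uh : u x - u y <= C * h.
  by rewrite E (le_trans (dot_le_enorm _ _))// ler_wpM2r.
pose zy := barrier x0 r A n y.
have PhiE : doubled u x0 r A n d x y = u x - u y - h ^+ 2 / (2 * d) - d * zy by rewrite /doubled -sqr_enorm.
have gy : 0 < gap x0 r y by exact: lt_le_trans yS.
have T1 : 1 <= r ^+ 2 / gap x0 r y.
  by rewrite ler_pdivlMr// mul1r /gap lerBlDr lerDl dot_ge0.
have AT : A * (r ^+ 2 / gap x0 r y) <= zy.
  by rewrite /zy /barrier ler_pM2l// ler_eXnr.
have zy0 : A <= zy by apply: le_trans AT; rewrite ler_peMr// ltW.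
have key : h ^+ 2 / (2 * d) + d * zy < u x - u y by move: Phi0; rewrite PhiE; lra.
have d2 : 0 < 2 * d by rewrite mulr_gt0.
have hC : h <= 2 * d * C.
  have h1 : h ^+ 2 / (2 * d) < C * h.
    have : 0 <= d * zy by rewrite mulr_ge0// ltW// (lt_le_trans A0).
    lra.
  have [hn|hp] := leP h 0; first by apply: le_trans hn _; rewrite mulr_ge0// ltW.
  move: h1; rewrite ltr_pdivrMr// expr2 -subr_gt0.
  have -> : C * h * (2 * d) - h * h = h * (2 * d * C - h) by ring.
  by rewrite pmulr_rgt0// subr_gt0 => /ltW.
(* The maximum of C h - h^2 / (2 d) over h is d C^2 / 2. *)
have zyC : zy < C ^+ 2.
  have : d * zy < C * h - h ^+ 2 / (2 * d) by lra.
  have : C * h - h ^+ 2 / (2 * d) <= d * C ^+ 2 / 2.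
    have : 0 <= (h - d * C) ^+ 2 / (2 * d) by rewrite divr_ge0 ?sqr_ge0// ltW.
    have -> : (h - d * C) ^+ 2 / (2 * d) = h ^+ 2 / (2 * d) - C * h + d * C ^+ 2 / 2.
      by field; rewrite gt_eqF.
    lra.
  move=> h1 h2; have h3 : d * zy < d * C ^+ 2.
    have : 0 < d * C ^+ 2 by rewrite mulr_gt0// exprn_gt0.
    lra.
  by move: h3; rewrite ltr_pM2l.
have gt : t0 < gap x0 r y.
  have : r ^+ 2 / gap x0 r y < C ^+ 2 / A by rewrite ltr_pdivlMr// mulrC (le_lt_trans AT).
  rewrite ltr_pdivrMr// => h1; rewrite /t0 ltr_pdivrMr ?addr_gt0//.
  by apply: lt_le_trans h1 _; rewrite mulrC ler_pM2l//; lra.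
have : nbhs y [set y' | t0 < gap x0 r y'].
  apply: (@continuous_gap x0 r y [set t | t0 < t]).
  by apply: open_nbhs_nbhs; split => //; exact: open_gt.
move=> /nbhs_eball[e1 e10 ye1].
have xr2 : enorm (x - x0) + r / 2 <= R0.
  have -> : x - x0 = (x - y) + (y - x0) by rewrite addrA subrK.
  have := enormD (x - y) (y - x0); have := SR _ yS; rewrite /eball/= -/h; lra.
pose e := Num.min e1 (r / 2).
have ep : 0 < e by rewrite lt_min e10 divr_gt0.
have localmax x' y' : enorm (x' - x) <= e -> enorm (y' - y) <= e ->
    doubled u x0 r A n d x' y' <= doubled u x0 r A n d x y.
  move=> xe ye; apply: max.
    apply: (eball_sub xr2); apply: le_trans xe _; by rewrite ge_min lexx orbT.
  by apply/ltW/ye1; apply: le_trans ye _; rewrite ge_min lexx.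
(* With y fixed, maximality says that a quadratic touches u from above at x. *)
have gradE : grad u x = d^-1 *: (x - y).
  apply: (@grad_of_touch _ _ u x _ (1 / (2 * d)) e ep); first exact/du/xR.
  move=> w we; have := localmax (x + w) y.
  rewrite addrAC subrr add0r => /(_ we); rewrite subrr enorm0 => /(_ (ltW ep)).
  rewrite /doubled (_ : x + w - y = (x - y) + w); last by rewrite addrAC.
  rewrite (dotDl (x - y)) !(dotDr _ (x - y)) (dotC w (x - y)) dotZl.
  have -> : (dot (x - y) (x - y) + dot (x - y) w + (dot (x - y) w + dot w w)) / (2 * d) =
    dot (x - y) (x - y) / (2 * d) + (d^-1 * dot (x - y) w + 1 / (2 * d) * dot w w).
    by field; rewrite gt_eqF.
  lra.
have hE : enorm (grad u x) = h / d by rewrite gradE enormZ gtr0_norm ?invr_gt0// mulrC.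
have hd : h = d * enorm (grad u x) by rewrite hE mulrC divfK// gt_eqF.
set W := enorm (grad u x) in hE hd *.
have W0 : 0 <= W by exact: enorm_ge0.
have HW : enorm (H - grad u x) <= eta.
  apply: ucg => //.
  have -> : y + t *: (x - y) - x = - (1 - t) *: (x - y).
    by apply/rowP => i; rewrite !mxE; ring.
  rewrite enormZ normrN ger0_norm ?subr_ge0; last by case/andP: t01'.
  apply: le_trans dd1; apply: le_trans hC; rewrite -/h ler_piMl// lerBlDr lerDl.
  by case/andP: t01'.
have uW : u x - u y <= (W + eta) * h.
  rewrite E -(subrK (grad u x) H) dotDl mulrDl addrC.
  apply: lerD; first exact: dot_le_enorm.
  by apply: le_trans (dot_le_enorm _ _) _; rewrite ler_wpM2r.
(* As h = d W, positivity of the maximum reads W^2 / 2 + zy < W^2 + eta W after division by d. *)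
have z2 : zy < W ^+ 2 / 2 + eta * W.
  have : d * (W ^+ 2 / 2 + zy) < d * ((W + eta) * W).
    have -> : d * ((W + eta) * W) = (W + eta) * h by rewrite hd; ring.
    have -> : d * (W ^+ 2 / 2 + zy) = h ^+ 2 / (2 * d) + d * zy.
      by rewrite hd; field; rewrite gt_eqF.
    exact: lt_le_trans key uW.
  rewrite ltr_pM2l//; lra.
(* If W < eta <= sqrt A / 2, the bound [z2] would put zy below A, its least possible value. The
   constants 3/2 and 2 of the statement come from eta <= W. *)
have etaW : eta <= W.
  rewrite leNgt; apply/negP => Weta; move: z2.
  have : W ^+ 2 <= eta ^+ 2 by rewrite lerXn2r ?nnegrE// ltW.
  have : eta * W <= eta ^+ 2 by rewrite expr2 ler_wpM2l// ltW.
  have : eta ^+ 2 <= (sA / 2) ^+ 2 by rewrite lerXn2r ?nnegrE// ltW// divr_gt0.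
  rewrite (_ : (sA / 2) ^+ 2 = A / 4); [lra|by rewrite -sAE; field].
have eW : eta * W <= W ^+ 2 by rewrite expr2 ler_wpM2r.
exists d, x, y, e; split => //; first by rewrite dp.
split => //; first by rewrite -/W -/zy; move: z2 eW; lra.
rewrite -/W; apply: le_trans uW _; rewrite hd.
have : 0 <= d * (W ^+ 2 - eta * W) by rewrite mulr_ge0 ?subr_ge0// ltW.
by rewrite mulrBr; lra.
Qed.

End doubling_maximum.

(** * The universal gradient bound *)

Section gradient_bound.
Context {R : realType} {N : nat}.
Implicit Types (u : 'rV[R]_N -> R) (x y w v z b : 'rV[R]_N) (r e k A d p q M : R).
Implicit Types (Omega : set 'rV[R]_N).

Definition reaction p q M u x : R := u x `^ p + M * enorm (grad u x) `^ q.

Lemma M0_gt0 p : (0 < N)%N -> 1 < p -> 0 < M0 N p :> R.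
Proof.
move=> N0 p1; have N0' : 0 < N%:R :> R by rewrite ltr0n.
rewrite /M0 !mulr_gt0//; try (apply: powR_gt0; rewrite ?mulr_gt0//); lra.
Qed.

Lemma dot_sub_sqr x y : dot (x - y) (x - y) = dot x x - 2 * dot x y + dot y y.
Proof. by rewrite !dotE (dotC y x); ring. Qed.

Lemma gradN u x : differentiable u x -> grad (fun z => - u z) x = - grad u x.
Proof.
move=> du; apply/rowP => i; rewrite !mxE /partial.
by have [_ ->] := is_deriveN (is_derive_partial i du).
Qed.

(* The inequality of the Bernstein method at the doubled maximum, up to the
   error terms coming from the barrier. *)
Lemma doubling_inequality Omega u F x y d e s z (B : 'rV[R]_N -> R) (D : R) :
  weak_solution Omega u F -> Omega x -> Omega y -> 0 < d -> 0 < e ->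
  (forall x' y', enorm (x' - x) <= e -> enorm (y' - y) <= e ->
     u x' - u y' - dot (x' - y') (x' - y') / (2 * d) - d * B y' <=
     u x - u y - dot (x - y) (x - y) / (2 * d) - d * B y) ->
  (forall w, enorm w <= e -> B (y + w) <= B y + dot z w + D * dot w w) ->
  0 <= s -> d * s <= 1 ->
  grad u y = d^-1 *: (x - y) - d *: z /\
  - (1 - d * s) ^+ 2 * F x + F y <= 2 * N%:R * (d * (s ^+ 2 / 2 + D)).
Proof.
move=> ws Ox Oy d0 e0 max Bz s0 ds1.
have [oO [du _] cF _] := ws.
have dn0 : d != 0 by rewrite gt_eqF.
split.
  (* With x fixed, a quadratic touches - u from above at y; the barrier shifts the gradient by d
     z. *)
  have : grad (fun z => - u z) y = - (d^-1 *: (x - y)) + d *: z.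
    apply: (@grad_of_touch _ _ (fun z => - u z) y _ (1 / (2 * d) + d * D) e e0).
      by apply: differentiableN; exact: du.
    move=> w we; have := max x (y + w).
    rewrite subrr enorm0 => /(_ (ltW e0)); rewrite addrAC subrr add0r => /(_ we).
    have dB : d * B (y + w) <= d * (B y + dot z w + D * dot w w) by rewrite ler_pM2l// Bz.
    rewrite (_ : x - (y + w) = x - y - w); last by rewrite opprD addrA.
    move: (x - y) => P; rewrite !(dotDl, dotDr, dotNl, dotNr, dotZl) (dotC w P).
    have -> : (dot P P - dot P w + (- dot P w - - dot w w)) / (2 * d) =
      dot P P / (2 * d) - d^-1 * dot P w + 1 / (2 * d) * dot w w by field.
    lra.
  rewrite gradN; last exact: du.
  by move/(congr1 -%R); rewrite opprK opprD opprK.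
rewrite -[F y in leLHS]mul1r -[1 in X in _ + X * _ <= _](expr1n _ 2).
(* Under these moves x - y changes by - d s w only, so the penalty |x - y|^2 / (2 d) has
   second-order part d s^2 / 2, again a multiple of d. *)
apply: (@two_point_comparison R N Omega u F x y (- (s *: (x - y)) + d *: z) (1 - d * s) 1 _ e) => //.
  by rewrite subr_ge0.
move=> w we.
have aw : enorm ((1 - d * s) *: w) <= e.
  rewrite enormZ ger0_norm ?subr_ge0//; apply: le_trans we.
  by rewrite ler_piMl ?enorm_ge0// gerBl mulr_ge0// ltW.
have := max (x + (1 - d * s) *: w) (y + w).
have shiftE (a b : 'rV[R]_N) : a + b - a = b by rewrite addrAC subrr add0r.
rewrite !shiftE => /(_ aw we).
have dB : d * B (y + w) <= d * (B y + dot z w + D * dot w w) by rewrite ler_pM2l// Bz.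
rewrite scale1r (_ : x + (1 - d * s) *: w - (y + w) = (x - y) - (d * s) *: w); last first.
  by apply/rowP => i; rewrite !mxE; ring.
move: (x - y) => P; rewrite dot_sub_sqr !(dotDl, dotNl, dotZl, dotZr).
have -> : (dot P P - 2 * (d * s * dot P w) + d * s * (d * s * dot w w)) / (2 * d) =
  dot P P / (2 * d) - s * dot P w + d * (s ^+ 2 / 2) * dot w w by field.
lra.
Qed.

(** After division by d, and since s^2 (d f) <= K s^2, the gain is 2 s f - 2 K s^2, maximal at s = f
    / (2 K) with value f^2 / (2 K). Half of it pays for Y, the other half is the conclusion. *)
Lemma doubling_algebra (d f g s D Y Z K : R) : 0 < d -> 0 < K -> f = 2 * K * s ->
  d * f <= K -> - (1 - d * s) ^+ 2 * f + g <= 2 * K * (d * (s ^+ 2 / 2 + D)) ->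
  f - g <= d * (Y + Z) -> 4 * K * Y <= f ^+ 2 -> f ^+ 2 / (4 * K) <= Z + 2 * K * D.
Proof.
move=> d0 K0 fs df ineq fg Yf.
have sdf : s ^+ 2 * (d * f) <= s ^+ 2 * K by rewrite ler_wpM2l// sqr_ge0.
have : d * (2 * s * f - s ^+ 2 * (d * f) - K * s ^+ 2 - 2 * K * D) <= d * (Y + Z).
  by apply: le_trans fg; lra.
rewrite ler_pM2l// => main.
have K4 : 0 < 4 * K by lra.
have Y4 : Y <= f ^+ 2 / (4 * K) by rewrite ler_pdivlMr// mulrC.
have E : 2 * s * f - 2 * (s ^+ 2 * K) = 2 * (f ^+ 2 / (4 * K)).
  by rewrite fs; field; rewrite gt_eqF.
lra.
Qed.

(** If the bound failed at x0, the doubled maximum would yield M^2 / (4 N) W^(2 q) on the left and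
    barrier terms with a smaller coefficient of the same W^(2 q) on the right. The exponent
    -(p+1)/(p-1) is -1/(q-1). *)
Lemma gradient_estimate p q M : (0 < N)%N -> 1 < p -> q = 2 * p / (p + 1) -> M0 N p <= M ->
  exists2 C, 0 < C & forall Omega u x0 R0,
    weak_solution Omega u (reaction p q M u) -> (forall x, Omega x -> 0 < u x) ->
    0 < R0 -> eball x0 R0 `<=` Omega ->
    enorm (grad u x0) <= C * R0 `^ (- ((p + 1) / (p - 1))).
Proof.
move=> N0 p1 qE MM.
have N0' : 0 < N%:R :> R by rewrite ltr0n.
have M00 : 0 < M by apply: lt_le_trans MM; exact: M0_gt0.
have pp : 0 < p by lra.
have pm : 0 < p - 1 by lra.
have pP : 0 < p + 1 by lra.
have q1E : q - 1 = (p - 1) / (p + 1) by rewrite qE; field; rewrite gt_eqF.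
have q10 : 0 < q - 1 by rewrite q1E divr_gt0.
have q0 : 0 < q by lra.
(* With n (q-1)/2 >= 1 a number T >= 1 is at most (T^n)^((q-1)/2): a factor r/gap then costs no more
   than the power (q-1)/2 of the barrier. *)
pose n := (Num.truncn (2 / (q - 1))).+1.
have nq : 1 <= n%:R * ((q - 1) / 2).
  have : 2 / (q - 1) <= n%:R by rewrite ltW// truncnS_gt.
  by rewrite ler_pdivrMr//; lra.
have [Cz Cz0 Bz] := @barrier_touch R N n.
pose E := 3 * M * q * n%:R + 3 * N%:R * Cz.
have E0 : 0 <= E by rewrite addr_ge0// !mulr_ge0// ltW.
(* The barrier terms will have coefficient 3 M q n ep + 3 N Cz ep^2, to be kept below M^2 / (4
   N). *)
pose ep := Num.min 1 (M ^+ 2 / (4 * N%:R) / (E + 1)).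
have N40 : 0 < 4 * N%:R :> R by rewrite mulr_gt0.
have ep0 : 0 < ep by rewrite lt_min ltr01/= !divr_gt0 ?exprn_gt0// ltr_wpDl.
have ep1 : ep <= 1 by rewrite ge_min lexx.
have epE : 3 * M * q * n%:R * ep + 3 * N%:R * Cz * ep ^+ 2 < M ^+ 2 / (4 * N%:R).
  have e2 : ep ^+ 2 <= ep by rewrite expr2 ler_piMl// ltW.
  have h1 : 3 * N%:R * Cz * ep ^+ 2 <= 3 * N%:R * Cz * ep by rewrite ler_wpM2l// !mulr_ge0.
  have h2 : ep * (E + 1) <= M ^+ 2 / (4 * N%:R).
    by rewrite -ler_pdivlMr ?ltr_wpDl// ge_min lexx orbT.
  by move: h1 h2; rewrite /E mulrDr mulr1 mulrDr; lra.
clearbody ep.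
set ka := (p + 1) / (p - 1).
have kaE : ka = (q - 1)^-1 by rewrite q1E invf_div.
have ka0 : 0 < ka by rewrite divr_gt0.
exists (2 * (ep / 2) `^ (- ka)); first by rewrite mulr_gt0// powR_gt0// divr_gt0.
move=> Omega u x0 R0 ws u0 R00 xR.
have [oO cu cF _] := ws; have [du dpu] := cu.
set F := reaction p q M u in ws cF *.
set r := R0 / 2.
have r0 : 0 < r by rewrite divr_gt0.
have er0 : 0 < ep * r by rewrite mulr_gt0.
(* A is below half the square of 2 (ep r)^(-ka), as the doubled maximum requires, and its 3/2
   cancels the one in the bound of the barrier by W^2. *)
set A := 3 / 2 * (ep * r) `^ (- (2 * ka)).
have A0 : 0 < A by rewrite mulr_gt0// powR_gt0.
have -> : 2 * (ep / 2) `^ (- ka) * R0 `^ (- ka) = 2 * (ep * r) `^ (- ka).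
  by rewrite -mulrA -powRM ?divr_ge0 ?(ltW ep0) ?(ltW R00)// /r; congr (_ * (_ `^ _)); ring.
rewrite leNgt; apply/negP => big.
have Ag : A < enorm (grad u x0) ^+ 2 / 2.
  have p0 : 0 <= 2 * (ep * r) `^ (- ka) by rewrite mulr_ge0// powR_ge0.
  have : (2 * (ep * r) `^ (- ka)) ^+ 2 < enorm (grad u x0) ^+ 2.
    by rewrite ltrXn2r ?nnegrE// enorm_ge0.
  rewrite exprMn -[(_ `^ _) ^+ 2]powR_mulrn ?powR_ge0// -powRrM.
  rewrite (_ : - ka * 2%:R = - (2 * ka)); last by ring.
  have := powR_gt0 (- (2 * ka)) er0; rewrite /A; lra.
have [Fb Fb0 FbP] := continuous_bounded_eball (ltW R00) (fun w wR => cF w (xR w wR)).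
(* This bound on d ensures d F(x) <= N. *)
have d00 : 0 < N%:R / (Fb + 1) by rewrite divr_gt0// ltr_wpDl.
have [d [x [y [e [/andP[d0 dd0] e0 xK gy [gradx BW uW max]]]]]] :=
  doubling_max cu R00 xR A0 (ltn0Sn _ : (0 < n)%N) d00 Ag.
have Ox := xR _ xK.
have yr := gap_gt0_enorm r0 gy.
have Oy : Omega y by apply: xR; apply: eballS yr; rewrite /r; lra.
have [e1 e10 [z zb zB]] := Bz x0 r A y r0 (ltW A0) gy.
set W := enorm (grad u x) in BW uW.
set B := A * _ in zb zB.
have BE : barrier x0 r A n y = B by [].
rewrite -/r BE in BW.
have T1 : 1 <= r ^+ 2 / gap x0 r y.
  by rewrite ler_pdivlMr// mul1r /gap lerBlDr lerDl dot_ge0.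
set T := r ^+ 2 / gap x0 r y in T1.
have BET : B = A * T ^+ n by [].
have B0 : 0 < B by rewrite BET mulr_gt0// exprn_gt0// (lt_le_trans ltr01).
have W0 : 0 < W.
  rewrite lt_def enorm_ge0 andbT; apply/eqP => W0.
  by move: BW; rewrite W0 expr0n/= mulr0 leNgt B0.
pose W1 := W `^ (q - 1).
have W10 : 0 < W1 by exact: powR_gt0.
have Wq : W `^ q = W * W1 by rewrite /W1 mulr_powRB1// ltW.
(* T <= (B/A)^((q-1)/2) and B/A <= W^2 (ep r)^(2 ka), where ka (q-1) = 1. *)
have Tg : r / gap x0 r y <= ep * W1.
  have -> : r / gap x0 r y = T / r by rewrite /T; field; rewrite !gt_eqF.
  rewrite ler_pdivrMr// mulrAC mulrC.
  have T0 : 0 <= T by rewrite (le_trans ler01).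
  apply: (@le_trans _ _ (T `^ (n%:R * ((q - 1) / 2)))).
    by rewrite -[leLHS](powRr1 T0) ler_powR.
  rewrite powRrM powR_mulrn//.
  have -> : W1 * (ep * r) = (W ^+ 2 * (ep * r) `^ (2 * ka)) `^ ((q - 1) / 2).
    rewrite powRM ?sqr_ge0 ?powR_ge0// -powRrM -powR_mulrn ?enorm_ge0// -powRrM.
    rewrite (_ : 2%:R * ((q - 1) / 2) = q - 1); last by field.
    rewrite (_ : 2 * ka * _ = 1) ?powRr1 ?(ltW er0)//.
    by rewrite kaE; field; rewrite gt_eqF.
  apply: ge0_ler_powR.
  - by rewrite divr_ge0// ltW.
  - by rewrite nnegrE exprn_ge0.
  - by rewrite nnegrE mulr_ge0 ?sqr_ge0 ?powR_ge0.
  rewrite -(ler_pM2l A0) -BET; apply: le_trans BW _.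
  rewrite /A powRN le_eqVlt; apply/orP; left; apply/eqP; field.
  by rewrite gt_eqF// powR_gt0.
have gp0 : 0 <= r / gap x0 r y by rewrite divr_ge0// ltW.
have BW2 : B <= 3 / 2 * W ^+ 2 by [].
have zb' : enorm z <= 3 * n%:R * ep * W1 * W ^+ 2.
  apply: le_trans zb _.
  have -> : 3 * n%:R * ep * W1 * W ^+ 2 = 2 * n%:R * (3 / 2 * W ^+ 2) * (ep * W1) by field.
  have n20 : 0 <= 2 * n%:R :> R by rewrite mulr_ge0.
  apply: ler_pM => //; first exact: mulr_ge0 n20 (ltW B0).
  by rewrite ler_wpM2l.
pose D := Cz * B * (r / gap x0 r y) ^+ 2.
have CB0 : 0 <= Cz * B by exact: mulr_ge0 Cz0 (ltW B0).
have D0 : 0 <= D by exact: mulr_ge0 CB0 (sqr_ge0 _).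
have Db : D <= 3 / 2 * Cz * ep ^+ 2 * (W1 ^+ 2 * W ^+ 2).
  have -> : 3 / 2 * Cz * ep ^+ 2 * (W1 ^+ 2 * W ^+ 2) = Cz * (3 / 2 * W ^+ 2) * (ep * W1) ^+ 2 by field.
  apply: ler_pM => //; [exact: sqr_ge0|by rewrite ler_wpM2l|].
  by rewrite lerXn2r// nnegrE// mulr_ge0// ltW.
set f := F x.
have ux := u0 x Ox.
have fE : f = u x `^ p + M * W `^ q by [].
have f0 : 0 < f by rewrite fE ltr_wpDr ?powR_gt0// mulr_ge0 ?powR_ge0// ltW.
have fM : M * (W * W1) <= f by rewrite fE Wq lerDr powR_ge0.
have df : d * f <= N%:R.
  have fb : f <= Fb by apply: le_trans (ler_norm _) (FbP x xK).
  have F10 : 0 < Fb + 1 by rewrite ltr_wpDl.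
  apply: (@le_trans _ _ (N%:R / (Fb + 1) * (Fb + 1))); last by rewrite divfK// gt_eqF.
  by rewrite ler_pM// ?(ltW d0) ?(ltW f0)//; lra.
pose s := f / (2 * N%:R).
have N20 : 0 < 2 * N%:R :> R by rewrite mulr_gt0.
have s0 : 0 < s by rewrite divr_gt0.
have fs : f = 2 * N%:R * s by rewrite /s mulrC divfK// gt_eqF.
have ds1 : d * s <= 1 by rewrite /s mulrA ler_pdivrMr// mul1r; lra.
have eM : 0 < Num.min e e1 by rewrite lt_min e0.
have [] := @doubling_inequality Omega u F x y d (Num.min e e1) s z (barrier x0 r A n) D ws Ox Oy d0 eM.
- move=> x' y'; rewrite !le_min => /andP[xe _] /andP[ye _].
  exact: max.
- move=> w; rewrite le_min => /andP[_ we]; have [_] := zB w we.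
  by rewrite -/B /D /barrier.
- exact: ltW.
- exact: ds1.
move=> grady; rewrite -/f => ineq.
have Wy : W - enorm (grad u y) <= d * enorm z.
  rewrite grady -gradx; have := enormD (grad u x - d *: z) (d *: z).
  by rewrite subrK enormZ (gtr0_norm d0) -/W; lra.
have uy := u0 y Oy.
have up : u x `^ p - u y `^ p <= p * u x `^ (p - 1) * (2 * d * W ^+ 2).
  apply: le_trans (powR_diff_le (ltW ux) (ltW uy) p1) _.
  by rewrite ler_wpM2l// mulr_ge0 ?powR_ge0// ltW.
have q1 : 1 < q by lra.
have gq : W `^ q - enorm (grad u y) `^ q <= q * W1 * (d * enorm z).
  apply: le_trans (powR_diff_le (ltW W0) (enorm_ge0 _) q1) _.
  by rewrite ler_wpM2l// mulr_ge0 ?powR_ge0// ltW.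
have FF : f - F y <= d * (2 * p * u x `^ (p - 1) * W ^+ 2 + M * q * W1 * enorm z).
  rewrite fE /F /reaction.
  have Mgq : M * (W `^ q - enorm (grad u y) `^ q) <= M * (q * W1 * (d * enorm z)) by rewrite ler_pM2l.
  have -> : d * (2 * p * u x `^ (p - 1) * W ^+ 2 + M * q * W1 * enorm z) =
    p * u x `^ (p - 1) * (2 * d * W ^+ 2) + M * (q * W1 * (d * enorm z)) by ring.
  have sp (a1 a2 a3 a4 : R) : a1 + M * a2 - (a3 + M * a4) = (a1 - a3) + M * (a2 - a4) by ring.
  by rewrite sp; exact: lerD up Mgq.
have young := critical_M_young N0 p1 MM ux W0; rewrite -qE -fE in young.
have Y4 : 4 * N%:R * (2 * p * u x `^ (p - 1) * W ^+ 2) <= f ^+ 2.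
  apply: le_trans young; rewrite le_eqVlt; apply/orP; left; apply/eqP.
  by move: (u x `^ (p - 1)) => X; ring.
have f2 := doubling_algebra d0 N0' fs df ineq FF Y4.
have Z1 : M * q * W1 * enorm z <= 3 * M * q * n%:R * ep * (W1 ^+ 2 * W ^+ 2).
  have -> : 3 * M * q * n%:R * ep * (W1 ^+ 2 * W ^+ 2) = M * q * W1 * (3 * n%:R * ep * W1 * W ^+ 2) by ring.
  by rewrite ler_wpM2l// !mulr_ge0// ltW.
have Z2 : 2 * N%:R * D <= 3 * N%:R * Cz * ep ^+ 2 * (W1 ^+ 2 * W ^+ 2).
  have -> : 3 * N%:R * Cz * ep ^+ 2 * (W1 ^+ 2 * W ^+ 2) = 2 * N%:R * (3 / 2 * Cz * ep ^+ 2 * (W1 ^+ 2 * W ^+ 2)) by field.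
  by rewrite ler_wpM2l// ltW.
have WW0 : 0 < W1 ^+ 2 * W ^+ 2 by rewrite mulr_gt0 ?exprn_gt0.
have Z3 : M ^+ 2 / (4 * N%:R) * (W1 ^+ 2 * W ^+ 2) <= f ^+ 2 / (4 * N%:R).
  rewrite mulrAC ler_pM2r ?invr_gt0//.
  have -> : M ^+ 2 * (W1 ^+ 2 * W ^+ 2) = (M * (W * W1)) ^+ 2 by ring.
  by rewrite lerXn2r ?nnegrE ?(ltW f0)// !mulr_ge0 ?ltW.
(* Every term is now a multiple of W1^2 W^2 = W^(2 q), and the choice of ep contradicts this
   inequality. *)
have : M ^+ 2 / (4 * N%:R) * (W1 ^+ 2 * W ^+ 2) <=
    (3 * M * q * n%:R * ep + 3 * N%:R * Cz * ep ^+ 2) * (W1 ^+ 2 * W ^+ 2).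
  have Z12 := le_trans f2 (lerD Z1 Z2).
  by rewrite [leRHS]mulrDl; exact: le_trans Z3 Z12.
by rewrite ler_pM2r// leNgt epE.
Qed.

End gradient_bound.

(** * Interior estimates and the distance to the boundary *)

Section from_definition.
Context {R : realType} {N : nat}.
Local Notation mu := (lebesgue_rV R N).
Implicit Types (u F psi : 'rV[R]_N -> R) (x y w v z b : 'rV[R]_N) (r e k A d p q M m : R).
Implicit Types (Omega : set 'rV[R]_N).

Lemma continuous_powR_gt0 p t : 0 < t -> {for t, continuous (fun s : R => s `^ p)}.
Proof.
move=> t0; apply: differentiable_continuous; apply/derivable1_diffP.
by have [] := is_derive1_powR p t0.
Qed.

(** Zeros of g are treated apart, with the tolerance e^(1/q), since the derivative of the power is
    used only at positive reals. *)
Lemma continuous_enorm_powR (g : 'rV[R]_N -> 'rV[R]_N) x q : 0 < q ->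
  {for x, continuous g} -> {for x, continuous (fun z => enorm (g z) `^ q)}.
Proof.
move=> q0 cg.
have ce : {for x, continuous (fun z => enorm (g z))}.
  exact: (continuous_comp cg (@continuous_enorm _ _ (g x))).
have [g0|g0] := eqVneq (enorm (g x)) 0; last first.
  have gp : 0 < enorm (g x) by rewrite lt_def g0 enorm_ge0.
  have H := (@continuous_comp _ _ _ (fun z => enorm (g z)) (fun s : R => s `^ q) x ce (continuous_powR_gt0 gp)).
  exact: H.
have H : (fun z => enorm (g z) `^ q) @ nbhs x --> (0 : R).
  apply/cvgrPdist_le => e e0.
  have e1 : 0 < e `^ q^-1 by rewrite powR_gt0.
  have : \forall z \near nbhs x, `|enorm (g x) - enorm (g z)| <= e `^ q^-1.
    by move/cvgrPdist_le: ce => /(_ _ e1).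
  apply: filterS => z; rewrite g0 !sub0r !normrN ger0_norm ?enorm_ge0// => h.
  rewrite ger0_norm ?powR_ge0//.
  have := ge0_ler_powR (ltW q0) _ _ h; rewrite !nnegrE enorm_ge0 powR_ge0 => /(_ isT isT).
  by rewrite -powRrM mulVf ?gt_eqF// powRr1// ltW.
rewrite /prop_for /continuous_at.
have <- : 0 = enorm (g x) `^ q by rewrite g0 powR0// gt_eqF.
exact: H.
Qed.

Lemma test_function_supp Omega psi : test_function Omega psi ->
  exists2 c, 0 <= c & supp_in c psi.
Proof.
move=> [_ cpt _].
have [M [_ HM]] := compact_bounded cpt.
exists (N%:R * (`|M| + 1)); first by rewrite mulr_ge0// addr_ge0.
move=> w wc; apply/eqP/negPn/negP => pw.
have /HM : closure [set x | psi x != 0] w by exact: subset_closure.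
move=> /(_ (`|M| + 1)) H.
have : `|w| <= `|M| + 1 by apply: H; rewrite ltr_pwDr// ler_norm.
move=> wM; move: wc; rewrite ltNge; apply/negP/negPn.
by apply: le_trans (enorm_le_mx_norm w) _; rewrite ler_wpM2l.
Qed.

Lemma integrable_test Omega psi F : test_function Omega psi ->
  (forall x, Omega x -> {for x, continuous F}) ->
  mu.-integrable setT (EFin \o (fun x => F x * psi x)).
Proof.
move=> tf cF; have [c c0 psi0] := test_function_supp tf; have [sp _ cl] := tf.
apply: (continuous_supp_integrable c0); last exact: supp_in_mul.
suff H w : {for w, continuous (fun x => F x * psi x)} by exact: H.
have [Kw|nKw] := pselect (closure [set x | psi x != 0] w).
  apply: continuousM; first exact/cF/cl.
  exact: continuous_smooth sp w.
have near0 : nbhs w (~` closure [set x | psi x != 0]).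
  by apply: open_nbhs_nbhs; split => //; apply: closed_openC; exact: closed_closure.
have psi0z z : (~` closure [set x | psi x != 0]) z -> psi z = 0.
  by move=> zS; apply/eqP/negPn/negP => pz; apply: zS; exact: subset_closure.
have H : (fun x => F x * psi x) @ nbhs w --> (0 : R).
  apply: (@cvg_near_cst _ _ 0 (fun x => F x * psi x) (nbhs w)); near=> z.
  by rewrite psi0z ?mulr0//; near: z.
rewrite /prop_for /continuous_at.
have <- : 0 = F w * psi w by rewrite psi0z ?mulr0.
exact: H.
Unshelve. all: by end_near. Qed.

Lemma Rintegral_test Omega psi F : test_function Omega psi ->
  \int[mu]_(x in Omega) (F x * psi x) = \int[mu]_x (F x * psi x).
Proof.
move=> [_ _ cl]; apply: Rintegral_supp => z Oz.
have -> : psi z = 0; last by rewrite mulr0.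
by apply/eqP/negPn/negP => pz; apply/Oz/cl/subset_closure.
Qed.

(** Positivity of u makes u^p continuous. Against a compactly supported test function both terms on
    the right are then integrable, so their integrals combine into one. *)
Lemma positive_solution_weak Omega u p q M : 0 < q -> open Omega ->
  positive_solution p q M Omega u -> weak_solution Omega u (reaction p q M u).
Proof.
move=> q0 oO [[cu _ weak] u0]; have [du _] := cu.
have cup x : Omega x -> {for x, continuous (fun x => u x `^ p)}.
  move=> Ox; have c : {for x, continuous u} by exact/differentiable_continuous/du.
  exact: (@continuous_comp _ _ _ u (fun s : R => s `^ p) x c (continuous_powR_gt0 (u0 x Ox))).
have cgq x : Omega x -> {for x, continuous (fun x => enorm (grad u x) `^ q)}.
  by move=> Ox; apply: continuous_enorm_powR => //; exact: continuous_grad cu Ox.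
have cMgq x : Omega x -> {for x, continuous (fun x => M * enorm (grad u x) `^ q)}.
  by move=> Ox; apply: (@continuousM _ _ (cst M)); [exact: cst_continuous|exact: cgq].
split=> //.
  by move=> x Ox; apply: (@continuousD _ _ _ (fun x => u x `^ p) (fun x => M * enorm (grad u x) `^ q)); [exact: cup|exact: cMgq].
move=> psi tf; rewrite weak// !(Rintegral_test _ tf).
have ip := integrable_test tf cup; have iq := integrable_test tf cgq.
have iM : mu.-integrable setT (EFin \o (fun x => M * (enorm (grad u x) `^ q * psi x))).
  have := integrable_test tf cMgq; apply: eq_integrable => // x _ /=.
  by rewrite mulrA.
rewrite -(RintegralZl M measurableT iq) -(RintegralD measurableT ip iM).
by apply: eq_Rintegral => x _; rewrite /reaction mulrDl mulrA.
Qed.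

End from_definition.

(** * Balls in a domain and the distance to its boundary *)

Section distance.
Context {R : realType} {N : nat}.
Implicit Types (x y z : 'rV[R]_N) (r C s v : R) (Omega : set 'rV[R]_N).

(** If the ball left Omega at y, the first exit point of the segment from x to y would be a boundary
    point at distance at most r. The exit parameter is the minimum of a compact set. *)
Lemma eball_sub_dist Omega x r : open Omega -> Omega x ->
  (r%:E < dist x Omega)%E -> eball x r `<=` Omega.
Proof.
move=> oO Ox rd y yr; apply: contrapT => nOy.
pose seg (t : R) := x + t *: (y - x).
have cseg : continuous seg.
  suff H (t : R) : {for t, continuous seg} by exact: H.
  have c : {for t, continuous (fun t : R => t *: (y - x))}.
    by apply: (@cvgZr_tmp _ _ _ (nbhs t) _ id); exact: cvg_id.
  by apply: (@continuousD _ _ _ (cst x) (fun t : R => t *: (y - x))); [exact: cst_continuous|exact: c].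
pose E := `[0, 1]%classic `&` (seg @^-1` (~` Omega)).
have cE : compact E.
  apply: (@subclosed_compact _ E `[0, 1]%classic).
  - apply: closedI; first exact: interval_closed.
    by apply: preimage_closed; [move=> t _; exact: cseg|rewrite closedC].
  - exact: segment_compact.
  - by move=> t [].
have E1 : E 1.
  split; first by rewrite /= in_itv/= ler01 lexx.
  by rewrite /seg/= scale1r addrC subrK.
have [t /set_mem [t01 tO] tmin] := @compact_EVT_min _ _ id E (ex_intro _ 1 E1) cE
  (continuous_subspaceT (fun t : R => cvg_id)).
have [t0 t1] : 0 <= t /\ t <= 1 by move: t01; rewrite /= in_itv/= => /andP[].
have tpos : 0 < t.
  rewrite lt_def t0 andbT; apply/eqP => t00; apply: tO.
  by rewrite t00 /seg scale0r addr0.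
have bd : boundary Omega (seg t).
  split; last by move=> iy; apply: tO; exact: interior_subset iy.
  move=> B /nbhs_eball[e e0 eB].
  (* A parameter slightly before the exit gives a point of Omega within e of the exit point. *)
  pose t' := Num.max 0 (t - e / (enorm (y - x) + 1)).
  have n1 : 0 < enorm (y - x) + 1 by rewrite ltr_wpDl ?enorm_ge0.
  have t'0 : 0 <= t' by rewrite le_max lexx.
  have t't : t' < t by rewrite gt_max tpos ltrBlDr ltrDl divr_gt0.
  have t'e : t - t' <= e / (enorm (y - x) + 1) by rewrite lerBlDr -lerBlDl le_max lexx orbT.
  exists (seg t'); split.
    apply: contrapT => nO.
    have /tmin : t' \in E by apply/mem_set; split => //; rewrite /= in_itv/= t'0; apply/ltW; exact: lt_le_trans t1.
    by rewrite leNgt t't.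
  apply: eB; rewrite /eball/= /seg.
  have -> : x + t' *: (y - x) - (x + t *: (y - x)) = - ((t - t') *: (y - x)).
    by apply/rowP => i; rewrite !mxE; ring.
  rewrite enormN enormZ ger0_norm ?subr_ge0 ?(ltW t't)//.
    apply: (@le_trans _ _ (e / (enorm (y - x) + 1) * (enorm (y - x) + 1))).
    rewrite ler_pM ?subr_ge0 ?enorm_ge0//; first exact: ltW.
    by rewrite lerDl.
  by rewrite divfK// gt_eqF.
have : (dist x Omega <= (enorm (x - seg t))%:E)%E by apply: ereal_inf_lbound; exists (seg t).
move=> dt; have : (r%:E < r%:E)%E.
  apply: lt_le_trans rd _; apply: le_trans dt _; rewrite lee_fin.
  rewrite (_ : x - seg t = - (t *: (y - x))); last by rewrite /seg opprD addrA subrr add0r.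
  rewrite enormN enormZ ger0_norm//; apply: le_trans yr.
  by rewrite ler_piMl ?enorm_ge0.
by rewrite ltxx.
Qed.

Lemma dist_gt0 Omega x : open Omega -> Omega x -> (0 < dist x Omega)%E.
Proof.
move=> oO Ox.
have /nbhs_eball[e e0 eO] : nbhs x Omega by exact: open_nbhs_nbhs.
apply: (@lt_le_trans _ _ e%:E); first by rewrite lte_fin.
apply: le_ereal_inf_tmp => _ [y [_ nIy] <-]; rewrite lee_fin leNgt; apply/negP => ye.
apply: nIy; rewrite [interior _](interior_id _).1//.
by apply: eO; rewrite /eball/= -enormN opprB ltW.
Qed.

(** For a finite distance d the ball of radius d/2 is admissible, whence the factor 2^s. For an
    infinite distance every radius is, and v <= 0 follows. *)
Lemma distN_bound Omega x s C v : open Omega -> Omega x -> 0 < s -> 0 < C ->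
  (forall r, 0 < r -> eball x r `<=` Omega -> v <= C * r `^ (- s)) ->
  v <= C * 2 `^ s * distN s x Omega.
Proof.
move=> oO Ox s0 C0 vr.
have {}vr r : 0 < r -> (r%:E < dist x Omega)%E -> v <= C * r `^ (- s).
  by move=> r0 rd; apply: vr => //; exact: eball_sub_dist.
have := dist_gt0 oO Ox; rewrite /distN.
case: (dist x Omega) vr => [d| |]// vr d0.
  rewrite lte_fin in d0.
  have -> : C * 2 `^ s * d `^ (- s) = C * (d / 2) `^ (- s).
    by rewrite powRM ?invr_ge0 ?ltW// -powR_inv1// -powRrM mulN1r opprK -mulrA [d `^ _ * _]mulrC.
  by apply: vr; rewrite ?lte_fin; lra.
rewrite mulr0 leNgt; apply/negP => v0.
have t0 : 0 < v / (2 * C) by rewrite divr_gt0// mulr_gt0.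
(* This radius solves C r^(-s) = v/2, absurd for v > 0. *)
have := vr ((v / (2 * C)) `^ (- s^-1)) (powR_gt0 _ t0) (ltry _).
rewrite -powRrM mulrNN mulVf ?gt_eqF// powRr1 ?(ltW t0)// leNgt.
have -> : C * (v / (2 * C)) = v / 2 by field; rewrite gt_eqF.
by rewrite ltr_pdivrMr// ltr_pMr// ltr1n.
Qed.

End distance.

(** * The bound on u *)

Section solution_bound.
Context {R : realType} {N : nat}.
Implicit Types (u : 'rV[R]_N -> R) (x y w v z b : 'rV[R]_N) (r e k p q M m : R).
Implicit Types (Omega : set 'rV[R]_N).

Lemma powR_half r k : 0 < r -> (r / 2) `^ (- k) = 2 `^ k * r `^ (- k).
Proof.
move=> r0.
by rewrite powRM ?invr_ge0 ?(ltW r0)// -powR_inv1// -powRrM mulN1r opprK mulrC.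
Qed.

Lemma continuous_within_eball (f : 'rV[R]_N -> R) x r :
  (forall y, eball x r y -> {for y, continuous f}) -> {within eball x r, continuous f}.
Proof.
move=> cf; apply: continuous_in_subspaceT => y /set_mem.
exact: cf.
Qed.

(** Here y minimises u + k |. - x|^2 on the ball. At an interior minimum u is touched from below by
    a paraboloid whose - Delta is 2 N k. *)
Lemma paraboloid_min Omega u F x r k : weak_solution Omega u F -> 0 < r ->
  eball x r `<=` Omega ->
  exists2 y, eball x r y & u y + k * dot (y - x) (y - x) <= u x /\
    (enorm (y - x) < r -> F y <= 2 * N%:R * k).
Proof.
move=> ws r0 xr; have [oO [du _] _ _] := ws.
pose f y := u y + k * dot (y - x) (y - x).
have cf y : eball x r y -> {for y, continuous f}.
  move=> yr.
  have cu : {for y, continuous u} by exact/differentiable_continuous/du/xr.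
  have cs : {for y, continuous (fun y => y - x)}.
    by apply: (@continuousB _ _ _ id (cst x)); [exact: cvg_id|exact: cst_continuous].
  have cd : {for y, continuous (fun y => k * dot (y - x) (y - x))}.
    apply: (@continuousM _ _ (cst k)); first exact: cst_continuous.
    exact: (@cvg_dot _ _ _ (nbhs y) (fun y => y - x) (fun y => y - x)).
  exact: (@continuousD _ _ _ u (fun y => k * dot (y - x) (y - x))).
have xx : eball x r x by apply: eball_center; exact: ltW.
have [y /set_mem yr ymin] := compact_EVT_min (ex_intro _ x xx) (@compact_eball _ _ x r)
  (continuous_within_eball cf).
exists y => //; split.
  by have /ymin := mem_set xx; rewrite /f subrr dot0l mulr0 addr0.
move=> yx; have Oy := xr _ yr.
have e0 : 0 < r - enorm (y - x) by rewrite subr_gt0.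
(* With a = 0 the first point stays put, and the two-point comparison becomes a one-point test. *)
have := @two_point_comparison R N Omega u F y y ((2 * k) *: (y - x)) 0 1 k _ ws Oy Oy (lexx 0) ler01 e0.
rewrite expr0n/= oppr0 mul0r add0r expr1n mul1r; apply => w we.
rewrite scale0r addr0 scale1r subrr add0r.
have : eball x r (y + w).
  apply: (@eball_sub _ _ x y r (r - enorm (y - x))); first by rewrite addrC subrK.
  by rewrite /eball/= addrAC subrr add0r.
move=> /mem_set/ymin; rewrite /f (addrAC y w) !(dotDl, dotDr, dotZl).
rewrite !(dotC w _).
lra.
Qed.

Lemma solution_estimate p q M : (0 < N)%N -> 1 < p -> q = 2 * p / (p + 1) -> M0 N p <= M ->
  exists2 C, 0 < C & forall Omega u x0 R0,
    weak_solution Omega u (reaction p q M u) -> (forall x, Omega x -> 0 < u x) ->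
    0 < R0 -> eball x0 R0 `<=` Omega ->
    u x0 <= C * R0 `^ (- (2 / (p - 1))).
Proof.
move=> N0 p1 qE MM.
have [C1 C10 grd] := @gradient_estimate R N p q M N0 p1 qE MM.
have M00 : 0 < M by apply: lt_le_trans MM; exact: M0_gt0.
have N0' : 0 < N%:R :> R by rewrite ltr0n.
have pm : 0 < p - 1 by lra.
set s := 2 / (p - 1).
set L0 := (4 * N%:R) `^ (p - 1)^-1.
(* With L = r^(-s), 2 C1 L < u(x0) lets u drop by at most half on the ball, and 2 L0 L < u(x0) makes
   m^(p-1) r^2 exceed 4 N for m = u(x0)/2. *)
pose K := Num.max (2 * C1) (2 * L0).
have K0 : 0 < K by rewrite lt_max mulr_gt0.
exists (K * 2 `^ s); first by rewrite mulr_gt0// powR_gt0.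
move=> Omega u x0 R0 ws u0 R00 xR.
have [oO [du _] _ _] := ws.
rewrite -mulrA -powR_half//; set r := R0 / 2.
have r0 : 0 < r by rewrite divr_gt0.
set L := r `^ (- s); have L_gt0 : 0 < L by exact: powR_gt0.
rewrite leNgt; apply/negP => big.
have {big} [big1 big2] : 2 * C1 * L < u x0 /\ 2 * L0 * L < u x0.
  split; apply: le_lt_trans big; rewrite ler_pM2r// le_max lexx ?orbT//.
have xr : eball x0 r `<=` Omega by move=> y /(eballS _) yr; apply/xR/yr; rewrite /r; lra.
have kaE : r `^ (- ((p + 1) / (p - 1))) * r = L.
  rewrite -[X in _ * X](powRr1 (ltW r0)) -powRD; last by rewrite (gt_eqF r0) implybT.
  by congr (_ `^ _); rewrite /s; field; rewrite gt_eqF.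
have gr y : eball x0 r y -> enorm (grad u y) * r <= C1 * L.
  move=> yr; rewrite -kaE [leRHS]mulrA ler_pM2r//; apply: (grd Omega) => //.
  by apply: subset_trans xR; apply: eball_sub; move: yr; rewrite /eball/= /r; lra.
have ub y : eball x0 r y -> u x0 / 2 <= u y.
  move=> yr.
  have seg (t : R) : 0 <= t <= 1 -> eball x0 r (x0 + t *: (y - x0)).
    by apply: eball_convex => //; apply: eball_center; exact: ltW.
  have [t|t t01] := @mvt_line R N u x0 (y - x0).
    by rewrite in_itv/= => t01; exact/du/xr/seg.
  have /andP[t0 t1] : 0 < t < 1 by move: t01; rewrite in_itv.
  have rt : eball x0 r (x0 + t *: (y - x0)) by apply: seg; rewrite !ltW.
  rewrite (addrC x0 (y - x0)) subrK => eq.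
  have := dot_le_enorm (- grad u (x0 + t *: (y - x0))) (y - x0).
  rewrite dotNl enormN -eq => h1.
  have h2 : enorm (grad u (x0 + t *: (y - x0))) * enorm (y - x0) <= C1 * L.
    by apply: le_trans (gr _ rt); rewrite ler_wpM2l// enorm_ge0.
  by move: h1 h2 big1; clear; lra.
set m := u x0 / 2 in ub.
have Ox : Omega x0 by apply/xr/eball_center/ltW.
have m0 : 0 < m by rewrite divr_gt0// u0.
have mp0 : 0 < m `^ p by exact: powR_gt0.
(* With this k an interior minimum gives m^p <= F(y) <= m^p / 2, and one on the sphere gives k r^2
   <= u(x0) - m = m; both are impossible. *)
have [y yr [ymin yF]] := @paraboloid_min Omega u _ x0 r (m `^ p / (4 * N%:R)) ws r0 xr.
have my := ub y yr.
have [yx|yx] := ltP (enorm (y - x0)) r.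
  have := yF yx; have -> : 2 * N%:R * (m `^ p / (4 * N%:R)) = m `^ p / 2.
    by field; rewrite gt_eqF.
  have h : m `^ p <= u y `^ p.
    apply: ge0_ler_powR => //; rewrite ?nnegrE.
    - by move: p1; clear; lra.
    - exact: ltW.
    - exact/ltW/u0/xr.
  have : 0 <= M * enorm (grad u y) `^ q by rewrite mulr_ge0 ?powR_ge0// ltW.
  by rewrite /reaction; move: h mp0; clear; lra.
have r2 : r ^+ 2 <= dot (y - x0) (y - x0).
  by rewrite -sqr_enorm lerXn2r ?nnegrE ?enorm_ge0// ltW.
have : m `^ p / (4 * N%:R) * r ^+ 2 <= m.
  have : m `^ p / (4 * N%:R) * r ^+ 2 <= m `^ p / (4 * N%:R) * dot (y - x0) (y - x0).
    by rewrite ler_wpM2l// divr_ge0 ?mulr_ge0// ltW.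
  by move: ymin my; rewrite /m; clear; lra.
rewrite -[m `^ p](mulr_powRB1 (ltW m0)); last lra.
rewrite leNgt => /negP; apply.
have {big2} big2 : L0 * L < m by move: big2; rewrite /m; clear; lra.
have : 4 * N%:R * (r ^+ 2)^-1 < m `^ (p - 1).
  have := @gt0_ltr_powR R (p - 1) pm (L0 * L) m.
  rewrite !nnegrE (ltW m0) mulr_ge0 ?powR_ge0// => /(_ isT isT big2).
  rewrite powRM ?powR_ge0// /L0 /L -!powRrM mulVf ?gt_eqF// powRr1 ?mulr_ge0//.
  rewrite (_ : - s * (p - 1) = - 2); last by rewrite /s; field; rewrite gt_eqF.
  by rewrite powRN powR_mulrn// ltW.
have r20 : 0 < r ^+ 2 by rewrite exprn_gt0.
rewrite ltr_pdivrMr// => h.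
have -> : m * m `^ (p - 1) / (4 * N%:R) * r ^+ 2 = m * (m `^ (p - 1) * r ^+ 2 / (4 * N%:R)).
  by field; rewrite gt_eqF.
by rewrite ltr_pMr// ltr_pdivlMr ?mulr_gt0// mul1r.
Qed.

End solution_bound.

(** * The gradient of bounded solutions *)

Section bounded_solutions.
Context {R : realType} {N : nat}.
Implicit Types (u : 'rV[R]_N -> R) (x y w v z b : 'rV[R]_N) (r e k p q M m : R).
Implicit Types (Omega : set 'rV[R]_N).

(** Here y maximises the gradient weighted by the distance to the sphere. Within half that distance
    of y the weight is at least half its value at y, so the gradient at most doubles. *)
Lemma weighted_grad_max Omega u x r : Cn 1 Omega u -> 0 < r -> eball x r `<=` Omega ->
  exists2 y, eball x r y &
    r * enorm (grad u x) <= (r - enorm (y - x)) * enorm (grad u y) /\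
    forall t, 0 <= t -> t <= (r - enorm (y - x)) / 2 ->
      eball y t `<=` eball x r /\
      forall z, eball y t z ->
        (r - enorm (y - x)) * enorm (grad u z) <=
        2 * ((r - enorm (y - x)) * enorm (grad u y)).
Proof.
move=> cu r0 xr.
pose f y := (r - enorm (y - x)) * enorm (grad u y).
have cf y : eball x r y -> {for y, continuous f}.
  move=> yr.
  have cs : {for y, continuous (fun y => enorm (y - x))}.
    apply: (@cvg_enorm _ _ _ (nbhs y) (fun y => y - x) (y - x)).
    by apply: (@continuousB _ _ _ id (cst x)); [exact: cvg_id|exact: cst_continuous].
  have cr : {for y, continuous (fun y => r - enorm (y - x))}.
    by apply: (@continuousB _ _ _ (cst r) (fun y => enorm (y - x))); [exact: cst_continuous|exact: cs].
  apply: (@continuousM _ _ (fun y => r - enorm (y - x)) (fun y => enorm (grad u y))) => //.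
  exact: (continuous_comp (continuous_grad cu (xr _ yr)) (@continuous_enorm _ _ (grad u y))).
have xx : eball x r x by apply: eball_center; exact: ltW.
have [y /set_mem yr ymax] := compact_EVT_max (ex_intro _ x xx) (@compact_eball _ _ x r)
  (continuous_within_eball cf).
exists y => //; split.
  by have /ymax := mem_set xx; rewrite /f subrr enorm0 subr0.
move=> t t0 td.
have yx : enorm (y - x) <= r by exact: yr.
have sub : eball y t `<=` eball x r by apply: eball_sub; move: td yx; clear; lra.
split=> // z zy.
have /mem_set/ymax := sub z zy; rewrite /f => h.
have zx : enorm (z - x) <= enorm (z - y) + enorm (y - x).
  by rewrite -[z - x](subrKA y); exact: enormD.
have : (r - enorm (y - x)) / 2 * enorm (grad u z) <= (r - enorm (z - x)) * enorm (grad u z).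
  rewrite ler_wpM2r ?enorm_ge0//; move: zx zy td; rewrite /eball/=; clear; lra.
by move: h; clear; lra.
Qed.

Lemma bounded_gradient_estimate p q M : (0 < N)%N -> 1 < p -> q = 2 * p / (p + 1) -> M0 N p <= M ->
  exists2 C, 0 < C & forall Omega u x0 R0 m,
    weak_solution Omega u (reaction p q M u) -> (forall x, Omega x -> 0 < u x) ->
    0 < m -> (forall x, Omega x -> u x <= m) ->
    0 < R0 -> eball x0 R0 `<=` Omega ->
    enorm (grad u x0) <= C * m * R0 `^ (- 1).
Proof.
move=> N0 p1 qE MM.
have [C1 C10 grd] := @gradient_estimate R N p q M N0 p1 qE MM.
have [Cl Cl0 lin] := @linear_gradient_estimate R N.
have M00 : 0 < M by apply: lt_le_trans MM; exact: M0_gt0.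
have pm : 0 < p - 1 by lra.
have pP : 0 < p + 1 by lra.
pose h := 2 / (p + 1).
have h0 : 0 < h by rewrite divr_gt0.
have hq : h = 2 - q by rewrite /h qE; field; rewrite gt_eqF.
have q0 : 0 < q by rewrite qE !mulr_gt0 ?invr_gt0//; lra.
pose Q := 16 * Cl ^+ 2 * M * 2 `^ q.
have Q0 : 0 < Q by rewrite !mulr_gt0 ?exprn_gt0// powR_gt0.
(* The bound 8 Cl makes th at most 1/2, and the root of Q gives Q m^h <= S^h, where h = 2 - q is the
   margin below quadratic growth in the gradient. *)
pose K := Num.max (8 * Cl) (Q `^ h^-1).
have K0 : 0 < K by rewrite lt_max mulr_gt0.
exists (Num.max C1 K); first by rewrite lt_max C10.
move=> Omega u x0 r m ws u0 m0 um r0 xr.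
have [oO cu _ _] := ws.
rewrite powR_inv1 ?(ltW r0)//.
(* In the first case r^(-2/(p-1)) <= m, and the universal bound, with exponent -2/(p-1) - 1,
   suffices. *)
have [big|small] := leP (r `^ (- 2)) (m `^ (p - 1)).
  apply: le_trans (grd _ _ _ _ ws u0 r0 xr) _.
  have -> : - ((p + 1) / (p - 1)) = - 2 / (p - 1) + - 1 by field; rewrite gt_eqF.
  rewrite powRD; last by rewrite (gt_eqF r0) implybT.
  rewrite powR_inv1 ?(ltW r0)// mulrA ler_pM2r ?invr_gt0//.
  apply: ler_pM; [exact: ltW|exact: powR_ge0|by rewrite le_max lexx|].
  rewrite powRrM -[leRHS](powRr1 (ltW m0)) -[X in m `^ X](@mulfV _ (p - 1)) ?gt_eqF//.
  rewrite (powRrM m); apply: ge0_ler_powR; rewrite ?nnegrE ?powR_ge0//.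
  by rewrite invr_ge0 ltW.
have [y yr [yx near_y]] := weighted_grad_max cu r0 xr.
set d := r - enorm (y - x0) in yx near_y.
have d_ge0 : 0 <= d by rewrite subr_ge0; exact: yr.
have dr : d <= r by rewrite lerBlDr lerDl enorm_ge0.
set S := d * enorm (grad u y) in yx near_y.
suff SK : S <= K * m.
  rewrite ler_pdivlMr// mulrC; apply: le_trans yx _; apply: le_trans SK _.
  by rewrite ler_pM2r// le_max lexx orbT.
rewrite leNgt; apply/negP => big.
have S0 : 0 < S by apply: le_lt_trans big; rewrite mulr_ge0// ltW.
have d0 : 0 < d.
  rewrite lt_def d_ge0 andbT; apply/eqP => dE; move: S0.
  by rewrite /S dE mul0r ltxx.
have [S1 S2] : 8 * Cl * m < S /\ Q `^ h^-1 * m < S.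
  by split; apply: le_lt_trans big; rewrite ler_pM2r// le_max lexx ?orbT.
have Sg : enorm (grad u y) = S / d by rewrite /S mulrAC divff ?mul1r// gt_eqF.
clearbody S.
(* On the ball of radius th d the term m / (th d) of the linear estimate contributes exactly S/4. *)
pose th := 4 * Cl * m / S.
have th0 : 0 < th by rewrite divr_gt0// !mulr_gt0.
have th2 : th <= 1 / 2 by rewrite ler_pdivrMr//; move: S1; clear; lra.
have t0 : 0 < th * d by rewrite mulr_gt0.
have td : th * d <= d / 2 by rewrite mulrC ler_pM2l// -div1r.
have [sub ygrad] := near_y _ (ltW t0) td.
have yO : eball y (th * d) `<=` Omega by exact: subset_trans xr.
have ub z : eball y (th * d) z -> `|u z| <= m.
  by move=> /yO Oz; rewrite ger0_norm ?um// ltW// u0.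
pose A := m `^ p + M * (2 * S / d) `^ q.
have A0 : 0 <= A by rewrite addr_ge0 ?powR_ge0// mulr_ge0 ?powR_ge0// ltW.
have Fb z : eball y (th * d) z -> `|reaction p q M u z| <= A.
  move=> zy; have Oz := yO _ zy.
  have g1 : enorm (grad u z) <= 2 * S / d by rewrite ler_pdivlMr// mulrC ygrad.
  have u1 : u z `^ p <= m `^ p.
    apply: ge0_ler_powR; rewrite ?nnegrE ?um ?(ltW m0) ?(ltW (u0 _ Oz))//.
    by move: p1; clear; lra.
  have g2 : enorm (grad u z) `^ q <= (2 * S / d) `^ q.
    apply: ge0_ler_powR => //; rewrite ?nnegrE ?enorm_ge0 ?(ltW q0)//.
    exact: le_trans (enorm_ge0 _) g1.
  rewrite ger0_norm /reaction; last by rewrite addr_ge0 ?powR_ge0// mulr_ge0 ?powR_ge0// ltW.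
  by rewrite lerD// ler_pM2l.
have := lin _ _ _ _ _ _ _ ws t0 yO (ltW m0) A0 ub Fb.
rewrite Sg ler_pdivrMr// => main.
have dm : d ^+ 2 * m `^ (p - 1) <= 1.
  have : m `^ (p - 1) * d ^+ 2 <= (r ^+ 2)^-1 * r ^+ 2.
    apply: ler_pM; [exact: powR_ge0|exact: sqr_ge0| |by rewrite lerXn2r// nnegrE// ltW].
    by move: (ltW small); rewrite powRN powR_mulrn// ltW.
  by rewrite mulVf ?gt_eqF ?exprn_gt0// mulrC.
have T1 : Cl * th * (d ^+ 2 * m `^ p) <= S / 8.
  rewrite -(mulr_powRB1 (ltW m0)); last by move: p1; clear; lra.
  have -> : d ^+ 2 * (m * m `^ (p - 1)) = m * (d ^+ 2 * m `^ (p - 1)) by ring.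
  apply: (@le_trans _ _ (Cl * th * (m * 1))).
    by rewrite (ler_pM2l (mulr_gt0 Cl0 th0)) (ler_pM2l m0).
  rewrite mulr1; apply: (@le_trans _ _ (Cl * (1 / 2) * m)).
    by rewrite ler_pM2r// ler_pM2l.
  by move: S1 (mulr_gt0 Cl0 m0); clear; lra.
(* The (p+1)-st root of m^(p+1) d^2 = m^2 (m^(p-1) d^2) <= m^2. *)
have dh : m * d `^ h <= m `^ h.
  have -> : d `^ h = (d ^+ 2) `^ (p + 1)^-1 by rewrite /h powRrM powR_mulrn.
  have mE : m = (m `^ (p + 1)) `^ (p + 1)^-1.
    by rewrite -powRrM mulfV ?gt_eqF// powRr1// ltW.
  rewrite [X in X * _]mE -powRM ?powR_ge0 ?sqr_ge0// /h [leRHS]powRrM.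
  apply: ge0_ler_powR; rewrite ?nnegrE ?powR_ge0 ?invr_ge0 ?(ltW pP) ?mulr_ge0 ?powR_ge0 ?sqr_ge0//.
  rewrite (_ : p + 1 = 2 + (p - 1)); last by ring.
  rewrite powRD; last by rewrite (gt_eqF m0) implybT.
  rewrite -mulrA ler_piMr ?powR_ge0//.
  by rewrite mulrC.
have Qm : Q * (m * d `^ h) <= S `^ h.
  apply: (@le_trans _ _ (Q * m `^ h)); first by rewrite ler_pM2l.
  have -> : Q * m `^ h = (Q `^ h^-1 * m) `^ h.
    by rewrite powRM ?powR_ge0 ?(ltW m0)// -powRrM mulVf ?gt_eqF// powRr1// ltW.
  apply: ge0_ler_powR; rewrite ?nnegrE ?(ltW h0) ?(ltW S0) ?(ltW S2)//.
  by rewrite mulr_ge0 ?powR_ge0// ltW.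
have SS : S `^ q * S `^ h = S ^+ 2.
  by rewrite -powRD ?(gt_eqF S0) ?implybT// hq addrC subrK powR_mulrn// ltW.
have dd : d `^ q * d `^ h = d ^+ 2.
  by rewrite -powRD ?(gt_eqF d0) ?implybT// hq addrC subrK powR_mulrn// ltW.
have dS : d ^+ 2 * (2 * S / d) `^ q = 2 `^ q * S `^ q * d `^ h.
  have Sd0 : 0 <= 2 * S / d by rewrite divr_ge0 ?mulr_ge0// ltW.
  rewrite -dd mulrAC -(powRM _ d_ge0 Sd0).
  have -> : d * (2 * S / d) = 2 * S by field; rewrite gt_eqF.
  by rewrite powRM// ltW.
have T2 : Cl * th * (d ^+ 2 * (M * (2 * S / d) `^ q)) <= S / 4.
  have -> : Cl * th * (d ^+ 2 * (M * (2 * S / d) `^ q)) =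
    Q * (m * d `^ h) * S `^ q / (4 * S).
    have -> : Cl * th * (d ^+ 2 * (M * (2 * S / d) `^ q)) =
      Cl * th * M * (d ^+ 2 * (2 * S / d) `^ q) by ring.
    rewrite dS /th /Q; move: (2 `^ q) (S `^ q) (d `^ h) => X1 X2 X3.
    by field; rewrite gt_eqF.
  rewrite ler_pdivrMr ?mulr_gt0//.
  apply: (@le_trans _ _ (S `^ h * S `^ q)); first by rewrite ler_wpM2r ?powR_ge0.
  by rewrite mulrC SS le_eqVlt; apply/orP; left; apply/eqP; field.
have mainE : Cl * (m / (th * d) + th * d * A) * d =
    S / 4 + Cl * th * (d ^+ 2 * m `^ p) + Cl * th * (d ^+ 2 * (M * (2 * S / d) `^ q)).
  rewrite /A /th; move: (m `^ p) ((2 * S / d) `^ q) => X1 X2.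
  by field; rewrite !gt_eqF.
(* The three contributions are at most S/4, S/8 and S/4, in total less than S. *)
move: main; rewrite mainE; move: T1 T2 S0.
move: (Cl * th * (d ^+ 2 * m `^ p)) (Cl * th * _) => X1 X2; clear; lra.
Qed.

End bounded_solutions.

(** * From balls to domains and the whole space *)

Theorem theorem1p6 (R : realType) (N : nat) (p q M : R) :
  (2 <= N)%N -> 1 < p -> q = 2 * p / (p + 1) -> M0 N p <= M ->
  [/\ exists C : R, 0 < C /\
        forall (Omega : set 'rV[R]_N) (u : 'rV[R]_N -> R),
          domain Omega -> positive_solution p q M Omega u ->
          forall x, Omega x ->
            u x + enorm (grad u x) `^ (2 / (p + 1))
              <= C * distN (2 / (p - 1)) x Omega,
      ~ (exists u : 'rV[R]_N -> R, positive_solution p q M setT u) &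
      exists C : R, 0 < C /\
        forall (Omega : set 'rV[R]_N) (m : R) (u : 'rV[R]_N -> R),
          domain Omega -> 0 < m -> positive_solution p q M Omega u ->
          (forall x, Omega x -> u x <= m) ->
          forall x, Omega x ->
            enorm (grad u x) <= C * m * distN 1 x Omega].
Proof.
move=> N2 p1 qE MM.
have N0 : (0 < N)%N by exact: leq_trans N2.
have pm : 0 < p - 1 by lra.
have pP : 0 < p + 1 by lra.
have q0 : 0 < q by rewrite qE !mulr_gt0 ?invr_gt0//; lra.
have s0 : 0 < 2 / (p - 1) by rewrite divr_gt0.
have [Cg Cg0 grd] := @gradient_estimate R N p q M N0 p1 qE MM.
have [Cu Cu0 sol] := @solution_estimate R N p q M N0 p1 qE MM.
have [Cb Cb0 bgrd] := @bounded_gradient_estimate R N p q M N0 p1 qE MM.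
have C0 : 0 < Cu + Cg `^ (2 / (p + 1)) by rewrite addr_gt0// powR_gt0.
have bound (Omega : set 'rV[R]_N) u x : open Omega -> positive_solution p q M Omega u -> Omega x ->
    u x + enorm (grad u x) `^ (2 / (p + 1)) <=
    (Cu + Cg `^ (2 / (p + 1))) * 2 `^ (2 / (p - 1)) * distN (2 / (p - 1)) x Omega.
  move=> oO ps Ox; have ws := positive_solution_weak q0 oO ps; have [_ u0] := ps.
  apply: distN_bound => // r r0 xr.
  rewrite [leRHS]mulrDl lerD//; first exact: (sol _ _ _ _ ws u0 r0 xr).
  (* Raised to the power 2/(p+1), the gradient bound scales like the bound on u. *)
  have -> : - (2 / (p - 1)) = - ((p + 1) / (p - 1)) * (2 / (p + 1)) by field; rewrite !gt_eqF.
  rewrite (powRrM r) -powRM ?powR_ge0 ?(ltW Cg0)//.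
  apply: ge0_ler_powR; rewrite ?nnegrE ?enorm_ge0 ?mulr_ge0 ?powR_ge0 ?invr_ge0 ?(ltW Cg0) ?(ltW pP)//.
  exact: (grd _ _ _ _ ws u0 r0 xr).
split.
- exists ((Cu + Cg `^ (2 / (p + 1))) * 2 `^ (2 / (p - 1))); split.
    by rewrite mulr_gt0// powR_gt0.
  by move=> Omega u [_ oO _] ps x; exact: bound.
- move=> [u ps]; have [_ u0] := ps.
  have := bound setT u 0 openT ps I.
  (* The whole space has empty boundary, so the distance is +oo and its negative power 0, whereas
     u(0) > 0. *)
  have -> : distN (2 / (p - 1)) (0 : 'rV[R]_N) setT = 0.
    rewrite /distN /dist (_ : boundary setT = set0) ?image_set0 ?ereal_inf0//.
    by rewrite /boundary interiorT setDT.
  rewrite mulr0; apply/negP; rewrite -ltNge.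
  by rewrite ltr_wpDr ?powR_ge0// u0.
- exists (Cb * 2 `^ 1); split; first by rewrite mulr_gt0// powR_gt0.
  move=> Omega m u [_ oO _] m0 ps um x Ox.
  have ws := positive_solution_weak q0 oO ps; have [_ u0] := ps.
  rewrite (mulrAC Cb); apply: distN_bound => //; first exact: mulr_gt0.
  by move=> r r0 xr; exact: (bgrd _ _ _ _ _ ws u0 m0 um r0 xr).
Qed.
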